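(* Suppose Assumptions 1 and 2 of the context hold, and fix $\epsilon\in(0,1)$. Let $c_\gamma=\frac{2}{1-\gamma^2}$. 1. If $\kappa<1$ and Assumption 3 of the context holds with bound $B$, put $C_1=\frac{3c_\gamma^2\vartheta}{(1-\kappa)^3}$. Then every depth (integer $\ell\ge 0$) with $$\ell\ \ge\ \frac{3\log\big(3B^{2/3}C_1^{1/3}/\epsilon\big)}{\log(1/\kappa)}$$ satisfies $\mathcal{E}(\ell)\le\mathcal{E}(\infty)+\epsilon$, where $\mathcal{E}(\infty)=\lim_{\ell'\to\infty}\mathcal{E}(\ell')$. 2. If $\kappa>1$, put $c_0=\frac{\vartheta^2}{8c_\gamma^2}$. Then $\mathcal{E}(\ell)\le\frac{16}{\kappa-1}+\epsilon$ for every $\ell\ge\ell_1$, where $\ell_1=\ell_1(\epsilon)$ is the smallest depth $\ell\ge 4/\log\kappa$ satisfying the three conditions $$\kappa^{\ell/2}\ge\frac{6}{\epsilon},\qquad c_0(\kappa-1)\,\kappa^{\ell/2-1}\ \ge\ \ell^2\log\frac{3}{\epsilon},\qquad \frac{\vartheta}{2}\,\kappa^\ell\ \ge\ \log\frac{3}{\epsilon}.$$ These conditions, once satisfied at some depth $\ge 4/\log\kappa$, persist for all larger depths. The first is the binding one as $\epsilon\to0$, so that $\ell_1=2\log_\kappa(6/\epsilon)+O(\log\log(1/\epsilon))$ as $\epsilon\to0$, with implied constant depending only on the model. In both regimes, depth $O(\log(1/\epsilon))$ (with implied constant depending only on the model, independent of any graph size) suffices for the stated conclusion.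
   Context: Parameters. Constants $a>b>0$; $\Delta=\frac{a+b}{2}$, assumed $>1$; $\gamma=\frac{a-b}{a+b}\in(0,1)$; $\kappa=\gamma^2\Delta$. Limit object $(T,o,y,X)$. $T$ is a Poisson Galton--Watson tree rooted at $o$: every vertex independently has $\mathrm{Poi}(\Delta)$ children. Labels $y_v\in\{\pm1\}$ follow a broadcast process: $y_o$ is uniform on $\{\pm1\}$ and, independently along edges and of the tree shape, each child has its parent's label with probability $\frac{1+\gamma}{2}$ and the opposite label with probability $\frac{1-\gamma}{2}$. Given the tree and labels, the features $X_v\in\mathbb{R}^d$ are independent with $X_v\sim\mathbb{P}_{y_v}$, where $\mathbb{P}_+,\mathbb{P}_-$ are two given probability laws on $\mathbb{R}^d$. $N_k$ is the set of vertices at graph distance exactly $k$ from $o$. All probabilities and expectations are on this object. Features and classifier. $\rho_\pm$ are the densities of $\mathbb{P}_\pm$ with respect to a common base measure $\mu$; $\psi=\rho_+/\rho_-$; $t(x)=\frac{\rho_+(x)-\rho_-(x)}{\rho_+(x)+\rho_-(x)}\in[-1,1]$, so $\log\psi=2\operatorname{artanh}(t)$. For $k\ge0$, $M_k(x)=2\operatorname{artanh}(\gamma^k t(x))$. For $\ell\ge 0$, $$T_\ell=\sum_{k=0}^{\ell}\sum_{v\in N_k}M_k(X_v),\qquad \mathcal{E}(\ell)=\mathbb{P}(y_oT_\ell\le 0)$$ (ties count as errors). $\mathbb{E}_+$ denotes expectation under $X\sim\mathbb{P}_+$. When $\kappa<1$ and Assumptions 1--3 hold, the limit $\lim_{\ell\to\infty}\mathcal{E}(\ell)$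 exists. Assumption 1. $\mathbb{P}_+$ and $\mathbb{P}_-$ are mutually absolutely continuous, with densities $\rho_\pm$ with respect to $\mu$, and there is a $\mu$-measure-preserving involution $\tau:\mathbb{R}^d\to\mathbb{R}^d$ with $\rho_-(x)=\rho_+(\tau(x))$ for $\mu$-a.e. $x$. Assumption 2. $\vartheta:=\mathbb{E}_+[t(X)^2]>0$. Assumption 3. Under $X\sim\mathbb{P}_+$, the random variable $\log\psi(X)$ has a density on $\mathbb{R}$ bounded by $B<\infty$. *)

(* Defs.v *)
From HB Require Import structures.
From mathcomp Require Import all_boot all_order all_algebra.
From mathcomp Require Import all_classical all_reals all_analysis.
Import Order.TTheory GRing.Theory Num.Theory.
Import numFieldNormedType.Exports.

Set Implicit Arguments.
Unset Strict Implicit.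
Unset Printing Implicit Defensive.

Local Open Scope classical_set_scope.
Local Open Scope ring_scope.

Definition artanh (R : realType) (u : R) : R := ln ((1 + u) / (1 - u)) / 2.

Definition Delta (R : realType) (a b : R) : R := (a + b) / 2.
Definition gamma (R : realType) (a b : R) : R := (a - b) / (a + b).
Definition kappa (R : realType) (a b : R) : R := gamma a b ^+ 2 * Delta a b.
Definition cgamma (R : realType) (a b : R) : R := 2 / (1 - gamma a b ^+ 2).

(* R^d is [d.-tuple R] with its product (hence Borel) sigma-algebra.
   The base measure need not be sigma-finite. *)
Definition has_density (R : realType) (d : nat)
    (mu : {measure set (d.-tuple R) -> \bar R})
    (P : probability (d.-tuple R) R) (rho : d.-tuple R -> R) : Prop :=
  [/\ measurable_fun setT rho, forall x, 0 <= rho x &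
      forall A, measurable A -> P A = (\int[mu]_(x in A) (rho x)%:E)%E].

Definition psi (R : realType) (d : nat) (rhop rhom : d.-tuple R -> R)
    (x : d.-tuple R) : R := rhop x / rhom x.

(* Total division gives the value 0 where both densities vanish, which is a
   null set for both laws. *)
Definition tfun (R : realType) (d : nat) (rhop rhom : d.-tuple R -> R)
    (x : d.-tuple R) : R := (rhop x - rhom x) / (rhop x + rhom x).

(* For k = 0 the argument of artanh may be 1 or -1 (junk value), but only
   where exactly one density vanishes: null for both laws when they are
   mutually absolutely continuous. *)
Definition Mfun (R : realType) (d : nat) (a b : R) (rhop rhom : d.-tuple R -> R)
    (k : nat) (x : d.-tuple R) : R :=
  2 * artanh (gamma a b ^+ k * tfun rhop rhom x).

Definition theta (R : realType) (d : nat) (Pp : probability (d.-tuple R) R)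
    (rhop rhom : d.-tuple R -> R) : R :=
  fine ('E_Pp [(fun x => tfun rhop rhom x ^+ 2)%R]).

Definition assumption1 (R : realType) (d : nat)
    (Pp Pm : probability (d.-tuple R) R)
    (mu : {measure set (d.-tuple R) -> \bar R})
    (rhop rhom : d.-tuple R -> R) : Prop :=
  [/\ Pp `<< Pm, Pm `<< Pp, has_density mu Pp rhop, has_density mu Pm rhom &
      exists tau : d.-tuple R -> d.-tuple R,
        [/\ measurable_fun setT tau,
            involutive tau,
            forall A, measurable A -> mu (tau @^-1` A) = mu A &
            {ae mu, forall x, rhom x = rhop (tau x)}]].

Definition assumption2 (R : realType) (d : nat)
    (Pp : probability (d.-tuple R) R) (rhop rhom : d.-tuple R -> R) : Prop :=
  0 < theta Pp rhop rhom.

Definition assumption3 (R : realType) (d : nat)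
    (Pp : probability (d.-tuple R) R) (rhop rhom : d.-tuple R -> R) (B : R)
    : Prop :=
  exists f : R -> R,
    [/\ measurable_fun setT f, forall z, 0 <= f z <= B &
        forall A : set R, measurable A ->
          Pp [set x | A (ln (psi rhop rhom x))]
          = (\int[lebesgue_measure]_(z in A) (f z)%:E)%E].

(* Ulam-Harris addresses, written from the vertex up to the root: [::] is the
   root and i :: v is the i-th child of v. The graph distance of v to the root
   is size v. *)
Definition vertex := seq nat.

(* The vertices of generation k when v has n v children. *)
Fixpoint generation (n : vertex -> nat) (k : nat) : seq vertex :=
  if k is k'.+1
  then [seq i :: v | v <- generation n k', i <- iota 0 (n v)]
  else [:: [::]].

(* F lists, without repetition, the vertices of a finite rooted subtree of the
   tree with offspring numbers n. *)
Definition rooted_subtree (n : vertex -> nat) (F : seq vertex) : Prop :=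
  [/\ uniq F, [::] \in F &
      forall (i : nat) (v : vertex), i :: v \in F -> v \in F /\ (i < n v)%N].

(* Conditional probability that v has the label s v, given its ancestors'
   labels; [true] stands for the label +1 and [false] for -1. *)
Definition label_prob (R : realType) (g : R) (s : vertex -> bool) (v : vertex)
    : R :=
  if v is _ :: u then (if s v == s u then (1 + g) / 2 else (1 - g) / 2)
  else 1 / 2.

(* A realization (T, o, y, X) of the limit object on some probability space.
   Its law is prescribed through the probabilities that a given finite rooted
   subtree F occurs with prescribed offspring numbers, labels and feature
   events. Such F consist of vertices of T, so nothing is required of the
   values of children, label and feature at addresses outside T. *)
Record limit_object (R : realType) (d : nat) (a b : R)
    (Pp Pm : probability (d.-tuple R) R) := LimitObject {
  lo_display : measure_display;
  lo_space : measurableType lo_display;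
  lo_prob : probability lo_space R;
  children : vertex -> lo_space -> nat;
  label : vertex -> lo_space -> bool;
  feature : vertex -> lo_space -> d.-tuple R;
  measurable_children : forall v, measurable_fun setT (children v);
  measurable_label : forall v, measurable_fun setT (label v);
  measurable_feature : forall v, measurable_fun setT (feature v);
  lo_law : forall (F : seq vertex) (n : vertex -> nat) (s : vertex -> bool)
      (A : vertex -> set (d.-tuple R)),
    rooted_subtree n F -> (forall v, measurable (A v)) ->
    lo_prob [set w | forall v, v \in F ->
               [/\ children v w = n v, label v w = s v & A v (feature v w)]]
    = (\prod_(v <- F) (poisson_pmf (Delta a b) (n v)
                       * label_prob (gamma a b) s v
                       * fine ((if s v then Pp else Pm) (A v))))%:E
}.

Definition label_value (R : realType) (s : bool) : R := if s then 1 else -1.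

Definition Tstat (R : realType) (d : nat) (a b : R)
    (Pp Pm : probability (d.-tuple R) R) (L : limit_object a b Pp Pm)
    (rhop rhom : d.-tuple R -> R) (l : nat) (w : lo_space L) : R :=
  \sum_(k < l.+1) \sum_(v <- generation (fun u => children u w) k)
     Mfun a b rhop rhom k (feature v w).

Definition error (R : realType) (d : nat) (a b : R)
    (Pp Pm : probability (d.-tuple R) R) (L : limit_object a b Pp Pm)
    (rhop rhom : d.-tuple R -> R) (l : nat) : R :=
  fine (lo_prob L [set w | label_value R (label [::] w)
                             * Tstat rhop rhom l w <= 0]).

Definition C1 (R : realType) (a b th : R) : R :=
  3 * cgamma a b ^+ 2 * th / (1 - kappa a b) ^+ 3.

Definition c0 (R : realType) (a b th : R) : R :=
  th ^+ 2 / (8 * cgamma a b ^+ 2).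

Definition cond1 (R : realType) (a b eps : R) (l : nat) : Prop :=
  6 / eps <= kappa a b `^ (l%:R / 2).

Definition cond2 (R : realType) (a b th eps : R) (l : nat) : Prop :=
  l%:R ^+ 2 * ln (3 / eps)
  <= c0 a b th * (kappa a b - 1) * kappa a b `^ (l%:R / 2 - 1).

Definition cond3 (R : realType) (a b th eps : R) (l : nat) : Prop :=
  ln (3 / eps) <= th / 2 * kappa a b ^+ l.

Definition admissible_depth (R : realType) (a b th eps : R) (l : nat) : Prop :=
  [/\ 4 / ln (kappa a b) <= l%:R, cond1 a b eps l, cond2 a b th eps l &
      cond3 a b th eps l].

Definition smallest_admissible (R : realType) (a b th eps : R) (l : nat)
    : Prop :=
  admissible_depth a b th eps l /\
  forall l', admissible_depth a b th eps l' -> (l <= l')%N.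

Definition log_depth_suffices (R : realType) (good : R -> nat -> Prop) : Prop :=
  exists D : R -> nat,
    ((fun eps => (D eps)%:R : R) =O_ (at_right (0 : R)) (fun eps => ln (1 / eps) : R)) /\
    forall (eps : R) (l : nat), 0 < eps < 1 -> (D eps <= l)%N -> good eps l.

(* Main.v *)
Require Import Defs.
From HB Require Import structures.
From mathcomp Require Import all_boot all_order all_algebra.
From mathcomp Require Import all_classical all_reals all_analysis.
From mathcomp Require Import measurable_realfun ring lra.
Import Order.TTheory GRing.Theory Num.Theory.
Import numFieldNormedType.Exports.

Local Open Scope classical_set_scope.
Local Open Scope ring_scope.

Set Implicit Arguments.
Unset Strict Implicit.
Unset Printing Implicit Defensive.

(** Given the tree and the labels up to generation k, the labels, offspring
    numbers and features of generation k + 1 are independent, with means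
    proportional to the parents' labels. This gives recursions for the first two
    moments of S_k, the sum of M_k(X_v) over generation k. The involution makes M_k
    centred up to sign, with E_+[M_k] = E_+[t M_k] of order gamma^k theta, so that
    y_o S_k has mean of order theta kappa^k.

    If kappa < 1, then E[S_k^2] is of order kappa^k; by a Cauchy-Schwarz inequality
    with weights kappa^(k/2) the tail T_l' - T_l is of order kappa^(l/2) in L^2. It
    changes the sign of y_o T_l only where y_o T_l' or y_o T_l is small, and this is
    unlikely since the feature of the root is independent of the other ones and its
    log-likelihood ratio has a bounded density.

    If kappa > 1, then y_o S_k has variance at most mean * (const + mean / (kappa - 1)),
    and Chebyshev's inequality with the means as weights shows that y_o (T_l - M_0(X_o))
    exceeds half of its mean with the stated probability, while y_o M_0(X_o) <= -s
    has probability at most exp(-s). *)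

(** * Integrable functions with a prescribed integral *)

(** The limit object is given only through probabilities of finite rooted subtrees of a random tree,
    so conditioning on a generation is done by hand. The tree and the labels up to generation k take
    countably many values; on each corresponding event (an atom) the next generation has an explicit
    finite product law. Integrals are compared atom by atom and added up, which is safe for
    nonnegative integrands. For this reason the recursion carries [E[(y_o S_k - c)^2]] for every
    real c rather than a mean and a variance: the integrand is nonnegative, and one identity in c
    contains both moments.

    For k > 0 the score M_k is bounded, since gamma^k t stays away from 1 and -1. M_0 is not, so the
    root feature is kept out of all moment computations: it enters only through its bounded density
    (kappa < 1) or its exponential tail (kappa > 1).

    For kappa > 1 second moments are enough: Chebyshev's inequality leaves a term 4 / (kappa - 1),
    the branching fluctuation that depth does not remove, and 16 / (kappa - 1) has room for it. *)

Section HasInt.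
Context {dT} {T : measurableType dT} {R : realType}
  (m : {measure set T -> \bar R}).
Implicit Types (E : set T) (f g : T -> R) (r : R).

(** Integrability is bundled with a real value, so that linear combinations of integrals are
    computed by [ring] and [field] in [R] and never meet an undefined difference in [\bar R]. *)
Definition has_int E f r : Prop :=
  [/\ measurable E, m.-integrable E (EFin \o f) &
      (\int[m]_(x in E) (f x)%:E = r%:E)%E].

Lemma has_int_ge0 E f r : measurable E -> measurable_fun E f ->
  (forall x, E x -> 0 <= f x) -> (\int[m]_(x in E) (f x)%:E = r%:E)%E ->
  has_int E f r.
Proof.
move=> mE mf f0 fr; split => //; apply/integrableP; split.
  exact/measurable_EFinP.
rewrite [X in (X < _)%E](_ : _ = r%:E) ?ltry// -fr.
by apply: eq_integral => x /[!inE] Ex /=; rewrite ger0_norm// f0.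
Qed.

Lemma has_int_ext E f g r : (forall x, E x -> f x = g x) ->
  has_int E f r -> has_int E g r.
Proof.
move=> fg [mE fi fr]; split => //.
  by apply: (eq_integrable mE) fi => x /[!inE] Ex /=; rewrite fg.
by rewrite -fr; apply: eq_integral => x /[!inE] Ex; rewrite fg.
Qed.

Lemma has_int_measurable E f r : has_int E f r -> measurable_fun E f.
Proof. by move=> [_ fi _]; apply/measurable_EFinP/(measurable_int _ fi). Qed.

Lemma has_intD E f g r s : has_int E f r -> has_int E g s ->
  has_int E (fun x => f x + g x) (r + s).
Proof.
move=> [mE fi fr] [_ gi gs]; split => //.
  exact: eq_integrable (integrableD mE fi gi).
by rewrite EFinD -fr -gs -integralD.
Qed.

Lemma has_intZ E f r (c : R) : has_int E f r ->
  has_int E (fun x => c * f x) (c * r).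
Proof.
move=> [mE fi fr]; split => //.
  exact: eq_integrable (integrableZl mE c fi).
by rewrite EFinM -fr -integralZl.
Qed.

Lemma has_intB E f g r s : has_int E f r -> has_int E g s ->
  has_int E (fun x => f x - g x) (r - s).
Proof.
move=> fi gi; have := has_intD fi (has_intZ (-1) gi).
by rewrite mulN1r; apply: has_int_ext => x _; rewrite mulN1r.
Qed.

Lemma has_int_sum E (I : eqType) (s : seq I) (f : I -> T -> R) (r : I -> R) :
  measurable E -> (forall i, i \in s -> has_int E (f i) (r i)) ->
  has_int E (fun x => \sum_(i <- s) f i x) (\sum_(i <- s) r i).
Proof.
move=> mE; elim: s => [|i s IH] fi.
  rewrite big_nil; split => //.
    have := integrable0 m E.
    by apply: (eq_integrable mE) => x _ /=; rewrite big_nil.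
  by under eq_integral do rewrite big_nil; rewrite integral0.
rewrite big_cons; apply: (@has_int_ext _ (fun x => f i x + \sum_(j <- s) f j x)).
  by move=> x _; rewrite big_cons.
apply: has_intD => //; first by apply: fi; rewrite mem_head.
by apply: IH => j js; apply: fi; rewrite in_cons js orbT.
Qed.

Lemma has_int_cst E (r c : R) : measurable E -> m E = r%:E ->
  has_int E (fun=> c) (c * r).
Proof.
move=> mE Er.
have h1 : has_int E (fun=> 1) r.
  apply: has_int_ge0 => //.
  by rewrite integral_cst// mul1e.
by have := has_intZ c h1; apply: has_int_ext => x _; exact: mulr1.
Qed.

Lemma has_int_setU E F f r s : [disjoint E & F] ->
  has_int E f r -> has_int F f s -> has_int (E `|` F) f (r + s).
Proof.
move=> EF fE fF; have [mE fi fr] := fE; have [mF gi gs] := fF.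
have mfU : measurable_fun (E `|` F) (EFin \o f).
  by apply/measurable_EFinP/measurable_funU => //; split;
    [exact: has_int_measurable fE|exact: has_int_measurable fF].
split; first exact: measurableU.
  apply/integrableP; split => //.
  rewrite ge0_integral_setU//; last exact: measurableT_comp.
  by apply: lte_add_pinfty; [case/integrableP: fi|case/integrableP: gi].
by rewrite EFinD -fr -gs integral_setU.
Qed.

Lemma has_int_le E f g r s : has_int E f r -> has_int E g s ->
  (forall x, E x -> f x <= g x) -> r <= s.
Proof.
move=> [mE fi fr] [_ gi gs] fg.
rewrite -lee_fin -fr -gs; apply: le_integral => // x /[!inE] Ex.
by rewrite lee_fin fg.
Qed.

Lemma has_int_integrable E f : measurable E -> m.-integrable E (EFin \o f) ->
  has_int E f (fine (\int[m]_(x in E) (f x)%:E)%E).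
Proof.
by move=> mE fi; split => //; rewrite fineK//; exact: integrable_fin_num fi.
Qed.

Lemma has_int_fine E f r : has_int E f r ->
  r = fine (\int[m]_(x in E) (f x)%:E)%E.
Proof. by move=> [_ _ ->]. Qed.

Lemma has_int_norm E f r : has_int E f r ->
  has_int E (fun x => `|f x|) (fine (\int[m]_(x in E) `|f x|%:E)%E).
Proof.
by move=> [mE fi _]; apply: has_int_integrable => //; exact: integrable_norm.
Qed.

End HasInt.

(* The law of (X, Y) on the event E is c * (Q1 x Q2). *)
Section ProductLaw.
Context {dT} {T : measurableType dT} {R : realType} (P : probability T R).
Context {d1 d2} {S1 : measurableType d1} {S2 : measurableType d2}.
Variables (Q1 : probability S1 R) (Q2 : probability S2 R).
Variables (E : set T) (mE : measurable E).
Variables (X : T -> S1) (Y : T -> S2).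
Hypotheses (mX : measurable_fun setT X) (mY : measurable_fun setT Y).
Variable c : {nonneg R}.
Hypothesis joint : forall B B', measurable B -> measurable B' ->
  P (E `&` (X @^-1` B) `&` (Y @^-1` B')) = (c%:num%:E * (Q1 B * Q2 B'))%E.

(** Divided by [c], the image under [(X, Y)] of [P] restricted to [E] agrees with the product
    measure on rectangles, hence everywhere; Tonelli's theorem then gives the iterated integral. If
    [c = 0], the event [E] is null and both sides vanish. *)
Lemma ge0_integral_product_law (F : S1 * S2 -> \bar R) :
  measurable_fun setT F -> (forall z, 0 <= F z)%E ->
  (\int[P]_(w in E) F (X w, Y w) = c%:num%:E * \int[Q1]_x \int[Q2]_y F (x, y))%E.
Proof.
move=> mF F0.
have mXY : measurable_fun setT (fun w => (X w, Y w)).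
  exact: measurable_fun_pair.
have mFXY : measurable_fun setT (fun w => F (X w, Y w)).
  exact: measurableT_comp mXY.
have c00 : c%:num = 0 -> P E = 0%E.
  move=> c0; have := joint measurableT measurableT.
  by rewrite !preimage_setT !setIT c0 mul0e.
have [c0|c0] := eqVneq c%:num 0.
  rewrite c0 mul0e; apply: null_set_integral => //; last exact: c00.
  exact: measurable_funTS.
pose mr := mrestr P mE.
transitivity (\int[mr]_w F (X w, Y w))%E.
  rewrite -(setUv E) ge0_integral_setU//; last 3 first.
  - exact: measurableC.
  - by rewrite setUv.
  - by apply/disj_setPS => x [].
  rewrite [X in (_ + X)%E]null_set_integral ?adde0//; last 3 first.
  - exact: measurableC.
  - exact: measurable_funTS.
  - by rewrite /mr/= /mrestr setICl.
  by apply: eq_measure_integral => A mA AE; rewrite /mr/= /mrestr setIidl.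
have ci0 : (0 <= c%:num^-1)%R by rewrite invr_ge0.
pose ci : {nonneg R} := NngNum ci0.
pose m0 : {measure set T -> \bar R} := mscale ci mr.
pose m' : {measure set (S1 * S2) -> \bar R} :=
  measure_function_pushforward__canonical__measure_function_Measure m0 mXY.
have e1 : (\int[m']_z F z = ci%:num%:E * \int[mr]_w F (X w, Y w))%E.
  rewrite (ge0_integral_pushforward mXY)// preimage_setT.
  by rewrite /m0 ge0_integral_mscale// => x _; exact: F0.
have e2 : (\int[m']_z F z = \int[Q1 \x Q2]_z F z)%E.
  apply/esym/eq_measure_integral => A mA _.
  apply: product_measure_unique => // B B' mB mB'.
  rewrite /m'/= /pushforward/= /m0/= /mscale/= /mr/= /mrestr/=.
  have -> : (fun w => (X w, Y w)) @^-1` (B `*` B') `&` E =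
     E `&` (X @^-1` B) `&` (Y @^-1` B').
    by apply/seteqP; split => w /=; tauto.
  by rewrite joint// muleA -EFinM mulVf// mul1e.
have <- := fubini_tonelli1 F mF F0.
by rewrite -e2 e1 muleA -EFinM mulfV// mul1e.
Qed.

(** Each factor is split into its positive and negative parts, written [(|h| + h) / 2] and
    [(|h| - h) / 2]; the four nonnegative products recombine. *)
Lemma has_int_product_law (f : S1 -> R) (g : S2 -> R) (r s : R) :
  has_int Q1 setT f r -> has_int Q2 setT g s ->
  has_int P E (fun w => f (X w) * g (Y w)) (c%:num * (r * s)).
Proof.
have pos (f' : S1 -> R) (g' : S2 -> R) (r' s' : R) :
    (forall x, 0 <= f' x) -> (forall x, 0 <= g' x) ->
    has_int Q1 setT f' r' -> has_int Q2 setT g' s' ->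
    has_int P E (fun w => f' (X w) * g' (Y w)) (c%:num * (r' * s')).
  move=> f0 g0 hf hg; have [_ fi fr] := hf; have [_ gi gs] := hg.
  have mf : measurable_fun setT f' by exact: has_int_measurable hf.
  have mg : measurable_fun setT g' by exact: has_int_measurable hg.
  apply: has_int_ge0 => //.
  - apply: measurable_funM; apply: measurable_funTS;
    exact: measurableT_comp.
  - by move=> w _; rewrite mulr_ge0.
  rewrite (ge0_integral_product_law (F := fun z => (f' z.1 * g' z.2)%:E)); last 2 first.
  - apply/measurable_EFinP/measurable_funM; exact: measurableT_comp.
  - by move=> z; rewrite lee_fin mulr_ge0.
  rewrite EFinM; congr (_ * _)%E.
  transitivity (\int[Q1]_x ((f' x)%:E * s'%:E))%E.
    apply: eq_integral => x _; rewrite -gs -ge0_integralZl//=.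
    - exact/measurable_EFinP.
    - by move=> y _; rewrite lee_fin.
    - by rewrite lee_fin.
  rewrite ge0_integralZr//.
  - by rewrite fr EFinM.
  - exact/measurable_EFinP.
  - by move=> y _; rewrite lee_fin.
  - rewrite -gs; apply: integral_ge0 => y _; by rewrite lee_fin.
have dec d' (S : measurableType d') (Q : probability S R) (h : S -> R) t :
    has_int Q setT h t ->
    exists h1 h2 t1 t2, [/\ forall x, 0 <= h1 x, forall x, 0 <= h2 x,
      has_int Q setT h1 t1, has_int Q setT h2 t2 &
      t = t1 - t2 /\ forall x, h x = h1 x - h2 x].
  move=> hi.
  have hn := has_int_norm hi.
  exists (fun x => 2^-1 * (`|h x| + h x)), (fun x => 2^-1 * (`|h x| - h x)).
  do 2 eexists; split.
  - by move=> x; rewrite mulr_ge0//; have := ler_norm (- h x); rewrite normrN; lra.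
  - by move=> x; rewrite mulr_ge0//; have := ler_norm (h x); lra.
  - exact: has_intZ (has_intD hn hi).
  - exact: has_intZ (has_intB hn hi).
  - by split; [field | move=> x; field].
move=> /dec [f1 [f2 [r1 [r2 [f10 f20 fi1 fi2 [-> ef]]]]]].
move=> /dec [g1 [g2 [s1 [s2 [g10 g20 gi1 gi2 [-> eg]]]]]].
have := has_intD
  (has_intB (pos _ _ _ _ f10 g10 fi1 gi1) (pos _ _ _ _ f10 g20 fi1 gi2))
  (has_intB (pos _ _ _ _ f20 g20 fi2 gi2) (pos _ _ _ _ f20 g10 fi2 gi1)).
rewrite (_ : _ + _ = c%:num * ((r1 - r2) * (s1 - s2))); last by ring.
by apply: has_int_ext => w _; rewrite ef eg; ring.
Qed.

End ProductLaw.

(** * Atoms: the tree and its labels up to a given generation *)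

Section Tree.
Implicit Types (n : vertex -> nat) (v u : vertex) (k : nat).

Fixpoint alive n v : bool :=
  if v is i :: u then (i < n u)%N && alive n u else true.

Lemma mem_generation n k v : (v \in generation n k) = (size v == k) && alive n v.
Proof.
elim: k v => [|k IH] v; first by rewrite /= inE; case: v.
apply/allpairsPdep/idP => /= [[u [i [uk]]]|].
  rewrite mem_iota add0n /= => ilt ->.
  by move: uk; rewrite IH => /andP[/eqP<- au] /=; rewrite eqxx ilt.
case: v => [|i u]//= /andP[us /andP[il au]].
by exists u, i; rewrite IH mem_iota add0n /= il au andbT.
Qed.

Lemma generation_uniq n k : uniq (generation n k).
Proof.
elim: k => [//|k IH]; apply: allpairs_uniq_dep => //.
- by move=> v _; exact: iota_uniq.
- by move=> [v i] [v' i'] _ _ /= [-> ->].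
Qed.

Fixpoint ball n k : seq vertex :=
  generation n k ++ (if k is k'.+1 then ball n k' else [::]).

Let ballS n k : ball n k.+1 = generation n k.+1 ++ ball n k.
Proof. by []. Qed.

Lemma mem_ball n k v : (v \in ball n k) = (size v <= k)%N && alive n v.
Proof.
elim: k => [|k IH]; first by rewrite inE; case: v.
rewrite ballS mem_cat mem_generation IH [in RHS]leq_eqVlt ltnS.
by rewrite andb_orl.
Qed.

Lemma ball_uniq n k : uniq (ball n k).
Proof.
elim: k => [//|k IH]; rewrite ballS cat_uniq generation_uniq IH andbT.
apply/hasPn => v; rewrite mem_ball mem_generation => /andP[vk _].
by apply/negP => /andP[/eqP vk' _]; rewrite vk' ltnn in vk.
Qed.

(** The parents of [us] lie in the ball. Hence the law can be queried at any chosen vertices of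
    generation k + 1, in practice one or two, while the rest of that generation stays free. *)
Lemma rooted_subtree_ball n k us : uniq us -> {subset us <= generation n k.+1} ->
  rooted_subtree n (us ++ ball n k).
Proof.
move=> uus sus; split.
- rewrite cat_uniq uus ball_uniq andbT /=.
  apply/hasPn => v; rewrite mem_ball => /andP[vk _].
  apply/negP => /sus; rewrite mem_generation => /andP[/eqP vk' _].
  by rewrite vk' ltnn in vk.
- by rewrite mem_cat mem_ball /= orbT.
- move=> i v; rewrite !mem_cat !mem_ball => /orP[/sus|].
    by rewrite mem_generation /= => /andP[/eqP[->] /andP[-> ->]]; rewrite leqnn orbT.
  by move=> /= /andP[sv /andP[-> ->]]; rewrite (ltnW sv) orbT.
Qed.

(** The bound is [k.+1], not [k]: the offspring numbers of generation k already determine which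
    vertices form generation k + 1. *)
Lemma eq_generation n n' k j : {in ball n k, n =1 n'} -> (j <= k.+1)%N ->
  generation n j = generation n' j.
Proof.
move=> nn'; elim: j => [//|j IH] jk /=; rewrite -IH; last exact: ltnW.
congr flatten; apply/eq_in_map => v vj; rewrite nn'//.
move: vj; rewrite mem_generation mem_ball => /andP[/eqP -> ->].
by rewrite -ltnS jk.
Qed.

Lemma eq_ball n n' k j : {in ball n k, n =1 n'} -> (j <= k.+1)%N ->
  ball n j = ball n' j.
Proof.
move=> nn'; elim: j => [//|j IH] jk.
by rewrite !ballS -IH ?(ltnW jk)// (eq_generation nn' jk).
Qed.

Lemma generation_ball n k j v : v \in generation n j -> (j <= k)%N -> v \in ball n k.
Proof. by rewrite mem_generation mem_ball => /andP[/eqP -> ->] ->. Qed.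

Lemma root_ball n k : [::] \in ball n k.
Proof. by rewrite mem_ball. Qed.

End Tree.

(** * Countable partitions in place of conditional expectations *)

Section Fibers.
Context {dT} {T : measurableType dT} {R : realType} (P : {measure set T -> \bar R}).
Variable code : T -> nat.
Hypothesis mcode : forall w0, measurable [set w | code w = code w0].

Let fiber n := code @^-1` [set n].

Let mfiber n : measurable (fiber n).
Proof.
have [[w0 w0n]|no] := pselect (exists w0, code w0 = n).
  by have := mcode w0; rewrite w0n.
by rewrite (_ : fiber n = set0)// -subset0 => w /= wn; apply: no; exists w.
Qed.

Let fiberT : \bigcup_n fiber n = setT.
Proof. by rewrite -subTset => w _; exists (code w). Qed.

Let trivIset_fiber : trivIset setT fiber.
Proof. by move=> i j _ _ [w [/= <- <-]]. Qed.

Lemma measurable_fun_fibers {dS} {S : measurableType dS} (f : T -> S) :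
  (forall w0, exists h, measurable_fun setT h /\
     forall w, code w = code w0 -> f w = h w) ->
  measurable_fun setT f.
Proof.
move=> fh; rewrite -fiberT; apply/measurable_fun_bigcup => // n.
have [[w0 w0n]|no] := pselect (exists w0, code w0 = n).
  have [h [mh fhE]] := fh w0.
  apply: (eq_measurable_fun h); last exact: measurable_funTS.
  by move=> w /[!inE] /= wn; rewrite fhE// wn w0n.
rewrite (_ : fiber n = set0); first exact: measurable_fun_set0.
by rewrite -subset0 => w /= wn; apply: no; exists w.
Qed.

(** Sigma-additivity over the fibers of [code], which are countably many because [code] takes values
    in [nat]. *)
Lemma le_integral_fibers (f g : T -> \bar R) :
  measurable_fun setT f -> measurable_fun setT g ->
  (forall w, 0 <= f w)%E -> (forall w, 0 <= g w)%E ->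
  (forall w0, \int[P]_(w in [set w | code w = code w0]) f w <=
              \int[P]_(w in [set w | code w = code w0]) g w)%E ->
  (\int[P]_w f w <= \int[P]_w g w)%E.
Proof.
move=> mf mg f0 g0 fg.
rewrite -fiberT !ge0_integral_bigcup//; try by rewrite fiberT.
apply: lee_nneseries => n _; first by move=> _; apply: integral_ge0.
have [[w0 w0n]|no] := pselect (exists w0, code w0 = n).
  by have := fg w0; rewrite w0n.
rewrite (_ : fiber n = set0) ?integral_set0//.
by rewrite -subset0 => w /= wn; apply: no; exists w.
Qed.

Lemma eq_integral_fibers (f g : T -> \bar R) :
  measurable_fun setT f -> measurable_fun setT g ->
  (forall w, 0 <= f w)%E -> (forall w, 0 <= g w)%E ->
  (forall w0, \int[P]_(w in [set w | code w = code w0]) f w =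
              \int[P]_(w in [set w | code w = code w0]) g w)%E ->
  (\int[P]_w f w = \int[P]_w g w)%E.
Proof.
move=> mf mg f0 g0 fg; apply/eqP; rewrite eq_le.
by apply/andP; split; apply: le_integral_fibers => // w0; rewrite fg.
Qed.

End Fibers.

Section Atoms.
Context {R : realType} {d : nat} {a b : R} {Pp Pm : probability (d.-tuple R) R}
  {L : limit_object a b Pp Pm}.
Implicit Types (w : lo_space L) (k : nat) (v u : vertex).
Notation P := (lo_prob L).

Definition tree w : vertex -> nat := fun v => children v w.

Definition class_law (y : bool) : probability (d.-tuple R) R :=
  if y then Pp else Pm.

Definition flip_prob (p y : bool) : R :=
  if y == p then (1 + gamma a b) / 2 else (1 - gamma a b) / 2.

(** The offspring numbers of generation k are prescribed too. On an atom the vertices of generation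
    k + 1 are therefore fixed, while their labels, offspring numbers and features are still
    random. *)
Definition atom k w0 : set (lo_space L) :=
  [set w | forall v, v \in ball (tree w0) k ->
     children v w = children v w0 /\ label v w = label v w0].

(** [pickle] is injective on these finite lists, so the fibers of the code are exactly the atoms. *)
Definition atom_code k w : nat :=
  pickle [seq (v, (children v w, label v w)) | v <- ball (tree w) k].

Lemma atom_tree k w0 w : atom k w0 w -> {in ball (tree w0) k, tree w0 =1 tree w}.
Proof. by move=> aw v /aw[]. Qed.

Lemma atom_generation k w0 w j : atom k w0 w -> (j <= k.+1)%N ->
  generation (tree w) j = generation (tree w0) j.
Proof. by move=> aw jk; rewrite (eq_generation (atom_tree aw)). Qed.

Lemma atom_label k w0 w v : atom k w0 w -> v \in ball (tree w0) k ->
  label v w = label v w0.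
Proof. by move=> aw /aw[]. Qed.

Lemma atom_codeE k w0 : [set w | atom_code k w = atom_code k w0] = atom k w0.
Proof.
apply/seteqP; split => w /=.
  move=> /(pcan_inj pickleK) e.
  have eb : ball (tree w) k = ball (tree w0) k.
    have := congr1 (map fst) e; rewrite -!map_comp.
    by rewrite (@eq_map _ _ _ id)// (@eq_map _ _ (_ \o (fun v => (v, (children v w0, _)))) id)// !map_id.
  move: e; rewrite eb => /eq_in_map e v /e.
  by move=> [-> ->].
move=> aw; congr pickle.
rewrite (eq_ball (atom_tree aw) (leqnSn k)); apply/eq_in_map => v vb.
by move: vb; rewrite -(eq_ball (atom_tree aw) (leqnSn k)) => /aw[-> ->].
Qed.

Lemma measurable_all_in (s : seq vertex) (Q : vertex -> set (lo_space L)) :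
  (forall v, v \in s -> measurable (Q v)) ->
  measurable [set w | forall v, v \in s -> Q v w].
Proof.
elim: s => [|v s IH] mQ.
  by rewrite (_ : [set w | _] = setT)// -subTset.
rewrite (_ : [set w | _] = Q v `&` [set w | forall v, v \in s -> Q v w]).
  apply: measurableI; first by apply: mQ; rewrite mem_head.
  by apply: IH => u us; apply: mQ; rewrite in_cons us orbT.
apply/seteqP; split => w /=.
  by move=> Qw; split=> [|u us]; apply: Qw; rewrite in_cons ?eqxx ?us ?orbT.
by move=> [Qv Qs] u; rewrite in_cons => /predU1P[->//|/Qs].
Qed.

Lemma measurable_children_eq v n : measurable [set w : lo_space L | children v w = n :> nat].
Proof.
have := @measurable_children _ _ _ _ _ _ L v measurableT [set n] I.
by rewrite setTI.
Qed.

Lemma measurable_label_eq v y : measurable [set w : lo_space L | label v w = y :> bool].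
Proof.
have := @measurable_label _ _ _ _ _ _ L v measurableT [set y] I.
by rewrite setTI.
Qed.

Lemma measurable_atom k w0 : measurable (atom k w0).
Proof.
apply: (@measurable_all_in _ (fun v (w : lo_space L) => children v w = children v w0 /\
  label v w = label v w0)) => v _.
by apply: measurableI; [exact: measurable_children_eq|exact: measurable_label_eq].
Qed.

Lemma measurable_atom_code k w0 : measurable [set w | atom_code k w = atom_code k w0].
Proof. by rewrite atom_codeE; exact: measurable_atom. Qed.

(** The defining law at [us ++ ball], regrouped: the offspring and label factors of the ball
    multiply to the probability of the atom, and the features of the ball and the marks of [us]
    remain. The parent of [u] is [behead u], since an address lists the youngest index first. *)
Lemma atom_law_ext k w0 (us : seq vertex) (n : vertex -> nat) (s : vertex -> bool)
    (A : vertex -> set (d.-tuple R)) :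
  uniq us -> {subset us <= generation (tree w0) k.+1} ->
  (forall v, measurable (A v)) ->
  P [set w | [/\ atom k w0 w, forall v, v \in ball (tree w0) k -> A v (feature v w)
     & forall u, u \in us ->
       [/\ children u w = n u, label u w = s u & A u (feature u w)]]]
  = (fine (P (atom k w0)) * (\prod_(v <- ball (tree w0) k)
        fine (class_law (label v w0) (A v))) *
     \prod_(u <- us) (poisson_pmf (Delta a b) (n u) *
       flip_prob (label (behead u) w0) (s u) *
       fine (class_law (s u) (A u))))%:E.
Proof.
move=> uus sus mA.
(* The prescribed values on [us] are spliced with those of [w0] on the ball; the two sets of
   vertices are disjoint because their generations differ. *)
pose n' v := if v \in us then n v else children v w0.
pose s' v := if v \in us then s v else label v w0.
have bus v : v \in ball (tree w0) k -> (v \in us) = false.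
  rewrite mem_ball => /andP[vk _]; apply/negP => /sus.
  by rewrite mem_generation => /andP[/eqP vk' _]; rewrite vk' ltnn in vk.
have nn' : {in ball (tree w0) k, tree w0 =1 n'}.
  by move=> v vb; rewrite /n' bus.
have rs0 : rooted_subtree (tree w0) (ball (tree w0) k).
  by have := @rooted_subtree_ball (tree w0) k [::]; apply.
have rs : rooted_subtree n' (us ++ ball (tree w0) k).
  rewrite (eq_ball nn' (leqnSn k)); apply: rooted_subtree_ball => // u /sus.
  by rewrite (eq_generation nn' (leqnn _)).
have Patom : P (atom k w0) = (\prod_(v <- ball (tree w0) k)
    (poisson_pmf (Delta a b) (children v w0) *
     label_prob (gamma a b) (fun v => label v w0) v))%:E.
  have := @lo_law _ _ _ _ _ _ L _ (tree w0) (fun v => label v w0) (fun=> setT) rs0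
    (fun=> measurableT).
  rewrite (_ : [set w | _] = atom k w0); last first.
    by apply/seteqP; split => w /= aw v vb; have := aw v vb; rewrite /tree => -[] //.
  move=> ->; congr EFin; apply: eq_bigr => v _.
  by case: label; rewrite probability_setT mulr1.
have := @lo_law _ _ _ _ _ _ L _ n' s' A rs mA.
rewrite (_ : [set w | _] = [set w | [/\ atom k w0 w,
    forall v, v \in ball (tree w0) k -> A v (feature v w)
     & forall u, u \in us ->
       [/\ children u w = n u, label u w = s u & A u (feature u w)]]]); last first.
  apply/seteqP; split => w /=.
    move=> h; split.
    - move=> v vb; have := h v; rewrite mem_cat vb orbT /n' /s' bus// => /(_ isT).
      by case.
    - by move=> v vb; have := h v; rewrite mem_cat vb orbT => /(_ isT)[].
    - by move=> u uu; have := h u; rewrite mem_cat uu /n' /s' uu => /(_ isT).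
  move=> [h1 h2 h3] v; rewrite mem_cat /n' /s'; case: ifP => [vu _|_ /= vb].
    exact: h3.
  by have [-> ->] := h1 _ vb; split=> //; exact: h2.
move=> ->; congr EFin; rewrite big_cat/= Patom/= mulrC; congr (_ * _).
  rewrite -big_split; apply: eq_big_seq => v vb /=.
  rewrite {1}/n' {2}/s' bus//; congr (_ * _ * _).
  case: v vb => [//|i v] vb /=; rewrite /s' bus// bus//.
  by move: vb; rewrite !mem_ball/= => /andP[/ltnW -> /andP[_ ->]].
apply: eq_big_seq => u uu; rewrite {1}/n' {2}/s' uu; congr (_ * _ * _).
have := sus _ uu; rewrite mem_generation; case: u uu => [//|i v] uu /= /andP[sv /andP[_ av]].
by rewrite /s' uu bus// mem_ball av andbT -ltnS (eqP sv).
Qed.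

End Atoms.

(** * The law of a generation given the atom of the previous ones *)

Section NatLaw.
Context {R : realType}.

Lemma nat_measure_ext (m1 m2 : {measure set nat -> \bar R}) :
  (forall n, m1 [set n] = m2 [set n]) -> forall S, m1 S = m2 S.
Proof.
move=> m12 S; have tS : trivIset S (fun n : nat => [set n]).
  by move=> i j _ _ [n [/= -> ->]].
have := bigcup_imset1 S id; rewrite image_id => SE.
rewrite -{1 2}SE !measure_bigcup//.
by apply: eq_eseriesr => n _; exact: m12.
Qed.

Lemma poisson_prob1 (D : R) (n : nat) : 0 < D ->
  poisson_prob D 0 [set n] = (poisson_pmf D n)%:E.
Proof.
move=> D0; rewrite /poisson_prob D0 esum_set1// lee_fin.
exact: poisson_pmf_ge0.
Qed.

Context {dT} {T : measurableType dT} (P : probability T R).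

(** The defining law prescribes single offspring numbers only; sigma-additivity passes to arbitrary
    sets of numbers, for one vertex at a time. *)
Lemma nat_law_ext (Q : probability nat R) (G : set T) (C : T -> nat) (c : {nonneg R}) :
  measurable G -> measurable_fun setT C ->
  (forall n, P (G `&` [set w | C w = n]) = c%:num%:E * Q [set n])%E ->
  forall S, (P (G `&` (C @^-1` S)) = c%:num%:E * Q S)%E.
Proof.
move=> mG mC PQ S.
pose m1 : {measure set nat -> \bar R} :=
  measure_function_pushforward__canonical__measure_function_Measure
    (mrestr P mG) mC.
have -> : P (G `&` (C @^-1` S)) = m1 S.
  by rewrite /m1/= /pushforward/= /mrestr setIC.
rewrite (@nat_measure_ext m1 (mscale c Q))// => n.
by rewrite /m1/= /pushforward/= /mrestr setIC /mscale/= -PQ.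
Qed.

End NatLaw.

Section Marks.
Context {R : realType} {d : nat} {a b : R} {Pp Pm : probability (d.-tuple R) R}
  {L : limit_object a b Pp Pm}.
Hypothesis D0 : 0 < Delta a b.
Hypothesis g01 : -1 <= gamma a b <= 1.
Notation P := (lo_prob L).
Notation pois := (poisson_prob (Delta a b) 0).

Lemma flip_prob_ge0 p y : 0 <= flip_prob (a := a) (b := b) p y.
Proof. by case/andP: g01 => g1 g2; rewrite /flip_prob; case: ifP => _; lra. Qed.

(** Induction on a list [us1] of vertices at which [S] may be an arbitrary set, all other values of
    [S] on [us] being singletons. The base case is [atom_law_ext], and [nat_law_ext] frees one more
    vertex at each step. *)
Lemma atom_law k w0 (us : seq vertex) (s : vertex -> bool)
    (S : vertex -> set nat) (A : vertex -> set (d.-tuple R)) :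
  uniq us -> {subset us <= generation (tree w0) k.+1} ->
  (forall v, measurable (A v)) ->
  P [set w | atom k w0 w /\ forall u, u \in us ->
       [/\ S u (children u w), label u w = s u & A u (feature u w)]]
  = (fine (P (atom k w0)) *
     \prod_(u <- us) (fine (pois (S u)) *
       flip_prob (a := a) (b := b) (label (behead u) w0) (s u) *
       fine (class_law (Pp := Pp) (Pm := Pm) (s u) (A u))))%:E.
Proof.
move=> uus sus mA.
suff H (us1 : seq vertex) : forall S : vertex -> set nat,
    (forall u, u \in us -> u \notin us1 -> exists n, S u = [set n]) ->
    P [set w | atom k w0 w /\ forall u, u \in us ->
         [/\ S u (children u w), label u w = s u & A u (feature u w)]]
    = (fine (P (atom k w0)) *
       \prod_(u <- us) (fine (pois (S u)) *
         flip_prob (a := a) (b := b) (label (behead u) w0) (s u) *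
         fine (class_law (Pp := Pp) (Pm := Pm) (s u) (A u))))%:E.
  by apply: (H us) => u ->.
elim: us1 => [|x us1 IH] {}S hS.
  pose n u := get (S u).
  have Sn u : u \in us -> S u = [set n u].
    move=> /hS /(_ isT) [m Sm]; rewrite /n Sm; congr [set _].
    have : [set m] (get [set m]) by apply: getPex; exists m.
    by [].
  pose A' v := if v \in us then A v else setT.
  have mA' v : measurable (A' v) by rewrite /A'; case: ifP.
  have := @atom_law_ext _ _ _ _ _ _ L k w0 us n s A' uus sus mA'.
  have bus v : v \in ball (tree w0) k -> A' v = setT.
    rewrite mem_ball /A' => /andP[vk _]; case: ifP => // /sus.
    by rewrite mem_generation => /andP[/eqP vk' _]; rewrite vk' ltnn in vk.
  have -> : \prod_(v <- ball (tree w0) k) fine (class_law (Pp := Pp) (Pm := Pm) (label v w0) (A' v)) = 1.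
    rewrite big1_seq// => v /andP[_ /bus ->].
    by rewrite /class_law; case: label; rewrite probability_setT.
  rewrite mulr1 (_ : [set w | _] = [set w | atom k w0 w /\ forall u, u \in us ->
         [/\ S u (children u w), label u w = s u & A u (feature u w)]]).
    move=> ->; congr (_ * _)%:E; apply: eq_big_seq => u uu.
    by rewrite Sn// poisson_prob1//= /A' uu.
  apply/seteqP; split => w /=.
    move=> [h1 _ h3]; split=> // u uu; have := h3 _ uu.
    by rewrite Sn// /A' uu.
  move=> [h1 h3]; split=> //.
    by move=> v /bus ->.
  by move=> u uu; have := h3 _ uu; rewrite Sn// /A' uu.
case: (boolP (x \in us)) => xus; last first.
  apply: IH => u uu uus1; apply: hS => //.
  by rewrite in_cons negb_or uus1 andbT; apply: contraNneq xus => <-.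
pose G := [set w | [/\ atom k w0 w, label x w = s x, A x (feature x w) &
  forall u, u \in rem x us ->
         [/\ S u (children u w), label u w = s u & A u (feature u w)]]].
have mG : measurable G.
  rewrite (_ : G = (atom k w0 `&` [set w | label x w = s x] `&`
     (feature x @^-1` A x)) `&` [set w | forall u, u \in rem x us ->
     [set w | [/\ S u (children u w), label u w = s u & A u (feature u w)]] w]); last first.
    by apply/seteqP; split => w /=; [case|move=> [[[]]]].
  have mX u : measurable (feature (l := L) u @^-1` A u).
    by rewrite -[X in measurable X]setTI; exact: measurable_feature.
  apply: measurableI.
    apply: measurableI; last exact: mX.
    by apply: measurableI; [exact: measurable_atom|exact: measurable_label_eq].
  apply: measurable_all_in => u _.
  rewrite (_ : [set w | _] = (children u @^-1` S u `&` [set w | label u w = s u] `&`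
     (feature u @^-1` A u))); last first.
    by apply/seteqP; split => w /=; [case|move=> [[]]].
  apply: measurableI; last exact: mX.
  apply: measurableI; last exact: measurable_label_eq.
  by rewrite -[X in measurable X]setTI; exact: measurable_children.
have usE w (S' : vertex -> set nat) : (forall u, u \in us ->
    [/\ S' u (children u w), label u w = s u & A u (feature u w)]) <->
   [/\ S' x (children x w), label x w = s x & A x (feature x w)] /\
   forall u, u \in rem x us ->
    [/\ S' u (children u w), label u w = s u & A u (feature u w)].
  split=> [h|[h1 h2] u uu]; first by split=> [|u /mem_rem]; exact: h.
  by have [->//|ux] := eqVneq u x; apply: h2; rewrite mem_rem_uniq// inE ux.
have big_us (S' : vertex -> set nat) : (forall u, u \in rem x us -> S' u = S u) ->
   \prod_(u <- us) (fine (pois (S' u)) *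
         flip_prob (a := a) (b := b) (label (behead u) w0) (s u) *
         fine (class_law (Pp := Pp) (Pm := Pm) (s u) (A u))) =
   fine (pois (S' x)) * ((flip_prob (a := a) (b := b) (label (behead x) w0) (s x) *
         fine (class_law (Pp := Pp) (Pm := Pm) (s x) (A x))) *
     \prod_(u <- rem x us) (fine (pois (S u)) *
         flip_prob (a := a) (b := b) (label (behead u) w0) (s u) *
         fine (class_law (Pp := Pp) (Pm := Pm) (s u) (A u)))).
  move=> S'S; rewrite (big_rem x)//= mulrA -!mulrA; congr (_ * (_ * (_ * _))).
  by apply: eq_big_seq => u /S'S ->.
rewrite big_us// mulrCA.
set c := (X in (_ * X)%:E).
have c0 : 0 <= c.
  rewrite mulr_ge0 ?fine_ge0//; rewrite mulr_ge0 ?mulr_ge0 ?flip_prob_ge0 ?fine_ge0//.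
  rewrite prodr_ge0// => u _.
  by rewrite mulr_ge0 ?mulr_ge0 ?flip_prob_ge0 ?fine_ge0.
rewrite mulrC EFinM fineK; last exact: fin_num_measure.
have := @nat_law_ext _ _ _ P pois G (children x) (NngNum c0) mG
  (@measurable_children _ _ _ _ _ _ L x).
rewrite /=; move=> <-.
  congr (P _); apply/seteqP; split => w /=.
    by move=> [h /usE [[h1 h2 h3] h4]]; split.
  by move=> [[h1 h2 h3 h4] h5]; split => //; apply/usE.
move=> n; pose S' u := if u == x then [set n] else S u.
have S'S u : u \in rem x us -> S' u = S u.
  by rewrite mem_rem_uniq// inE /S' => /andP[/negbTE ->].
have := IH S'; rewrite big_us// /S' eqxx => IHS.
rewrite (_ : G `&` _ = [set w | atom k w0 w /\ forall u, u \in us ->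
         [/\ S' u (children u w), label u w = s u & A u (feature u w)]]).
  rewrite IHS; last first.
    move=> u uu uus1; case: eqP => [_|/eqP ux]; first by exists n.
    by apply: hS; rewrite // in_cons negb_or ux.
  by rewrite mulrCA mulrC EFinM fineK//; exact: fin_num_measure.
apply/seteqP; split => w /=.
  move=> [[h1 h2 h3 h4] h5]; split => //; apply/usE; split.
    by rewrite /S' eqxx.
  by move=> u ur; rewrite S'S//; exact: h4.
move=> [h1 /usE]; rewrite {1}/S' eqxx => -[[h2 h3 h4] h5]; split => //; split => // u ur.
by have := h5 _ ur; rewrite S'S.
Qed.

End Marks.

(** * Second moments of generation sums *)

Section SingleLaw.
Context {dT} {T : measurableType dT} {R : realType} (P : probability T R).
Context {d1} {S1 : measurableType d1} (Q : probability S1 R).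

Lemma has_int_law (E : set T) (X : T -> S1) (c : {nonneg R}) (f : S1 -> R) r :
  measurable E -> measurable_fun setT X ->
  (forall B, measurable B -> P (E `&` (X @^-1` B)) = (c%:num%:E * Q B)%E) ->
  has_int Q setT f r -> has_int P E (fun w => f (X w)) (c%:num * r).
Proof.
move=> mE mX law fr.
(* A constant second variable, with a Dirac law, makes the one-variable case an instance of the
   product law. *)
pose Y (w : T) : bool := true.
have mY : measurable_fun setT Y by exact: measurable_cst.
have joint B B' : measurable B -> measurable B' ->
  P (E `&` (X @^-1` B) `&` (Y @^-1` B')) = (c%:num%:E * (Q B * \d_true B'))%E.
  move=> mB mB'; have [B't|B't] := pselect (B' true).
    rewrite (_ : Y @^-1` B' = setT); last by rewrite -subTset => w _.
    by rewrite setIT law// diracE mem_set// mule1.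
  rewrite (_ : Y @^-1` B' = set0); last by rewrite -subset0 => w.
  by rewrite setI0 measure0 diracE memNset// !mule0.
have h1 : has_int (\d_true : probability _ R) setT (fun=> 1 : R) (1 * 1).
  apply: has_int_cst => //; exact: probability_setT.
have := has_int_product_law mE mX mY joint fr h1.
by rewrite !mulr1; apply: has_int_ext => w _; rewrite mulr1.
Qed.

End SingleLaw.

Section MarkMoments.
Context {R : realType} {d : nat} {a b : R} {Pp Pm : probability (d.-tuple R) R}
  {L : limit_object a b Pp Pm}.
Hypothesis g01 : -1 <= gamma a b <= 1.
Notation P := (lo_prob L).
Notation flip := (flip_prob (a := a) (b := b)).
Notation sgn := (label_value R).
Context {dM} {M : measurableType dM} (zeta : vertex -> lo_space L -> M)
  (Q : bool -> probability M R).

(** The common form of the two kinds of marks, offspring numbers and features: given the atom, the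
    marks of generation k + 1 are independent, with a law depending on a label that is flipped from
    the parent's. The moment recursion is proved once for both. *)
Definition mark_law := forall k w0 (us : seq vertex) (s : vertex -> bool)
    (A : vertex -> set M),
  uniq us -> {subset us <= generation (tree w0) k.+1} ->
  (forall v, measurable (A v)) ->
  P [set w | atom k w0 w /\ forall u, u \in us -> label u w = s u /\ A u (zeta u w)]
  = (fine (P (atom k w0)) *
     \prod_(u <- us) (flip (label (behead u) w0) (s u) * fine (Q (s u) (A u))))%:E.

Hypothesis mz : forall v, measurable_fun setT (zeta v).
Hypothesis zeta_law : mark_law.
Variables (phi : bool -> M -> R) (mean : bool -> R).
Hypothesis phi_mean : forall y, has_int (Q y) setT (phi y) (mean y).

Definition mark_value (u : vertex) (w : lo_space L) := phi (label u w) (zeta u w).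
(** The conditional mean of a mark given the label of the parent. *)
Definition parent_mean (p : bool) : R := flip p true * mean true + flip p false * mean false.

Section OneAtom.
Variables (k : nat) (w0 : lo_space L).
Let A := atom k w0.
Let G := generation (tree w0) k.+1.
Let pA := fine (P A).

Let pA0 : 0 <= pA. Proof. exact: fine_ge0. Qed.
Let mA : measurable A. Proof. exact: measurable_atom. Qed.

Lemma has_int_mark_label f (r : bool -> R) u y : u \in G ->
  has_int (Q y) setT (f y) (r y) ->
  has_int P (A `&` [set w | label u w = y]) (fun w => f (label u w) (zeta u w))
    (pA * (flip (label (behead u) w0) y * r y)).
Proof.
move=> uG fr; have c0 : 0 <= pA * flip (label (behead u) w0) y.
  by rewrite mulr_ge0// flip_prob_ge0.
rewrite mulrA; apply: (@has_int_ext _ _ _ _ _ (fun w => f y (zeta u w))).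
  by move=> w [_ /= ->].
apply: (@has_int_law _ _ _ P _ _ (Q y) _ (zeta u) (NngNum c0)) => //.
  by apply: measurableI => //; exact: measurable_label_eq.
move=> B mB; have := @zeta_law k w0 [:: u] (fun=> y) (fun=> B).
rewrite big_seq1 mulrA EFinM fineK; last exact: fin_num_measure.
move=> <- //; last by move=> v; rewrite inE => /eqP ->.
congr (P _); apply/seteqP; split => w /=.
  by move=> [[h1 h2] h3]; split=> // v; rewrite inE => /eqP ->.
by move=> [h1 /(_ u)]; rewrite inE eqxx => /(_ isT) [].
Qed.

Let label_disj u (E : set (lo_space L)) :
  [disjoint E `&` [set w | label u w = true] & E `&` [set w | label u w = false]].
Proof. by apply/disj_setPS => w [[_ /= ->] [_]]. Qed.

Let label_cover u (E : set (lo_space L)) :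
  (E `&` [set w | label u w = true]) `|` (E `&` [set w | label u w = false]) = E.
Proof.
apply/seteqP; split => w /=; first by move=> [[]|[]].
by move=> Ew; case: (label u w); [left|right].
Qed.

Lemma has_int_mark f (r : bool -> R) u : u \in G ->
  (forall y, has_int (Q y) setT (f y) (r y)) ->
  has_int P A (fun w => f (label u w) (zeta u w))
   (pA * (flip (label (behead u) w0) true * r true +
          flip (label (behead u) w0) false * r false)).
Proof.
move=> uG fr; rewrite -[X in has_int _ X](label_cover u) mulrDr.
by apply: has_int_setU => //; exact: has_int_mark_label.
Qed.

Lemma has_int_mark2 u u' : u \in G -> u' \in G -> u != u' ->
  has_int P A (fun w => mark_value u w * mark_value u' w)
   (pA * (parent_mean (label (behead u) w0) * parent_mean (label (behead u') w0))).
Proof.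
move=> uG u'G uu'.
have H y y' : has_int P (A `&` [set w | label u w = y] `&` [set w | label u' w = y'])
   (fun w => mark_value u w * mark_value u' w)
   (pA * (flip (label (behead u) w0) y * flip (label (behead u') w0) y') *
     (mean y * mean y')).
  have c0 : 0 <= pA * (flip (label (behead u) w0) y * flip (label (behead u') w0) y').
    by rewrite mulr_ge0// mulr_ge0// flip_prob_ge0.
  apply: (@has_int_ext _ _ _ _ _ (fun w => phi y (zeta u w) * phi y' (zeta u' w))).
    by move=> w [[_ /= h1] h2]; rewrite /mark_value h1 h2.
  apply: (@has_int_product_law _ _ _ P _ _ _ _ (Q y) (Q y') _ _ (zeta u) (zeta u') _ _ (NngNum c0)) => //.
    by apply: measurableI; [apply: measurableI => //|]; exact: measurable_label_eq.
  move=> B B' mB mB'.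
  have := @zeta_law k w0 [:: u; u'] (fun v => if v == u then y else y')
    (fun v => if v == u then B else B').
  rewrite big_cons big_seq1 eqxx eq_sym (negbTE uu').
  rewrite (_ : _ * _ = pA * (flip (label (behead u) w0) y * flip (label (behead u') w0) y')
     * (fine (Q y B) * fine (Q y' B'))); last by rewrite /pA; ring.
  have -> (c : R) : ((c * (fine (Q y B) * fine (Q y' B')))%:E = c%:E * (Q y B * Q y' B'))%E.
    by rewrite EFinM [in LHS](EFinM (fine _)) !fineK; try exact: fin_num_measure.
  move=> <- //.
  - congr (P _); apply/seteqP; split => w /=.
      move=> [[[[h1 h2] h3] h4] h5]; split=> // v; rewrite !inE.
      by case: eqVneq => [->|_] //= /eqP ->.
    move=> [h1 h]; have := h u; rewrite !inE eqxx => /(_ isT)[].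
    by have := h u'; rewrite !inE eqxx orbT eq_sym (negbTE uu') => /(_ isT)[].
  - by rewrite /= inE uu'.
  - by move=> v; rewrite !inE => /orP[] /eqP ->.
  - by move=> v; case: ifP.
have H' y := has_int_setU (label_disj u' _) (H y true) (H y false).
have := has_int_setU (label_disj u A) (eq_ind _ (fun E => has_int P E _ _) (H' true) _ (label_cover u' _))
  (eq_ind _ (fun E => has_int P E _ _) (H' false) _ (label_cover u' _)).
rewrite label_cover /parent_mean.
by congr has_int; ring.
Qed.

Lemma has_int_mark_sum :
  has_int P A (fun w => \sum_(u <- G) mark_value u w)
   (pA * \sum_(u <- G) parent_mean (label (behead u) w0)).
Proof.
rewrite mulr_sumr; apply: has_int_sum => // u uG.
exact: has_int_mark.
Qed.

(** In the expanded square a diagonal term contributes [q] whatever the label, and an off-diagonal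
    term factors by conditional independence. Regrouping gives the conditional variances plus the
    square of the conditional mean. *)
Lemma has_int_mark_sum_sqr q :
  (forall y, has_int (Q y) setT (fun x => phi y x ^+ 2) q) ->
  has_int P A (fun w => (\sum_(u <- G) mark_value u w) ^+ 2)
   (pA * (\sum_(u <- G) (q - parent_mean (label (behead u) w0) ^+ 2) +
          (\sum_(u <- G) parent_mean (label (behead u) w0)) ^+ 2)).
Proof.
move=> phi2; set pm := fun u => parent_mean (label (behead u) w0).
have -> : pA * (\sum_(u <- G) (q - pm u ^+ 2) + (\sum_(u <- G) pm u) ^+ 2) =
  \sum_(u <- G) \sum_(u' <- G) (pA * (if u == u' then q else pm u * pm u')).
  rewrite expr2 mulr_suml -big_split/= mulr_sumr; apply: eq_big_seq => u uG.
  rewrite -mulr_sumr; congr (_ * _).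
  rewrite mulr_sumr !(bigD1_seq u)//= ?generation_uniq// eqxx.
  under [X in _ = _ + X]eq_bigr => i iu do rewrite eq_sym (negbTE iu).
  by ring.
apply: (@has_int_ext _ _ _ _ _
  (fun w => \sum_(u <- G) \sum_(u' <- G) mark_value u w * mark_value u' w)).
  move=> w _; rewrite expr2 mulr_suml; by apply: eq_bigr => u _; rewrite mulr_sumr.
apply: (@has_int_sum _ _ _ _ _ _ _
  (fun u w => \sum_(u' <- G) mark_value u w * mark_value u' w)) => // u uG.
apply: (@has_int_sum _ _ _ _ _ _ _
  (fun u' w => mark_value u w * mark_value u' w)) => // u' u'G.
case: eqVneq => [<-|uu']; last exact: has_int_mark2.
have := has_int_mark uG phi2; rewrite -mulrDl.
rewrite (_ : flip _ true + flip _ false = 1) ?mul1r.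
  by apply: has_int_ext => w _; rewrite -expr2.
by rewrite /flip_prob; case: label; rewrite /=; field.
Qed.

End OneAtom.

End MarkMoments.

Section PoissonMoments.
Context {R : realType}.

Lemma ge0_integral_nat (Q : probability nat R) (f : nat -> R) : (forall n, 0 <= f n) ->
  (\int[Q]_n (f n)%:E = \sum_(n <oo) ((f n)%:E * Q [set n]))%E.
Proof.
move=> f0.
have TE : \bigcup_n [set n] = [set: nat] by rewrite -subTset => n _; exists n.
rewrite -TE ge0_integral_bigcup//; last 2 first.
- by move=> n _; rewrite lee_fin.
- by move=> i j _ _ [n [/= -> ->]].
apply: eq_eseriesr => n _.
rewrite (eq_integral (fun=> (f n)%:E)); last by move=> m /[!inE] ->.
by rewrite integral_cst.
Qed.

(* The Stein-Chen identity E[N F(N)] = D E[F(N + 1)]. *)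
Lemma poisson_stein (D : R) (F : nat -> R) : 0 < D -> (forall n, 0 <= F n) ->
  (\int[poisson_prob D 0]_n (n%:R * F n)%:E =
   D%:E * \int[poisson_prob D 0]_n (F n.+1)%:E)%E.
Proof.
move=> D0 F0; rewrite !ge0_integral_nat => [|//|n]; last by rewrite mulr_ge0.
rewrite -nneseriesZl; last first.
  by move=> n _; rewrite mule_ge0// lee_fin.
rewrite (nneseries_split 0 1); last first.
  by move=> n _; rewrite mule_ge0// lee_fin mulr_ge0.
rewrite add0n big_nat1 mul0r mul0e add0e -nneseries_addn; last first.
  by move=> n; rewrite mule_ge0// lee_fin mulr_ge0.
apply: eq_eseriesr => n _; rewrite addn1/= !poisson_prob1// -!EFinM; congr EFin.
rewrite /poisson_pmf D0 factS natrM exprS invfM.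
have : n.+1%:R != 0 :> R by rewrite pnatr_eq0.
have : n`!%:R != 0 :> R by rewrite pnatr_eq0 -lt0n fact_gt0.
by move: n.+1%:R n`!%:R => x y y0 x0; field; rewrite y0 x0.
Qed.

Lemma has_int_poisson (D : R) : 0 < D ->
  has_int (poisson_prob D 0) setT (fun n : nat => n%:R) D.
Proof.
move=> D0; apply: has_int_ge0 => //.
under eq_integral => n _ do rewrite -[n%:R]mulr1.
rewrite (poisson_stein (F := fun=> 1))// integral_cst//.
by rewrite [X in (_ * (_ * X))%E]probability_setT !mule1.
Qed.

Lemma has_int_poisson_sqr (D : R) : 0 < D ->
  has_int (poisson_prob D 0) setT (fun n : nat => n%:R ^+ 2) (D ^+ 2 + D).
Proof.
move=> D0; apply: has_int_ge0 => //.
under eq_integral => n _ do rewrite expr2.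
rewrite (poisson_stein (F := fun n => n%:R))//.
have h1 : has_int (poisson_prob D 0) setT (fun=> 1 : R) (1 * 1).
  by apply: has_int_cst => //; exact: probability_setT.
have [_ _] := has_intD (has_int_poisson D0) h1.
under eq_integral => n _ do rewrite natr1.
move=> ->; rewrite -EFinM; congr EFin; ring.
Qed.

End PoissonMoments.

Section Instances.
Context {R : realType} {d : nat} {a b : R} {Pp Pm : probability (d.-tuple R) R}
  {L : limit_object a b Pp Pm}.
Hypothesis D0 : 0 < Delta a b.
Hypothesis g01 : -1 <= gamma a b <= 1.

Lemma children_mark_law :
  mark_law (children (l := L)) (fun=> poisson_prob (Delta a b) 0).
Proof.
move=> k w0 us s A uus sus mA.
have := @atom_law _ _ _ _ _ _ L D0 g01 k w0 us s A (fun=> setT) uus sus (fun=> measurableT).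
rewrite (_ : [set w | _] = [set w | atom k w0 w /\ forall u, u \in us ->
  label u w = s u /\ A u (children u w)]).
  move=> ->; congr (_ * _)%:E; apply: eq_bigr => u _.
  by rewrite /class_law; case: ifP; rewrite probability_setT /= mulr1 mulrC.
by apply/seteqP; split => w /= [h1 h2]; split=> // u /h2; [move=> []|move=> [? ?]; split].
Qed.

Lemma feature_mark_law :
  mark_law (feature (l := L)) (class_law (Pp := Pp) (Pm := Pm)).
Proof.
move=> k w0 us s A uus sus mA.
have := @atom_law _ _ _ _ _ _ L D0 g01 k w0 us s (fun=> setT) A uus sus mA.
rewrite (_ : [set w | _] = [set w | atom k w0 w /\ forall u, u \in us ->
  label u w = s u /\ A u (feature u w)]).
  move=> ->; congr (_ * _)%:E; apply: eq_bigr => u _.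
  by rewrite probability_setT /= mul1r.
by apply/seteqP; split => w /= [h1 h2]; split=> // u /h2; [move=> []|move=> [? ?]; split].
Qed.

End Instances.

Lemma sum_seq_const (V : nmodType) (I : Type) (s : seq I) (x : V) :
  \sum_(i <- s) x = x *+ size s.
Proof. by rewrite big_const_seq count_predT iter_addr_0. Qed.

(** * The recursion for second moments about an arbitrary centre *)

Section Moments.
Context {R : realType} {d : nat} {a b : R} {Pp Pm : probability (d.-tuple R) R}
  {L : limit_object a b Pp Pm}.
Hypothesis D0 : 0 < Delta a b.
Hypothesis g01 : -1 <= gamma a b <= 1.
Notation P := (lo_prob L).
Notation D := (Delta a b).
Notation g := (gamma a b).
Notation sgn := (label_value R).
Notation pois := (poisson_prob (Delta a b) 0).

Definition root_sign (w : lo_space L) : R := sgn (label [::] w).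

Definition population k (w : lo_space L) : R := (size (generation (tree w) k))%:R.

Definition offspring_sum k (w : lo_space L) : R :=
  \sum_(v <- generation (tree w) k) sgn (label v w) * (children v w)%:R.

Lemma label_value_sqr y : sgn y ^+ 2 = 1.
Proof. by case: y => /=; rewrite ?sqrrN expr1n. Qed.

Lemma sum_generationS (V : nmodType) n k (F : vertex -> V) :
  \sum_(u <- generation n k.+1) F (behead u) =
  \sum_(v <- generation n k) F v *+ n v.
Proof.
rewrite /= big_allpairs_dep; apply: eq_bigr => v _ /=.
by rewrite sum_seq_const size_iota.
Qed.

Lemma populationS k w :
  population k.+1 w = \sum_(v <- generation (tree w) k) (children v w)%:R.
Proof.
have := @sum_generationS R (tree w) k (fun=> 1).
by rewrite sum_seq_const /population.
Qed.

Section Marks.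
Context {dM} {M : measurableType dM} (zeta : vertex -> lo_space L -> M)
  (Q : bool -> probability M R).
Hypothesis mz : forall v, measurable_fun setT (zeta v).
Hypothesis zeta_law : mark_law zeta Q.
Variables (phi : bool -> M -> R).

Lemma measurable_mark_value u : (forall y, measurable_fun setT (phi y)) ->
  measurable_fun setT (mark_value zeta phi u).
Proof.
move=> mphi; rewrite [X in measurable_fun _ X](_ : _ = fun w =>
  if label u w then phi true (zeta u w) else phi false (zeta u w)).
  apply: measurable_fun_ifT => //; first exact: measurable_label.
    exact: measurableT_comp.
  exact: measurableT_comp.
by apply/funext => w; rewrite /mark_value; case: label.
Qed.

Lemma has_int_mark_total k (mean : R) N :
  (forall y x, 0 <= phi y x) -> 0 <= mean ->
  (forall y, has_int (Q y) setT (phi y) mean) ->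
  has_int P setT (population k.+1) N ->
  has_int P setT (fun w => \sum_(u <- generation (tree w) k.+1) mark_value zeta phi u w)
    (mean * N).
Proof.
move=> phi0 mean0 phi_mean popN; have [_ _ popE] := has_intZ mean popN.
have mf : measurable_fun setT
    (fun w => \sum_(u <- generation (tree w) k.+1) mark_value zeta phi u w).
  apply: (measurable_fun_fibers (measurable_atom_code (L := L) k)) => w0.
  exists (fun w => \sum_(u <- generation (tree w0) k.+1) mark_value zeta phi u w).
  split; last first.
    move=> w aw; have : atom k w0 w by rewrite -atom_codeE.
    by move=> /atom_generation ->.
  apply: measurable_sum => u; apply: measurable_mark_value => y.
  exact: has_int_measurable (phi_mean y).
apply: has_int_ge0 => //.
  by move=> w _; apply: sumr_ge0 => u _; exact: phi0.
rewrite -popE.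
apply: (eq_integral_fibers (measurable_atom_code (L := L) k)).
- exact/measurable_EFinP.
- by apply/measurable_EFinP; have := has_int_measurable (has_intZ mean popN).
- by move=> w; rewrite lee_fin; apply: sumr_ge0 => u _; exact: phi0.
- by move=> w; rewrite lee_fin mulr_ge0.
move=> w0; rewrite atom_codeE.
have [_ _ h] := has_int_mark_sum g01 mz zeta_law phi_mean k w0.
transitivity (\int[P]_(w in atom k w0)
    (\sum_(u <- generation (tree w0) k.+1) mark_value zeta phi u w)%:E)%E.
  by apply: eq_integral => w /[!inE] /atom_generation ->.
rewrite h; apply/esym.
transitivity (\int[P]_(w in atom k w0) (mean * population k.+1 w0)%:E)%E.
  by apply: eq_integral => w /[!inE] /atom_generation e; rewrite /population e.
have PA : P (atom k w0) = (fine (P (atom k w0)))%:E.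
  by rewrite fineK ?fin_num_measure//; exact: measurable_atom.
have [_ _ ->] := has_int_cst (mean * population k.+1 w0) (measurable_atom k w0) PA.
rewrite mulrC; congr (_ * _)%:E.
rewrite (eq_bigr (fun=> mean)); first by rewrite sum_seq_const /population mulr_natr.
move=> u _; rewrite /parent_mean -mulrDl /flip_prob.
by case: label => /=; field.
Qed.

(** On an atom the signed sum has conditional mean [g * m] times the signed offspring sum and
    conditional variance [q - (g * m)^2] per vertex of generation k + 1. Factoring out [g * m] moves
    the centre from [c] to [c / (g * m)], which is why [V] has to be known at every centre. *)
Lemma has_int_mark_deviation k (m q c N : R) (V : R -> R) :
  (forall y, has_int (Q y) setT (phi y) (sgn y * m)) ->
  (forall y, has_int (Q y) setT (fun x => phi y x ^+ 2) q) ->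
  g * m != 0 ->
  has_int P setT (population k.+1) N ->
  (forall c, has_int P setT (fun w => (root_sign w * offspring_sum k w - c) ^+ 2) (V c)) ->
  has_int P setT (fun w => (root_sign w *
      \sum_(u <- generation (tree w) k.+1) mark_value zeta phi u w - c) ^+ 2)
    ((q - (g * m) ^+ 2) * N + (g * m) ^+ 2 * V (c / (g * m))).
Proof.
move=> phi_mean phi_sqr gm0 popN offV.
(* Nonnegativity of the variance gives [m^2 <= q], and [g^2 <= 1]. This makes [G] below nonnegative,
   as the comparison by fibers requires. *)
have q_ge : 0 <= q - (g * m) ^+ 2.
  have h1 := has_intB (phi_sqr true) (has_intZ (2 * m) (phi_mean true)).
  have h2 : has_int (Q true) setT (fun=> m ^+ 2) (m ^+ 2 * 1).
    by apply: has_int_cst => //; exact: probability_setT.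
  have h3 : has_int (Q true) setT (fun=> 0) (0 * 1).
    by apply: has_int_cst => //; exact: probability_setT.
  have := has_int_le h3 (has_intD h1 h2).
  rewrite mul0r mul1r mulr1 => qm.
  have {}qm : 0 <= q - m ^+ 2.
    rewrite (_ : _ - _ = q - 2 * m * m + m ^+ 2); last by ring.
    apply: qm => x _; rewrite (_ : _ + _ = (phi true x - m) ^+ 2) ?sqr_ge0//.
    by ring.
  rewrite exprMn; have : g ^+ 2 <= 1.
    by case/andP: g01 => ? ?; rewrite -real_normK ?num_real// expr_le1// ler_norml; apply/andP.
  by have := sqr_ge0 m; nra.
(* The conditional expectation, given the atom, of the squared deviation. *)
pose G w := (q - (g * m) ^+ 2) * population k.+1 w +
  (g * m) ^+ 2 * (root_sign w * offspring_sum k w - c / (g * m)) ^+ 2.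
have G0 w : 0 <= G w.
  by apply: addr_ge0; apply: mulr_ge0; rewrite ?sqr_ge0 ?ler0n.
have hG : has_int P setT G
    ((q - (g * m) ^+ 2) * N + (g * m) ^+ 2 * V (c / (g * m))).
  exact: has_intD (has_intZ _ popN) (has_intZ _ (offV _)).
have mf : measurable_fun setT (fun w => (root_sign w *
      \sum_(u <- generation (tree w) k.+1) mark_value zeta phi u w - c) ^+ 2).
  apply: (measurable_fun_fibers (measurable_atom_code (L := L) k)) => w0.
  exists (fun w => (root_sign w0 *
     \sum_(u <- generation (tree w0) k.+1) mark_value zeta phi u w - c) ^+ 2).
  split; last first.
    move=> w aw; have {}aw : atom k w0 w by rewrite -atom_codeE.
    by rewrite (atom_generation aw)// /root_sign (atom_label aw)// root_ball.
  apply: measurable_funX; apply: measurable_funB => //.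
  apply: measurable_funM => //; apply: measurable_sum => u.
  apply: measurable_mark_value => y.
  exact: has_int_measurable (phi_mean y).
have [_ _ hGE] := hG.
apply: has_int_ge0 => //; first by move=> w _; exact: sqr_ge0.
rewrite -hGE; apply: (eq_integral_fibers (measurable_atom_code (L := L) k)).
- exact/measurable_EFinP.
- by apply/measurable_EFinP; exact: has_int_measurable hG.
- by move=> w; rewrite lee_fin sqr_ge0.
- by move=> w; rewrite lee_fin.
move=> w0; rewrite atom_codeE.
have PA : P (atom k w0) = (fine (P (atom k w0)))%:E.
  by rewrite fineK ?fin_num_measure//; exact: measurable_atom.
have h2 := has_int_mark_sum_sqr g01 mz zeta_law phi_mean k w0 phi_sqr.
have h1 := has_int_mark_sum g01 mz zeta_law phi_mean k w0.
have h0 := has_int_cst (c ^+ 2) (measurable_atom k w0) PA.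
have [_ _ h] := has_intD (has_intB h2 (has_intZ (2 * c * root_sign w0) h1)) h0.
have pmE u : parent_mean (a := a) (b := b) (fun y => sgn y * m)
    (label (behead u) w0) = g * m * sgn (label (behead u) w0).
  by rewrite /parent_mean /flip_prob; case: label => /=; field.
have sum_pm : \sum_(u <- generation (tree w0) k.+1)
     parent_mean (a := a) (b := b) (fun y => sgn y * m) (label (behead u) w0) =
   g * m * offspring_sum k w0.
  under eq_bigr => u _ do rewrite pmE.
  rewrite -mulr_sumr (sum_generationS _ _ (fun v => sgn (label v w0))); congr (_ * _).
  by apply: eq_bigr => v _; rewrite mulr_natr.
transitivity (\int[P]_(w in atom k w0) (((\sum_(u <- generation (tree w0) k.+1)
     mark_value zeta phi u w) ^+ 2 - 2 * c * root_sign w0 *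
     (\sum_(u <- generation (tree w0) k.+1) mark_value zeta phi u w)) + c ^+ 2)%:E)%E.
  apply: eq_integral => w /[!inE] aw; rewrite (atom_generation aw)//.
  rewrite /root_sign (atom_label aw) ?root_ball// sqrrB exprMn label_value_sqr mul1r.
  by congr (_%:E); ring.
rewrite h; apply/esym.
transitivity (\int[P]_(w in atom k w0) (G w0)%:E)%E.
  apply: eq_integral => w /[!inE] aw.
  have e1 : population k.+1 w = population k.+1 w0.
    by rewrite /population (atom_generation aw).
  have e2 : root_sign w = root_sign w0.
    by rewrite /root_sign (atom_label aw)// root_ball.
  have e3 : offspring_sum k w = offspring_sum k w0.
    rewrite /offspring_sum (atom_generation aw)//; apply: eq_big_seq => v vk.
    have vb : v \in ball (tree w0) k by exact: generation_ball vk _.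
    by have [-> ->] := aw _ vb.
  by rewrite /G e1 e2 e3.
have [_ _ ->] := has_int_cst (G w0) (measurable_atom k w0) PA.
congr EFin; rewrite sum_pm.
under eq_bigr => u _ do rewrite pmE exprMn label_value_sqr mulr1.
rewrite sum_seq_const -[_ *+ _]mulr_natr -/(population k.+1 w0) /G.
have -> (x y : R) : (root_sign w0 * x - y) ^+ 2 = x ^+ 2 - 2 * y * root_sign w0 * x + y ^+ 2.
  by rewrite sqrrB exprMn label_value_sqr mul1r; ring.
by field; move: gm0; rewrite mulf_eq0 negb_or andbC.
Qed.

End Marks.
End Moments.

Section RootAndGenerations.
Context {R : realType} {d : nat} {a b : R} {Pp Pm : probability (d.-tuple R) R}
  {L : limit_object a b Pp Pm}.
Hypothesis D0 : 0 < Delta a b.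
Hypothesis g01 : -1 <= gamma a b <= 1.
Hypothesis g0 : gamma a b != 0.
Notation P := (lo_prob L).
Notation D := (Delta a b).
Notation g := (gamma a b).
Notation sgn := (label_value R).
Notation pois := (poisson_prob (Delta a b) 0).

Lemma root_law y (S : set nat) (B : set (d.-tuple R)) : measurable B ->
  (P [set w | label [::] w = y /\ B (feature [::] w) /\ S (children [::] w)] =
   (1 / 2 * fine (class_law (Pp := Pp) (Pm := Pm) y B))%:E * pois S)%E.
Proof.
move=> mB; set c := 1 / 2 * _.
have c0 : 0 <= c by rewrite mulr_ge0// fine_ge0.
pose G := [set w : lo_space L | label [::] w = y] `&` (feature [::] @^-1` B).
have mG : measurable G.
  apply: measurableI; first exact: measurable_label_eq.
  by rewrite -[X in measurable X]setTI; exact: measurable_feature.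
have := @nat_law_ext _ _ _ P pois G (children [::]) (NngNum c0) mG
  (@measurable_children _ _ _ _ _ _ L [::]).
rewrite /= => <-.
  by congr (P _); apply/seteqP; split => w /=; [move=> [? [? ?]]|move=> [[? ?] ?]].
move=> n; rewrite poisson_prob1//.
have := @lo_law _ _ _ _ _ _ L [:: [::]] (fun=> n) (fun=> y) (fun=> B).
rewrite big_seq1 /= => law; have {law} := law _ (fun=> mB).
rewrite (_ : [set w | _] = G `&` [set w | children [::] w = n]); last first.
  apply/seteqP; split => w /=.
    by move=> /(_ [::]); rewrite inE eqxx => /(_ isT)[].
  by move=> [[? ?] ?] v; rewrite inE => /eqP ->.
move=> ->; first by rewrite -EFinM; congr EFin; rewrite /c /class_law; ring.
by split => // i v; rewrite inE.
Qed.

Lemma root_label_feature_law y (B : set (d.-tuple R)) : measurable B ->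
  (P ([set w | label [::] w = y] `&` (feature [::] @^-1` B)) =
   (1 / 2 * fine (class_law (Pp := Pp) (Pm := Pm) y B))%:E)%E.
Proof.
move=> mB; have := root_law y setT mB.
rewrite probability_setT mule1 => <-; congr (P _).
by apply/seteqP; split => w /= [? ?]; tauto.
Qed.

Lemma root_children_law (S : set nat) : P (children [::] @^-1` S) = pois S.
Proof.
have mS y : measurable [set w : lo_space L | label [::] w = y /\ setT (feature [::] w) /\ S (children [::] w)].
  rewrite (_ : [set w | _] = [set w : lo_space L | label [::] w = y] `&` (children [::] @^-1` S)).
    apply: measurableI; first exact: measurable_label_eq.
    by rewrite -[X in measurable X]setTI; exact: measurable_children.
  by apply/seteqP; split => w /=; tauto.
rewrite (_ : children [::] @^-1` S =
  [set w | label [::] w = true /\ setT (feature [::] w) /\ S (children [::] w)] `|`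
  [set w | label [::] w = false /\ setT (feature [::] w) /\ S (children [::] w)]).
  rewrite measureU//; last by rewrite -subset0 => w /= [[-> _] []].
  have e y : P [set w | label [::] w = y /\ setT (feature [::] w) /\ S (children [::] w)] =
      ((1 / 2)%:E * pois S)%E.
    by rewrite root_law// /class_law; case: ifP; rewrite probability_setT/= mulr1.
  transitivity ((1 / 2)%:E * pois S + (1 / 2)%:E * pois S)%E.
    by congr (_ + _)%E; exact: e.
  rewrite -(fineK (fin_num_measure pois S _))// -EFinM -EFinD; congr EFin.
  by field.
apply/seteqP; split => w /=; last tauto.
by case: label; tauto.
Qed.

Lemma has_int_root_children (f : nat -> R) r : has_int pois setT f r ->
  has_int P setT (fun w => f (children [::] w)) r.
Proof.
move=> fr; rewrite -[r]mul1r.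
apply: (@has_int_law _ _ _ P _ _ pois setT (children [::]) (NngNum (ler01 : (0 : R) <= 1))) fr => //.
  exact: measurable_children.
by move=> B _; rewrite setTI root_children_law mul1e.
Qed.

Lemma has_int_population k : has_int P setT (population (L := L) k.+1) (D ^+ k.+1).
Proof.
elim: k => [|k IH].
  have := has_int_root_children (has_int_poisson D0); apply: has_int_ext => w _.
  by rewrite populationS big_seq1.
have := @has_int_mark_total _ _ _ _ _ _ _ g01 _ _ _ _
  (@measurable_children _ _ _ _ _ _ L) (children_mark_law D0 g01)
  (fun _ n => n%:R) k D _ (fun _ n => ler0n _ n) (ltW D0) (fun=> has_int_poisson D0) IH.
by rewrite -exprS; apply: has_int_ext => w _; rewrite populationS.
Qed.

(* The excess over its square mean of E[(sum over generation k of label)^2]. *)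
Fixpoint label_var k : R :=
  if k is k'.+1 then D ^+ k + (g * D) ^+ 2 * label_var k' else 0.

(** The solution of the linear recursion, multiplied by [kappa - 1] so that a single identity serves
    both signs of that factor. *)
Lemma label_var_closed k :
  label_var k * (kappa a b - 1) = (g * D) ^+ (2 * k) - D ^+ k.
Proof.
elim: k => [|k IH]; first by rewrite /= mul0r muln0 !expr0 subrr.
rewrite /= mulrDl -mulrA IH /kappa mulnS exprD !exprS.
by ring.
Qed.

Lemma label_var_ge0 k : 0 <= label_var k.
Proof.
elim: k => [//|k IH] /=.
by rewrite addr_ge0//; [exact: exprn_ge0 (ltW D0)|rewrite mulr_ge0 ?sqr_ge0].
Qed.

(** Variance plus squared bias. The mean is [g^k D^(k+1)]; the variance is the Poisson noise [D] of
    each of the [D^k] expected vertices, plus [D^2] times the variance [label_var k] of the signed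
    label sum. *)
Lemma has_int_offspring_sum k c :
  has_int P setT (fun w => (root_sign w * offspring_sum (L := L) k w - c) ^+ 2)
    (D ^+ k.+1 + D ^+ 2 * label_var k + (g ^+ k * D ^+ k.+1 - c) ^+ 2).
Proof.
have D_neq0 : D != 0 by rewrite gt_eqF.
elim: k c => [|k IH] c.
  have h := has_int_root_children (has_int_poisson D0).
  have h2 := has_int_root_children (has_int_poisson_sqr D0).
  have h0 : has_int P setT (fun=> c ^+ 2) (c ^+ 2 * 1).
    by apply: has_int_cst => //; exact: probability_setT.
  have := has_intD (has_intB h2 (has_intZ (2 * c) h)) h0.
  rewrite (_ : _ - _ + _ = D ^+ 1 + D ^+ 2 * label_var 0 + (g ^+ 0 * D ^+ 1 - c) ^+ 2); last first.
    by rewrite /= expr0 expr1; ring.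
  apply: has_int_ext => w _; rewrite /offspring_sum /= big_seq1 /root_sign mulrA -expr2.
  by rewrite label_value_sqr mul1r sqrrB; ring.
have phi_mean (y : bool) : has_int pois setT (fun n : nat => sgn y * n%:R) (sgn y * D).
  exact: has_intZ (has_int_poisson D0).
have phi_sqr (y : bool) : has_int pois setT (fun n : nat => (sgn y * n%:R) ^+ 2) (D ^+ 2 + D).
  by apply: has_int_ext (has_int_poisson_sqr D0) => n _; rewrite exprMn label_value_sqr mul1r.
have gD0 : g * D != 0 by rewrite mulf_neq0.
have := @has_int_mark_deviation _ _ _ _ _ _ _ g01 _ _ _ _
  (@measurable_children _ _ _ _ _ _ L) (children_mark_law D0 g01)
  (fun y n => sgn y * n%:R) k D _ c _ _ phi_mean phi_sqr gD0 (has_int_population k) IH.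
congr has_int; rewrite [label_var k.+1]/= !exprS !expr0.
by field; rewrite D_neq0 g0.
Qed.

Definition feature_sum (h : d.-tuple R -> R) k (w : lo_space L) : R :=
  \sum_(v <- generation (tree w) k) h (feature v w).

Lemma has_int_feature_sum (h : d.-tuple R -> R) m q k c : m != 0 -> (0 < k)%N ->
  (forall y, has_int (class_law (Pp := Pp) (Pm := Pm) y) setT h (sgn y * m)) ->
  (forall y, has_int (class_law (Pp := Pp) (Pm := Pm) y) setT (fun x => h x ^+ 2) q) ->
  has_int P setT (fun w => (root_sign w * feature_sum h k w - c) ^+ 2)
    (D ^+ k * (q - m ^+ 2) + m ^+ 2 * label_var k + (m * (g * D) ^+ k - c) ^+ 2).
Proof.
case: k => [//|k] m0 _ hm hq.
have D_neq0 : D != 0 by rewrite gt_eqF.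
have gm0 : g * m != 0 by rewrite mulf_neq0.
have := @has_int_mark_deviation _ _ _ _ _ _ _ g01 _ _ _ _
  (@measurable_feature _ _ _ _ _ _ L) (feature_mark_law D0 g01)
  (fun _ => h) k m _ c _ _ hm hq gm0 (has_int_population k) (has_int_offspring_sum k).
congr has_int; rewrite [label_var k.+1]/=.
move: g0; move: (label_var k) => lv; move: (g) (D) => x y x0.
by rewrite !exprMn !exprS !expr0; field; rewrite m0 x0.
Qed.

End RootAndGenerations.

(** * The feature laws *)

Section Density.
Context {dT} {T : measurableType dT} {R : realType}.
Variables (mu nu : {measure set T -> \bar R}) (rho : T -> R).
Hypotheses (mrho : measurable_fun setT rho) (rho0 : forall x, 0 <= rho x).
Hypothesis nuE : forall A, measurable A -> nu A = (\int[mu]_(x in A) (rho x)%:E)%E.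

Import HBNNSimple.

(** From sets to functions by an increasing sequence of simple functions, with monotone convergence
    under both measures. *)
Lemma ge0_integral_density (f : T -> R) :
  measurable_fun setT f -> (forall x, 0 <= f x) ->
  (\int[nu]_x (f x)%:E = \int[mu]_x (f x * rho x)%:E)%E.
Proof.
move=> mf f0.
have mEf : measurable_fun setT (EFin \o f) by exact/measurable_EFinP.
pose h := nnsfun_approx measurableT mEf.
have hf x : (h n x)%:E @[n --> \oo] --> (f x)%:E.
  by apply: (cvg_nnsfun_approx measurableT mEf) => // y _; rewrite lee_fin.
have hhomo x : {homo (fun n => h n x) : m n / (m <= n)%N >-> m <= n}.
  by move=> m n mn; exact/lefP/nd_nnsfun_approx.
transitivity (limn (fun n => \int[nu]_x (h n x)%:E))%E.
  rewrite -monotone_convergence//.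
  - by apply: eq_integral => x _; apply/esym/cvg_lim => //; exact: hf.
  - by move=> n; exact/measurable_EFinP.
  - by move=> n x _; rewrite lee_fin.
  - by move=> x _ m n mn; rewrite lee_fin; exact: hhomo.
transitivity (limn (fun n => \int[mu]_x (h n x * rho x)%:E))%E; last first.
  rewrite -monotone_convergence//.
  - apply: eq_integral => x _; apply/cvg_lim => //.
    rewrite EFinM; under eq_fun do rewrite EFinM.
    by apply: cvgeZr => //; exact: hf.
  - by move=> n; exact/measurable_EFinP/measurable_funM.
  - by move=> n x _; rewrite lee_fin mulr_ge0.
  - by move=> x _ m n mn; rewrite lee_fin ler_wpM2r//; exact: hhomo.
congr (limn _); apply/funext => n.
rewrite integral_nnsfun// (_ : _ \_ setT = h n); last first.
  by apply/funext => x; rewrite patchT// inE.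
rewrite sintegralE.
transitivity (\int[mu]_x \sum_(r \in range (h n))
    (r * (\1_(h n @^-1` [set r]) x * rho x))%:E)%E; last first.
  apply: eq_integral => x _; rewrite fsumEFin//; congr EFin.
  rewrite [in RHS](fimfunE (h n) x) !fsbig_finite//= mulr_suml.
  by apply: eq_bigr => r _; rewrite mulrA.
rewrite ge0_integral_fsum//; last 2 first.
- by move=> r; apply/measurable_EFinP/measurable_funM => //; exact: measurable_funM.
- move=> r x _; rewrite mulrA lee_fin mulr_ge0//.
  by have := nnfun_muleindic_ge0 (h n) r x; rewrite -EFinM lee_fin.
apply: eq_fsbigr => r /[!inE] -[x _ <-].
rewrite nuE; last by rewrite -[X in measurable X]setTI; exact: measurable_funP.
transitivity ((h n x)%:E * \int[mu]_y (\1_(h n @^-1` [set h n x]) y * rho y)%:E)%E; last first.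
  rewrite -ge0_integralZl//.
  - by apply/measurable_EFinP/measurable_funM.
  - by move=> y _; rewrite lee_fin mulr_ge0.
  - by rewrite lee_fin.
congr (_ * _)%E; rewrite integral_mkcond; apply: eq_integral => y _.
rewrite patchE indicE; case: (y \in _); by rewrite ?mul1r ?mul0r.
Qed.

End Density.

Lemma measurable_invr {R : realType} : measurable_fun setT (fun x : R => x^-1).
Proof.
rewrite -(setvU [set (0 : R)]); apply/measurable_funU => //.
  by apply: measurableC.
split; last first.
  apply: (eq_measurable_fun (fun=> 0 : R)) => //.
  by move=> x /[!inE] /= ->; rewrite invr0.
apply: open_continuous_measurable_fun => //.
  by apply: closed_openC; exact: closed_eq.
by move=> x /[!inE] /eqP x0; exact: inv_continuous.
Qed.

Lemma has_int_bounded {dT} {T : measurableType dT} {R : realType}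
    (P : probability T R) (f : T -> R) (C : R) :
  measurable_fun setT f -> (forall x, `|f x| <= C) ->
  has_int P setT f (fine (\int[P]_x (f x)%:E)%E).
Proof.
move=> mf fC; apply: has_int_integrable => //.
apply: measurable_bounded_integrable => //.
  by rewrite -ge0_fin_numE//; exact: fin_num_measure.
exists C; split; first exact: num_real.
by move=> M CM x _ /=; exact: le_trans (fC x) (ltW CM).
Qed.

Section Symmetry.
Context {R : realType} {d : nat} {Pp Pm : probability (d.-tuple R) R}
  {mu : {measure set (d.-tuple R) -> \bar R}} {rhop rhom : d.-tuple R -> R}.
Hypothesis h1 : assumption1 Pp Pm mu rhop rhom.
Notation t := (tfun rhop rhom).

Let mrhop : measurable_fun setT rhop. Proof. by case: h1 => _ _ []. Qed.
Let mrhom : measurable_fun setT rhom. Proof. by case: h1 => _ _ _ []. Qed.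
Let rhop0 x : 0 <= rhop x. Proof. by case: h1 => _ _ []. Qed.
Let rhom0 x : 0 <= rhom x. Proof. by case: h1 => _ _ _ []. Qed.
Let PpE A : measurable A -> Pp A = (\int[mu]_(x in A) (rhop x)%:E)%E.
Proof. by case: h1 => _ _ [_ _ h] _ _; exact: h. Qed.
Let PmE A : measurable A -> Pm A = (\int[mu]_(x in A) (rhom x)%:E)%E.
Proof. by case: h1 => _ _ _ [_ _ h] _; exact: h. Qed.

(** The change of variables [tau] preserves [mu] and exchanges the densities almost everywhere. *)
Lemma swap_densities (W : R * R -> R) :
  measurable_fun setT W -> (forall z, 0 <= W z) ->
  (\int[mu]_x (W (rhop x, rhom x))%:E = \int[mu]_x (W (rhom x, rhop x))%:E)%E.
Proof.
move=> mW W0; case: h1 => _ _ _ _ [tau [mtau tauK mutau rhoE]].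
have mpair : measurable_fun setT (fun x => (rhop x, rhom x)).
  exact: measurable_fun_pair.
have mpair' : measurable_fun setT (fun x => (rhom x, rhop x)).
  exact: measurable_fun_pair.
have mWr : measurable_fun setT (fun x => (W (rhop x, rhom x))%:E).
  by apply/measurable_EFinP; exact: measurableT_comp mpair.
transitivity (\int[mu]_x (W (rhop (tau x), rhom (tau x)))%:E)%E.
  transitivity (\int[pushforward mu tau]_x (W (rhop x, rhom x))%:E)%E.
    by apply: eq_measure_integral => A mA _; exact/esym/mutau.
  by rewrite (ge0_integral_pushforward mtau)// => y _; rewrite lee_fin.
apply: ge0_ae_eq_integral => //.
- by apply/measurable_EFinP; apply: measurableT_comp (measurableT_comp mpair mtau).
- by apply/measurable_EFinP; exact: measurableT_comp mpair'.
- by move=> x _; rewrite lee_fin.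
- by move=> x _; rewrite lee_fin.
have [N [mN N0 rhoN]] := rhoE.
(* Off [N] the density [rhom x] is [rhop (tau x)]; off the preimage of [N] the same identity at
   [tau x], with [tau] an involution, gives [rhom (tau x) = rhop x]. *)
exists (N `|` tau @^-1` N); split.
- apply: measurableU => //; rewrite -[X in measurable X]setTI; exact: mtau.
- by apply: null_set_setU => //; [rewrite -[X in measurable X]setTI; exact: mtau|
    rewrite mutau].
move=> x /= /not_implyP [_ nx].
have [xN|xN] := pselect (N x); [by left|right].
apply: contrapT => txN; apply: nx; congr (W (_, _))%:E.
  by apply/esym; apply: contrapT => /rhoN.
rewrite -[in RHS](tauK x); apply: contrapT => /rhoN.
by [].
Qed.

Lemma tfun_bound x : `|t x| <= 1.
Proof.
rewrite /tfun normrM normfV [`|rhop x + rhom x|]ger0_norm ?addr_ge0//.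
have [->|s0] := eqVneq (rhop x + rhom x) 0; first by rewrite invr0 mulr0.
rewrite ler_pdivrMr ?mul1r ?lt0r ?s0 ?addr_ge0// ler_norml.
by have := rhop0 x; have := rhom0 x; move=> *; apply/andP; split; lra.
Qed.

Lemma measurable_tfun : measurable_fun setT t.
Proof.
apply: measurable_funM; first exact: measurable_funB.
by apply: measurableT_comp measurable_invr _; exact: measurable_funD.
Qed.

Let mt2 : measurable_fun setT (fun z : R * R => (z.1 - z.2) / (z.1 + z.2)).
Proof.
apply: measurable_funM; first exact: measurable_funB.
by apply: measurableT_comp measurable_invr _; exact: measurable_funD.
Qed.

(** Exchanging the densities changes the sign of [t], so [t] has under [Pm] the law of [-t] under
    [Pp]. *)
Lemma ge0_integral_swap (F : R -> R) : measurable_fun setT F -> (forall s, 0 <= F s) ->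
  (\int[Pm]_x (F (t x))%:E = \int[Pp]_x (F (- t x))%:E)%E.
Proof.
move=> mF F0.
have mFt : measurable_fun setT (fun x => F (t x)).
  by apply: measurableT_comp mF _; exact: measurable_tfun.
have mFt' : measurable_fun setT (fun x => F (- t x)).
  by apply: measurableT_comp mF _; apply: measurableT_comp => //; exact: measurable_tfun.
rewrite (ge0_integral_density mrhom rhom0 PmE)//.
rewrite (ge0_integral_density mrhop rhop0 PpE)//.
(* [swap_densities] wants a function that is nonnegative on the whole plane; the maximum with 0
   changes nothing at values of the densities. *)
pose W (z : R * R) := F ((z.1 - z.2) / (z.1 + z.2)) * Num.max z.2 0.
have mW : measurable_fun setT W.
  apply: measurable_funM; first exact: measurableT_comp mF _.
  exact: measurable_maxr.
have W0 z : 0 <= W z by rewrite mulr_ge0// le_max lexx orbT.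
have WE x : F (t x) * rhom x = W (rhop x, rhom x).
  by rewrite /W /= max_l.
have WE' x : F (- t x) * rhop x = W (rhom x, rhop x).
  rewrite /W /= max_l// /tfun; congr (F _ * _).
  by rewrite -mulNr opprB addrC [rhop x + _]addrC.
by under eq_integral do rewrite WE; rewrite swap_densities//;
  under [RHS]eq_integral do rewrite WE'.
Qed.

(* (1 - t) rho_+ = 2 rho_+ rho_- / (rho_+ + rho_-) is symmetric in the densities. *)
Lemma ge0_integral_weighted_swap (F : R -> R) :
  measurable_fun setT F -> (forall s, 0 <= F s) ->
  (\int[Pp]_x (F (t x) * (1 - t x))%:E = \int[Pp]_x (F (- t x) * (1 - t x))%:E)%E.
Proof.
move=> mF F0.
have t1 x : 0 <= 1 - t x.
  by have := tfun_bound x; rewrite ler_norml => /andP[_]; lra.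
have mt1 : measurable_fun setT (fun x => 1 - t x).
  by apply: measurable_funB => //; exact: measurable_tfun.
have mFt : measurable_fun setT (fun x => F (t x)).
  by apply: measurableT_comp mF _; exact: measurable_tfun.
have mFt' : measurable_fun setT (fun x => F (- t x)).
  by apply: measurableT_comp mF _; apply: measurableT_comp => //; exact: measurable_tfun.
rewrite (ge0_integral_density mrhop rhop0 PpE); last 2 first.
- exact: measurable_funM.
- by move=> x; rewrite mulr_ge0.
rewrite (ge0_integral_density mrhop rhop0 PpE); last 2 first.
- exact: measurable_funM.
- by move=> x; rewrite mulr_ge0.
pose W (z : R * R) := F ((z.1 - z.2) / (z.1 + z.2)) *
  Num.max (2 * z.1 * z.2 / (z.1 + z.2)) 0.
have mW : measurable_fun setT W.
  apply: measurable_funM; first exact: measurableT_comp mF _.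
  apply: measurable_maxr => //; apply: measurable_funM.
    by apply: measurable_funM => //; exact: measurable_funM.
  by apply: measurableT_comp measurable_invr _; exact: measurable_funD.
have W0 z : 0 <= W z by rewrite mulr_ge0// le_max lexx orbT.
have sym x : (1 - t x) * rhop x = 2 * rhop x * rhom x / (rhop x + rhom x).
  rewrite /tfun; have [s0|s0] := eqVneq (rhop x + rhom x) 0; last by field.
  have -> : rhop x = 0 by have := rhop0 x; have := rhom0 x; lra.
  by rewrite !mulr0 !mul0r.
have prod_ge0 x : 0 <= 2 * rhop x * rhom x / (rhop x + rhom x).
  by rewrite -sym mulr_ge0.
have WE x : F (t x) * (1 - t x) * rhop x = W (rhop x, rhom x).
  by rewrite /W /= max_l// -sym mulrA.
have WE' x : F (- t x) * (1 - t x) * rhop x = W (rhom x, rhop x).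
  have e : 2 * rhom x * rhop x / (rhom x + rhop x) = (1 - t x) * rhop x.
    by rewrite sym [rhom x + _]addrC; congr (_ / _); ring.
  rewrite /W /= e max_l ?mulr_ge0// -mulrA [in LHS]/tfun; congr (F _ * _).
  by rewrite -mulNr opprB [rhom x + rhop x]addrC.
by under eq_integral do rewrite WE; rewrite swap_densities//;
  under [RHS]eq_integral do rewrite WE'.
Qed.

End Symmetry.

(** * Elementary bounds on the inverse hyperbolic tangent *)

Section Artanh.
Context {R : realType}.
Implicit Type u : R.

Lemma artanh2E u : 2 * artanh u = ln ((1 + u) / (1 - u)).
Proof. by rewrite /artanh; field. Qed.

Lemma lnV_total (x : R) : ln x^-1 = - ln x.
Proof.
have [x0|x0] := ltP 0 x; first by rewrite lnV.
by rewrite !ln0 ?oppr0// invr_le0.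
Qed.

Lemma artanhN u : artanh (- u) = - artanh u.
Proof. by rewrite /artanh opprK -mulNr -lnV_total invf_div. Qed.

Lemma ln_le_subr1 (x : R) : 0 < x -> ln x <= x - 1.
Proof. by move=> x0; rewrite -{1}[x](addrNK 1) addrC le_ln1Dx//; lra. Qed.

(** The inequality [ln x <= x - 1] at [x = (1 - u) / (1 + u)] gives [2 u / (1 + u) <= 2 artanh u],
    and [1 + u <= 2]. *)
Lemma artanh2_ge u : 0 <= u < 1 -> u <= 2 * artanh u.
Proof.
move=> /andP[u0 u1]; rewrite artanh2E -[ln _]opprK -lnV_total invf_div.
have y0 : 0 < (1 - u) / (1 + u) by rewrite divr_gt0; lra.
rewrite lerNr (le_trans (ln_le_subr1 y0))//.
rewrite (_ : _ - 1 = - (2 * u / (1 + u))); last by field; lra.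
by rewrite lerN2 ler_pdivlMr; nra.
Qed.

(* ln y = 2 ln r <= 2 (r - 1) with r = sqrt y, and 32 r^2 <= 9 (r + 1) (r^2 + 1). *)
Lemma artanh2_le u : 0 <= u < 1 -> 2 * artanh u <= 9 / 4 * (u / (1 - u ^+ 2)).
Proof.
move=> /andP[u0 u1]; rewrite artanh2E.
set y := (1 + u) / (1 - u).
have y1 : 1 <= y by rewrite ler_pdivlMr; lra.
have -> : u / (1 - u ^+ 2) = (y - y^-1) / 4.
  have n1 : 1 - u != 0 by rewrite gt_eqF//; lra.
  have n2 : 1 + u != 0 by rewrite gt_eqF//; lra.
  have n3 : 1 - u ^+ 2 != 0 by rewrite -[1](expr1n _ 2) subr_sqr mulf_neq0 ?expr1n.
  by rewrite /y; field; rewrite n1 n2 n3.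
pose r := Num.sqrt y.
have r0 : 0 <= r by exact: sqrtr_ge0.
have yE : y = r ^+ 2 by rewrite sqr_sqrtr//; lra.
have r1 : 1 <= r by rewrite -[1]sqrtr1 ler_wsqrtr.
have r_gt0 : 0 < r by lra.
have -> : ln y = 2 * ln r by rewrite yE lnXn// mulr_natl.
apply: (le_trans (y := 2 * (r - 1))); first by rewrite ler_pM2l//; exact: ln_le_subr1.
rewrite yE -subr_ge0.
have -> : 9 / 4 * ((r ^+ 2 - (r ^+ 2)^-1) / 4) - 2 * (r - 1) =
  (r - 1) * (9 * (r + 1) * (r ^+ 2 + 1) - 32 * r ^+ 2) / (16 * r ^+ 2).
  by field; rewrite gt_eqF.
rewrite divr_ge0//; last by rewrite mulr_ge0// sqr_ge0.
rewrite mulr_ge0//; first lra.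
(* The cubic [9 r^3 - 23 r^2 + 9 r + 9] is smallest on the half-line near [r = 3/2]; splitting off a
   square centred there leaves a nonnegative remainder. *)
rewrite (_ : _ - _ = (9 * r + 4) * (r - 3 / 2) ^+ 2 + 3 / 4 * r); last by field.
have : 0 <= (9 * r + 4) * (r - 3 / 2) ^+ 2 by apply: mulr_ge0; [lra|exact: sqr_ge0].
by move: ((9 * r + 4) * _) => z z0; lra.
Qed.

Lemma measurable_artanh : measurable_fun setT (@artanh R).
Proof.
apply: measurable_funM => //; apply: measurableT_comp; first exact: measurable_ln.
apply: measurable_funM; first exact: measurable_funD.
by apply: measurableT_comp measurable_invr _; exact: measurable_funB.
Qed.

End Artanh.

(** * Bounds and moments of the scores *)

Section FeatureMoments.
Context {R : realType} {d : nat} {a b : R} {Pp Pm : probability (d.-tuple R) R}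
  {mu : {measure set (d.-tuple R) -> \bar R}} {rhop rhom : d.-tuple R -> R}.
Hypotheses (hb : 0 < b) (hab : b < a).
Hypothesis h1 : assumption1 Pp Pm mu rhop rhom.
Notation t := (tfun rhop rhom).
Notation g := (gamma a b).
Notation M := (Mfun a b rhop rhom).
Notation theta := (theta Pp rhop rhom).
Notation sgn := (label_value R).
(* The factor 9/8 is the slack of [artanh2_le] against 2 artanh u <= 2 u / (1 - u^2). *)
Notation K := (9 / 8 * cgamma a b).

Lemma gamma_bounds : 0 < g < 1.
Proof.
have a0 := lt_trans hb hab; have ab0 : 0 < a + b by rewrite addr_gt0.
rewrite /gamma divr_gt0 ?subr_gt0//= ltr_pdivrMr// mul1r.
by rewrite ltrBlDr -addrA ltrDl addr_gt0.
Qed.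

(** For k > 0 the argument [u = g^k |t|] is at most [g], so [1 / (1 - u^2) <= 1 / (1 - g^2)], which
    is half of [cgamma]. *)
Lemma Mfun_bound k x : (0 < k)%N -> `|M k x| <= K * g ^+ k * `|t x|.
Proof.
move=> k0; have /andP[g0 g1] := gamma_bounds.
have t1 := tfun_bound h1 x.
have gk : g ^+ k <= g by case: k k0 => // k _; rewrite exprS ler_piMr ?(ltW g0)// exprn_ile1 ?ltW.
have gk0 : 0 < g ^+ k by rewrite exprn_gt0.
have -> : `|M k x| = 2 * artanh (g ^+ k * `|t x|).
  rewrite /Mfun; have [t0|t0] := ger0P (t x).
    rewrite ger0_norm//; apply: le_trans (artanh2_ge _); first by rewrite mulr_ge0// ltW.
    rewrite mulr_ge0//=; last exact: ltW.
    by move: t1; rewrite ger0_norm// => t1; nra.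
  rewrite -[t x]opprK mulrN artanhN mulrN normrN opprK ger0_norm//.
  apply: le_trans (artanh2_ge _); first by rewrite mulr_ge0 ?ltW// oppr_gt0.
  rewrite mulr_ge0/= ?ltW ?oppr_gt0//.
  by move: t1; rewrite ltr0_norm// => t1; nra.
have := normr_ge0 (t x); move: (`|t x|) t1 => s s1 s0.
have u1 : 0 <= g ^+ k * s < 1 by apply/andP; split; nra.
apply: le_trans (artanh2_le u1) _.
rewrite /cgamma; have [u0 u1'] := andP u1.
rewrite (_ : 9 / 8 * _ * _ * s = 9 / 4 * (g ^+ k * s / (1 - g ^+ 2))); last first.
  by field; rewrite gt_eqF//; nra.
rewrite ler_pM2l// ler_wpM2l// lef_pV2 ?posrE; [|nra..].
by rewrite lerB// ler_sqr ?nnegrE ?(ltW g0)//; nra.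
Qed.

Lemma Mfun_mul_ge k x : (0 < k)%N -> g ^+ k * t x ^+ 2 <= t x * M k x.
Proof.
move=> k0; have /andP[g0 g1] := gamma_bounds.
have t1 := tfun_bound h1 x.
have gk : g ^+ k <= g by case: k k0 => // k _; rewrite exprS ler_piMr ?(ltW g0)// exprn_ile1 ?ltW.
have gk0 : 0 < g ^+ k by rewrite exprn_gt0.
rewrite /Mfun; have [t0|t0] := ger0P (t x); move: t1.
  rewrite ger0_norm// => t1; rewrite expr2 mulrCA ler_wpM2l//.
  by apply: artanh2_ge; apply/andP; split; nra.
rewrite ltr0_norm// => t1; rewrite -[t x]opprK mulrN artanhN mulrN mulrNN sqrrN expr2 mulrCA.
apply: ler_wpM2l; first by rewrite oppr_ge0 ltW.
by apply: artanh2_ge; apply/andP; split; nra.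
Qed.

Lemma measurable_Mfun k : measurable_fun setT (M k).
Proof.
apply: measurable_funM => //; apply: measurableT_comp measurable_artanh _.
by apply: measurable_funM => //; exact: measurable_tfun h1.
Qed.

(** The identity holds at every point: where a density vanishes both sides are 0, by the conventions
    [x / 0 = 0] and [ln x = 0] for [x <= 0]. *)
Lemma Mfun0_psi x : M 0 x = ln (psi rhop rhom x).
Proof.
rewrite /Mfun expr0 mul1r artanh2E /tfun /psi.
have [_ _ [_ rp _] [_ rm _] _] := h1.
have := rp x; have := rm x; move: (rhop x) (rhom x) => p m m0 p0.
have [s0|s0] := eqVneq (p + m) 0.
  have -> : p = 0 by lra.
  have -> : m = 0 by lra.
  by rewrite subr0 !mul0r addr0 subr0 invr1 mulr1 ln1 ln0.
have [->|m1] := eqVneq m 0.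
  rewrite invr0 mulr0 subr0 addr0.
  have [->|p1] := eqVneq p 0; first by rewrite mul0r addr0 subr0 divr1 ln1 ln0.
  by rewrite divff// subrr invr0 mulr0.
by congr ln; field; rewrite m1 s0 /= (_ : _ - _ = m *+ 2) ?mulrn_eq0//; ring.
Qed.

Lemma Mfun0_swap A : measurable A ->
  Pm [set x | A (- M 0 x)] = Pp [set x | A (M 0 x)].
Proof.
move=> mA; pose F (s : R) : R := \1_A (- (2 * artanh s)).
have mF : measurable_fun setT F.
  apply: measurableT_comp => //; apply: measurableT_comp => //.
  by apply: measurable_funM => //; exact: measurable_artanh.
have mM : measurable [set x | A (M 0 x)].
  by rewrite -[X in measurable X]setTI; exact: measurable_Mfun.
have mM' : measurable [set x | A (- M 0 x)].
  have mN : measurable_fun setT (fun x => - M 0 x).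
    by apply: measurableT_comp => //; exact: measurable_Mfun.
  by have := mN measurableT A mA; rewrite setTI.
have := ge0_integral_swap h1 mF (fun s => ler0n _ _).
rewrite (_ : (fun x => (F (t x))%:E) = EFin \o \1_[set x | A (- M 0 x)]); last first.
  apply/funext => x; rewrite /= /F !indicE; congr ((nat_of_bool _)%:R)%:E.
  by apply/idP/idP => /set_mem h; apply/mem_set; move: h; rewrite /= /Mfun expr0 mul1r.
rewrite (_ : (fun x => (F (- t x))%:E) = EFin \o \1_[set x | A (M 0 x)]); last first.
  apply/funext => x; rewrite /= /F !indicE artanhN mulrN opprK; congr ((nat_of_bool _)%:R)%:E.
  by apply/idP/idP => /set_mem h; apply/mem_set; move: h; rewrite /= /Mfun expr0 mul1r.
by rewrite !integral_indic// !setIT.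
Qed.

(** A change of measure: on the event [rhop <= expR (- s) * rhom], so its [Pp]-measure is at most
    [expR (- s)] times its [Pm]-measure. *)
Lemma Mfun0_tail s : 0 < s -> (Pp [set x | (M 0 x <= - s)%R] <= (expR (- s))%:E)%E.
Proof.
move=> s0; have [_ _ [mrp rp PpE] [mrm rm PmE] _] := h1.
set A := [set x | _].
have mA : measurable A.
  rewrite (_ : A = M 0 @^-1` [set z | z <= - s]); last by [].
  rewrite -[X in measurable X]setTI; apply: measurable_Mfun => //.
  by rewrite -set_itvNyc; exact: measurable_itv.
have key x : A x -> rhop x <= expR (- s) * rhom x.
  rewrite /A/= Mfun0_psi /psi => h.
  (* A nonpositive ratio would have logarithm 0 by convention, and 0 is not below [- s]; such points
     are outside the event. *)
  have [r0|r0] := ltP 0 (rhop x / rhom x); last first.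
    by move: h; rewrite ln0// oppr_ge0 leNgt s0.
  have m0 : 0 < rhom x.
    rewrite lt0r rm andbT; apply: contraTneq r0 => ->.
    by rewrite invr0 mulr0 ltxx.
  by rewrite -ler_pdivrMr// -(lnK (x := rhop x / rhom x)) ?posrE// ler_expR.
rewrite PpE//; apply: (@le_trans _ _ (\int[mu]_(x in A) ((expR (- s))%:E * (rhom x)%:E)))%E.
  apply: ge0_le_integral => //.
  - by move=> x _; rewrite lee_fin.
  - by apply/measurable_EFinP; exact: measurable_funTS.
  - by apply: measurable_funeM; apply/measurable_EFinP; exact: measurable_funTS.
rewrite ge0_integralZl//; first last.
- by move=> x _; rewrite lee_fin.
- by apply/measurable_EFinP; exact: measurable_funTS.
rewrite -PmE// -[leRHS]mule1 lee_wpmul2l ?lee_fin ?expR_ge0//.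
exact: probability_le1.
Qed.

End FeatureMoments.

Section FeatureMeans.
Context {R : realType} {d : nat} {a b : R} {Pp Pm : probability (d.-tuple R) R}
  {mu : {measure set (d.-tuple R) -> \bar R}} {rhop rhom : d.-tuple R -> R}.
Hypotheses (hb : 0 < b) (hab : b < a).
Hypothesis h1 : assumption1 Pp Pm mu rhop rhom.
Notation t := (tfun rhop rhom).
Notation g := (gamma a b).
Notation M := (Mfun a b rhop rhom).
Notation theta := (theta Pp rhop rhom).
Notation sgn := (label_value R).
Notation K := (9 / 8 * cgamma a b).

Section Bounded.
Variables (F : R -> R) (C : R).
Hypotheses (mF : measurable_fun setT F) (FC : forall s, `|s| <= 1 -> `|F s| <= C).

(** The swap lemmas concern functions that are nonnegative on the whole line. Adding [C] makes [F]
    nonnegative on the range of [t], and the maximum with 0 takes care of the other arguments. *)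
Let G s := Num.max (F s + C) 0.

Let mG : measurable_fun setT G.
Proof. by apply: measurable_maxr => //; exact: measurable_funD. Qed.

Let G0 s : 0 <= G s. Proof. by rewrite le_max lexx orbT. Qed.

Let GE s : `|s| <= 1 -> G s = F s + C.
Proof.
by move=> /FC; rewrite ler_norml => /andP[Fs _]; rewrite /G max_l// -lerBlDr sub0r.
Qed.

Let mt := measurable_tfun h1.

Let tN1 x : `|- t x| <= 1. Proof. by rewrite normrN (tfun_bound h1). Qed.

Let has_int_C (Q : probability (d.-tuple R) R) : has_int Q setT (fun=> C) C.
Proof. by rewrite -[X in has_int _ _ _ X]mulr1; apply: has_int_cst => //; exact: probability_setT. Qed.

Lemma has_int_swap r : has_int Pp setT (fun x => F (- t x)) r ->
  has_int Pm setT (fun x => F (t x)) r.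
Proof.
move=> Fr; rewrite -[r](addrK C).
apply: (@has_int_ext _ _ _ _ _ (fun x => G (t x) - C)).
  by move=> x _; rewrite GE ?addrK// (tfun_bound h1).
apply: has_intB => //.
apply: has_int_ge0 => //; first exact: measurableT_comp mG mt.
rewrite (ge0_integral_swap h1 mG G0).
have [_ _ <-] := has_intD Fr (has_int_C Pp).
by apply: eq_integral => x _; rewrite GE.
Qed.

(** The weighted swap turns this integral into its own negative. Equivalently, [F (t)] and
    [t * F (t)] have the same mean under [Pp], which produces the factor [theta] in the mean of a
    score. *)
Lemma has_int_odd_weighted : (forall s, F (- s) = - F s) ->
  has_int Pp setT (fun x => F (t x) * (1 - t x)) 0.
Proof.
move=> Fodd.
have t2 x : `|1 - t x| <= 2.
  have := tfun_bound h1 x; rewrite !ler_norml => /andP[? ?].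
  by apply/andP; split; lra.
have C0 : 0 <= C.
  by apply: le_trans (FC (s := 0) _) => //; rewrite normr0.
have mt1 : measurable_fun setT (fun x => 1 - t x) by exact: measurable_funB.
have mFt : measurable_fun setT (fun x => F (t x) * (1 - t x)).
  by apply: measurable_funM => //; exact: measurableT_comp mF mt.
have Ft x : `|F (t x) * (1 - t x)| <= C * 2.
  by rewrite normrM ler_pM// FC// (tfun_bound h1).
have hF := has_int_bounded Pp mFt Ft.
have h1t := has_int_bounded Pp mt1 t2.
set r := fine _ in hF; set r1 := fine _ in h1t; suff -> : 0 = r by [].
have h2 := ge0_integral_weighted_swap h1 mG G0.
have [_ _ e1] := has_intD hF (has_intZ C h1t).
have [_ _ e2] := has_intB (has_intZ C h1t) hF.
move: h2.
under eq_integral => x _ do rewrite GE ?(tfun_bound h1)// mulrDl.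
rewrite e1.
under eq_integral => x _ do rewrite GE// Fodd mulrDl mulNr addrC.
by rewrite e2 => -[]; lra.
Qed.

End Bounded.

Lemma has_int_theta : has_int Pp setT (fun x => t x ^+ 2) theta.
Proof.
rewrite /theta unlock; apply: (@has_int_bounded _ _ _ _ _ 1).
  by apply: measurable_funX; exact: measurable_tfun h1.
by move=> x; rewrite normrX exprn_ile1// (tfun_bound h1).
Qed.

Lemma theta_le1 : theta <= 1.
Proof.
have h : has_int Pp setT (fun=> 1) (1 * 1).
  by apply: has_int_cst => //; exact: probability_setT.
rewrite -[1]mulr1; apply: (has_int_le has_int_theta h) => x _.
by rewrite -real_normK ?num_real// exprn_ile1// (tfun_bound h1).
Qed.

(** The mean [m] is also that of [t * M k], which lies between [g^k t^2] and [K g^k t^2]; and [M k]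
    is at most [K g^k |t|] in absolute value. Integration turns [t^2] into [theta]. *)
Lemma Mfun_moments k : (0 < k)%N -> exists m q : R,
  [/\ forall y, has_int (class_law (Pp := Pp) (Pm := Pm) y) setT (M k) (sgn y * m),
      forall y, has_int (class_law (Pp := Pp) (Pm := Pm) y) setT (fun x => M k x ^+ 2) q,
      g ^+ k * theta <= m, m <= K * g ^+ k * theta & q <= (K * g ^+ k) ^+ 2 * theta].
Proof.
move=> k0; have /andP[g0 g1] := gamma_bounds hb hab.
have gk0 : 0 < g ^+ k by rewrite exprn_gt0.
have K0 : 0 < K by rewrite /cgamma mulr_gt0// divr_gt0// subr_gt0 exprn_ilt1 ?ltW.
pose C := K * g ^+ k; have C0 : 0 < C by rewrite mulr_gt0.
(* [Mfun_bound] speaks only of arguments of the form [t x]. Clipping at [C] gives an odd function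
   bounded on the whole line that agrees with the score at these arguments. *)
pose F (s : R) := Num.max (- C) (Num.min C (2 * artanh (g ^+ k * s))).
have mF : measurable_fun setT F.
  apply: measurable_maxr => //; apply: measurable_minr => //.
  apply: measurable_funM => //; apply: measurableT_comp measurable_artanh _.
  exact: measurable_funM.
have FC s : `|s| <= 1 -> `|F s| <= C.
  move=> _; rewrite ler_norml /F le_max lexx/= ge_max ge_min lexx/= andbT.
  by rewrite (le_trans (y := 0))// ?oppr_le0 ltW.
have MC x : `|M k x| <= C.
  apply: le_trans (Mfun_bound hb hab h1 x k0) _.
  by rewrite ler_piMr ?(tfun_bound h1)//; exact: ltW.
have FE x : F (t x) = M k x.
  have := MC x; rewrite ler_norml => /andP[l1 l2].
  by rewrite /F -/(M k x) min_r// max_r.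
have FN s : F (- s) = - F s.
  rewrite /F mulrN artanhN mulrN; move: (2 * _) => z.
  have [zC|zC] := lerP z (- C).
    rewrite (@min_l _ _ C (- z)) ?(@min_r _ _ C z) ?(@max_r _ _ (- C) C); try lra.
    by rewrite max_l ?opprK.
  have [Cz|Cz] := lerP C z.
    by rewrite (@min_r _ _ C (- z)) ?(@max_l _ _ (- C) (- z)) ?(@max_r _ _ (- C) C); lra.
  by rewrite (@min_r _ _ C (- z)) ?(@max_r _ _ (- C) (- z)) ?(@max_r _ _ (- C) z); lra.
have mM : measurable_fun setT (M k) by exact: measurable_Mfun h1 k.
have hp := has_int_bounded Pp mM MC; set m : R := fine _ in hp.
have hM2 x : `|M k x ^+ 2| <= C ^+ 2 by rewrite normrX lerXn2r// nnegrE ltW.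
have mM2 : measurable_fun setT (fun x => M k x ^+ 2) by exact: measurable_funX.
have hq := has_int_bounded Pp mM2 hM2; set q : R := fine _ in hq.
have ht : has_int Pp setT (fun x => t x * M k x) m.
  rewrite -[m]subr0.
  apply: (has_int_ext _ (has_intB hp (has_int_odd_weighted mF FC FN))) => x _.
  by rewrite FE; ring.
have htheta := has_int_theta.
exists m, q; split.
- case; rewrite /= ?mul1r// mulN1r.
  apply: (@has_int_ext _ _ _ _ _ (fun x => F (t x))) => [x _|]; first exact: FE.
  apply: (has_int_swap mF FC).
  have := has_intZ (-1) hp; rewrite mulN1r; apply: has_int_ext => x _.
  by rewrite FN FE mulN1r.
- case=> //=.
  have mF2 : measurable_fun setT (fun s => F s ^+ 2) by exact: measurable_funX.
  have FC2 s : `|s| <= 1 -> `|F s ^+ 2| <= C ^+ 2.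
    by move=> /FC Fs; rewrite normrX lerXn2r// nnegrE ltW.
  apply: (@has_int_ext _ _ _ _ _ (fun x => F (t x) ^+ 2)) => [x _|]; first by rewrite FE.
  apply: (has_int_swap mF2 FC2).
  by apply: has_int_ext hq => x _; rewrite FN FE sqrrN.
- by apply: (has_int_le (has_intZ (g ^+ k) htheta) ht) => x _; exact: (Mfun_mul_ge hb hab h1 x k0).
- apply: (has_int_le ht (has_intZ C htheta)) => x _.
  apply: le_trans (ler_norm _) _; rewrite normrM.
  rewrite (_ : C * _ = `|t x| * (C * `|t x|)); last first.
    by rewrite -[t x ^+ 2]real_normK ?num_real//; ring.
  by rewrite ler_wpM2l// (Mfun_bound hb hab h1 x k0).
- apply: (has_int_le hq (has_intZ (C ^+ 2) htheta)) => x _.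
  rewrite -exprMn -[X in X <= _]real_normK ?num_real// -[X in _ <= X]real_normK ?num_real//.
  have -> : `|C * t x| = C * `|t x| by rewrite normrM gtr0_norm.
  apply: lerXn2r; rewrite ?nnegrE//; first by rewrite mulr_ge0// ltW.
  exact: (Mfun_bound hb hab h1 x k0).
Qed.

End FeatureMeans.

(** * Anticoncentration of the statistic *)

Section Anticoncentration.
Context {R : realType} {d : nat} {a b : R} {Pp Pm : probability (d.-tuple R) R}
  {L : limit_object a b Pp Pm}.
Notation P := (lo_prob L).
Notation sgn := (label_value R).
Notation class_law := (class_law (Pp := Pp) (Pm := Pm)).

Definition statistic (h : nat -> d.-tuple R -> R) l (w : lo_space L) : R :=
  \sum_(k < l.+1) feature_sum (h k) k w.

Lemma statistic_recl h l w : statistic h l w =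
  h 0%N (feature [::] w) + \sum_(k < l) feature_sum (h k.+1) k.+1 w.
Proof.
rewrite /statistic big_ord_recl /= /feature_sum /= big_seq1; congr (_ + _).
Qed.

Lemma measurable_feature_sum (h : d.-tuple R -> R) k : measurable_fun setT h ->
  measurable_fun setT (feature_sum (L := L) h k).
Proof.
move=> mh; apply: (measurable_fun_fibers (measurable_atom_code (L := L) k)) => w0.
exists (fun w => \sum_(v <- generation (tree w0) k) h (feature v w)); split.
  apply: measurable_sum => v; apply: measurableT_comp => //.
  exact: measurable_feature.
move=> w aw; have {}aw : atom k w0 w by rewrite -atom_codeE.
by rewrite /feature_sum (atom_generation aw).
Qed.

Lemma measurable_root_sign : measurable_fun setT (root_sign (L := L)).
Proof.
rewrite (_ : root_sign (L := L) = fun w => if label [::] w then 1 else -1); last first.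
  by apply/funext => w; rewrite /root_sign; case: label.
by apply: measurable_fun_ifT => //; exact: measurable_label.
Qed.

Lemma measurable_statistic h l : (forall k, measurable_fun setT (h k)) ->
  measurable_fun setT (statistic h l).
Proof. by move=> mh; apply: measurable_sum => k; exact: measurable_feature_sum. Qed.

Lemma measurable_statistic_itv h l (delta : R) : (forall k, measurable_fun setT (h k)) ->
  measurable [set w | 0 < root_sign w * statistic h l w <= delta].
Proof.
move=> mh; have mf : measurable_fun setT (fun w => root_sign w * statistic h l w).
  by apply: measurable_funM; [exact: measurable_root_sign|exact: measurable_statistic].
have := mf measurableT `]0, delta]%classic (measurable_itv _); rewrite setTI.
by congr measurable; apply/seteqP; split => w /=; rewrite in_itv.
Qed.

Section OneAtom.
Variables (h : nat -> d.-tuple R -> R) (l : nat) (w0 : lo_space L).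
Hypothesis mh : forall k, measurable_fun setT (h k).
Let A := atom l w0.
Let mA : measurable A. Proof. exact: measurable_atom. Qed.
Let F := ball (tree w0) l.
Let y := label [::] w0.

Let mfeature_set v B : measurable B -> measurable (feature (l := L) v @^-1` B).
Proof. by move=> mB; rewrite -[X in measurable X]setTI; exact: measurable_feature. Qed.

(** Events about the features of the vertices other than the root. They form a pi-system, and on the
    atom they are independent of the root feature. *)
Let cylinder (B : vertex -> set (d.-tuple R)) : set (lo_space L) :=
  [set w | forall v, v \in F -> v != [::] -> B v (feature v w)].

Let cylinders : set (set (lo_space L)) :=
  [set D | exists B, (forall v, measurable (B v)) /\ D = cylinder B].

Let measurable_cylinders : cylinders `<=` measurable.
Proof.
move=> _ [B [mB ->]].
rewrite (_ : cylinder B = [set w | forall v, v \in F ->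
   (if v == [::] then setT else feature v @^-1` B v) w]).
  by apply: measurable_all_in => v _; case: ifP => // _; exact: mfeature_set.
apply/seteqP; split => w /= H v vF; first by case: eqVneq => // v0; exact: H.
by move=> /negbTE v0; have := H _ vF; rewrite v0.
Qed.

Let cylinder_law (B0 : set (d.-tuple R)) B : measurable B0 ->
  (forall v, measurable (B v)) ->
  P (A `&` (feature [::] @^-1` B0) `&` cylinder B) =
  (class_law y B0 * P (A `&` cylinder B))%E.
Proof.
move=> mB0 mB.
have rF : [::] \in F by exact: root_ball.
have law C : (forall v, measurable (C v)) ->
   P [set w | atom l w0 w /\ forall v, v \in F -> C v (feature v w)] =
   (fine (P A) * \prod_(v <- F) fine (class_law (label v w0) (C v)))%:E.
  move=> mC; have := @atom_law_ext _ _ _ _ _ _ L l w0 [::] (fun=> 0%N) (fun=> true) C isT.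
  rewrite big_nil mulr1 => <- //.
  by congr (P _); apply/seteqP; split => w /=; [move=> []|move=> [? ?]].
have mC C : measurable C -> forall v, measurable (if v == [::] then C else B v).
  by move=> mC v; case: ifP.
have E C : A `&` (feature [::] @^-1` C) `&` cylinder B =
    [set w | atom l w0 w /\ forall v, v \in F -> (if v == [::] then C else B v) (feature v w)].
  apply/seteqP; split => w /=.
    by move=> [[? ?] h2]; split=> // v vF; case: eqVneq => [->|] //; exact: h2.
  move=> [? h2]; split; first by split=> //; exact: h2 rF.
  by move=> v vF /negbTE v0; have := h2 _ vF; rewrite v0.
have := E B0; have := E setT; rewrite preimage_setT setIT => -> ->.
rewrite (law _ (mC _ mB0)) (law _ (mC _ measurableT)).
rewrite !(bigD1_seq [::])//= ?ball_uniq// -/y.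
rewrite (eq_bigr (fun v => fine (class_law (label v w0) (B v)))); last by move=> v /negbTE ->.
rewrite [in RHS](eq_bigr (fun v => fine (class_law (label v w0) (B v)))); last by move=> v /negbTE ->.
have -> : fine (class_law y setT) = 1 by rewrite probability_setT.
rewrite -[in RHS](fineK (fin_num_measure (class_law y) _ mB0)) -EFinM.
by congr EFin; ring.
Qed.

(** The tree and the root label are frozen at [w0], so this is a function of the nonroot features on
    the whole space; on the atom it is the signed statistic without its root term. *)
Definition nonroot_sum (w : lo_space L) : R :=
  sgn y * \sum_(k < l) \sum_(v <- generation (tree w0) k.+1) h k.+1 (feature v w).

Let measurable_nonroot_sum : measurable_fun setT nonroot_sum.
Proof.
apply: measurable_funM => //; apply: measurable_sum => k; apply: measurable_sum => v.
by apply: measurableT_comp => //; exact: measurable_feature.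
Qed.

Let nonroot_sum_sigma (C : set R) : measurable C -> <<s cylinders >> (nonroot_sum @^-1` C).
Proof.
move=> mC; pose T' := g_sigma_algebraType cylinders.
suff : measurable_fun setT (nonroot_sum : T' -> R).
  by move=> /(_ measurableT C mC); rewrite setTI.
apply: measurable_funM => //; apply: measurable_sum => k.
(* Measurability of the sum is checked term by term for every address, in the list or not. The guard
   holds for all addresses of the list and makes the other terms constant. *)
rewrite (_ : (fun w : T' => _) = fun w : T' => \sum_(v <- generation (tree w0) k.+1)
    (if (v \in F) && (v != [::]) then h k.+1 (feature v (w : lo_space L)) else 0)); last first.
  apply/funext => w; apply: eq_big_seq => v vk.
  rewrite (generation_ball vk)//=; move: vk; rewrite mem_generation.
  by case: v.
apply: measurable_sum => v.
have [/andP[vF v0]|_] := boolP ((v \in F) && (v != [::])); last exact: measurable_cst.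
apply: (measurableT_comp (mh k.+1)) => _ B mB; rewrite setTI.
apply: sub_sigma_algebra; exists (fun u => if u == v then B else setT); split.
  by move=> u; case: ifP.
apply/seteqP; split => w /=; last by move=> /(_ _ vF v0); rewrite eqxx.
by move=> wB u uF u0; case: eqP => [->|].
Qed.

(** Both sides are finite measures of the nonroot event and agree on cylinders, hence on the
    sigma-algebra they generate. *)
Let nonroot_sum_law (B : set (d.-tuple R)) (C : set R) : measurable B -> measurable C ->
  P (A `&` (feature [::] @^-1` B) `&` (nonroot_sum @^-1` C)) =
  (class_law y B * P (A `&` (nonroot_sum @^-1` C)))%E.
Proof.
move=> mB mC.
have mAB : measurable (A `&` (feature [::] @^-1` B)).
  by apply: measurableI => //; exact: mfeature_set.
pose c : {nonneg R} := NngNum (fine_ge0 (measure_ge0 (class_law y) B)).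
pose m1 := mrestr P mAB; pose m2 := mscale c (mrestr P mA).
suff : m1 (nonroot_sum @^-1` C) = m2 (nonroot_sum @^-1` C).
  rewrite /m1 /m2 /= /mscale /mrestr /= fineK ?fin_num_measure//.
  by rewrite setIC => ->; rewrite setIC.
have cylT : cylinders setT.
  by exists (fun=> setT); split => //; apply/seteqP; split.
apply: (@g_sigma_algebra_measure_unique _ _ _ cylinders measurable_cylinders (fun=> setT)) => //.
- by rewrite -subTset => w _; exists 0%N.
- move=> _ _ [B1 [mB1 ->]] [B2 [mB2 ->]]; exists (fun v => B1 v `&` B2 v); split.
    by move=> v; exact: measurableI.
  apply/seteqP; split => w /=; first by move=> [H1 H2] v vF v0; split; [exact: H1|exact: H2].
  by move=> H; split => v vF v0; have [] := H v vF v0.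
- move=> _ [B1 [mB1 ->]]; rewrite /m1 /m2 /= /mscale /mrestr /= fineK ?fin_num_measure//.
  by rewrite setIC cylinder_law// [X in (_ * P X)%E]setIC.
- by move=> _; rewrite -ge0_fin_numE// /m1/= /mrestr fin_num_measure// setTI.
- exact: nonroot_sum_sigma.
Qed.

(** On the atom the root feature is independent of [nonroot_sum]. For each fixed value [r] of the
    latter the hypothesis bounds the probability over the root feature, and Tonelli's theorem
    averages over [r]. *)
Lemma atom_anticoncentration (delta c : R) : 0 <= c ->
  (forall y r, class_law y [set x | 0 < sgn y * h 0%N x + r <= delta]%R <= c%:E)%E ->
  (P (A `&` [set w | 0 < root_sign w * statistic h l w <= delta]%R) <= c%:E * P A)%E.
Proof.
move=> c0 conc.
have PAfin : P A \is a fin_num by exact: fin_num_measure.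
pose pA : {nonneg R} := NngNum (fine_ge0 (measure_ge0 P A)).
have pAE : (pA%:num%:E = P A)%E by rewrite /= fineK.
pose law_W := measure_function_pushforward__canonical__measure_function_Measure
    (mrestr P mA) measurable_nonroot_sum.
(* The law of [nonroot_sum] conditioned on the atom; the Dirac mass is the fallback for a null
   atom. *)
pose Q : probability R R := mnormalize law_W (\d_(0 : R)).
have QE C : measurable C -> (pA%:num%:E * Q C = P (A `&` (nonroot_sum @^-1` C)))%E.
  move=> mC.
  have lE B : law_W B = P (A `&` (nonroot_sum @^-1` B)).
    by rewrite /law_W/= /pushforward /mrestr setIC.
  have lT : law_W setT = P A by rewrite lE preimage_setT setIT.
  rewrite /Q /= /mnormalize lT; case: ifPn => [/orP[/eqP PA0|/eqP PAoo]|].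
  - rewrite pAE PA0 mul0e; apply/esym/eqP; rewrite eq_le measure_ge0 andbT -[leRHS]PA0.
    apply: le_measure; rewrite ?inE//; apply: measurableI => //.
    by rewrite -[X in measurable X]setTI; exact: measurable_nonroot_sum.
  - by move: PAfin; rewrite PAoo.
  - rewrite negb_or => /andP[PA0 _]; rewrite -/law_W lE muleC -muleA -EFinM mulVf ?mule1//.
    by rewrite fine_eq0.
pose S := [set z : R * d.-tuple R | 0 < sgn y * h 0%N z.2 + z.1 <= delta].
have mS : measurable S.
  have mf : measurable_fun setT (fun z : R * d.-tuple R => sgn y * h 0%N z.2 + z.1).
    apply: measurable_funD => //; apply: measurable_funM => //.
    by apply: measurableT_comp => //; exact: measurable_snd.
  have := mf measurableT `]0, delta]%classic (measurable_itv _); rewrite setTI.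
  by congr measurable; apply/seteqP; split => z /=; rewrite in_itv.
have mS1 : measurable_fun setT (fun z : R * d.-tuple R => (\1_S z : R)%:E).
  by apply/measurable_EFinP; exact: measurable_indic.
have key : (\int[P]_(w in A) (\1_S (nonroot_sum w, feature [::] w) : R)%:E <= c%:E * P A)%E.
  rewrite (@ge0_integral_product_law _ _ _ P _ _ _ _ Q (class_law y) A mA nonroot_sum
    (feature [::]) measurable_nonroot_sum (@measurable_feature _ _ _ _ _ _ L [::]) pA _
    (fun z => (\1_S z : R)%:E)).
  - rewrite pAE muleC lee_wpmul2r//.
    apply: (@le_trans _ _ (\int[Q]_r c%:E)%E).
      apply: ge0_le_integral => //.
      - by move=> r _; apply: integral_ge0 => x _; rewrite lee_fin.
      - have S0 (z : R * d.-tuple R) : (0 <= (\1_S z : R)%:E)%E by rewrite lee_fin.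
        exact: (measurable_fun_fubini_tonelli_F _ mS1 S0).
      - move=> r _.
        rewrite (_ : (fun x => (\1_S (r, x) : R)%:E) = EFin \o \1_[set x | 0 < sgn y * h 0%N x + r <= delta]).
          rewrite integral_indic// ?setIT; first exact: conc.
          have mr : measurable_fun setT (fun x => sgn y * h 0%N x + r).
            by apply: measurable_funD => //; exact: measurable_funM.
          have := mr measurableT `]0, delta]%classic (measurable_itv _); rewrite setTI.
          by congr measurable; apply/seteqP; split => z /=; rewrite in_itv.
        by apply/funext => x; rewrite /= !indicE; congr ((nat_of_bool _)%:R)%:E.
    by have [_ _ ->] := has_int_cst (m := Q) c measurableT (probability_setT Q); rewrite mulr1.
  - move=> B B' mB mB'.
    by rewrite setIAC nonroot_sum_law// -QE// muleCA [X in (_ * X)%E = _]muleC.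
  - exact: mS1.
  - by move=> z; rewrite lee_fin.
apply: le_trans key.
rewrite (_ : (fun w => (\1_S (nonroot_sum w, feature [::] w) : R)%:E) =
  EFin \o \1_[set w | S (nonroot_sum w, feature [::] w)]); last first.
  by apply/funext => w; rewrite /= !indicE; congr ((nat_of_bool _)%:R)%:E.
have mSW : measurable [set w | S (nonroot_sum w, feature [::] w)].
  have mWX : measurable_fun setT (fun w => (nonroot_sum w, feature (l := L) [::] w)).
    by apply: measurable_fun_pair => //; exact: measurable_feature.
  by have := mWX measurableT S mS; rewrite setTI.
rewrite integral_indic// setIC; apply: le_measure; rewrite ?inE.
- apply: measurableI => //; exact: measurable_statistic_itv.
- exact: measurableI.
move=> w [] H Aw /=; split=> //; rewrite /S /=.
rewrite (_ : _ + _ = root_sign w * statistic h l w)//.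
rewrite statistic_recl /root_sign (atom_label Aw) ?root_ball// mulrDr; congr (_ + _).
rewrite /nonroot_sum; congr (_ * _); apply: eq_bigr => k _.
by rewrite /feature_sum (atom_generation Aw)// ltnS ltnW.
Qed.

End OneAtom.

Lemma anticoncentration h l (delta c : R) : (forall k, measurable_fun setT (h k)) -> 0 <= c ->
  (forall y r, class_law y [set x | 0 < sgn y * h 0%N x + r <= delta]%R <= c%:E)%E ->
  (P [set w | 0 < root_sign w * statistic h l w <= delta]%R <= c%:E)%E.
Proof.
move=> mh c0 conc; set E := [set w | _].
have mE : measurable E by exact: measurable_statistic_itv.
have := @le_integral_fibers _ _ _ P _ (measurable_atom_code (L := L) l)
  (EFin \o \1_E) (fun=> c%:E).
rewrite integral_indic// setIT.
have [_ _ ->] := has_int_cst (m := P) c measurableT (probability_setT P); rewrite mulr1.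
apply.
- by apply/measurable_EFinP; exact: measurable_indic.
- exact: measurable_cst.
- by move=> w; rewrite lee_fin.
- by move=> w; rewrite lee_fin.
move=> w0; rewrite atom_codeE integral_indic//; last exact: measurable_atom.
rewrite integral_cst; last exact: measurable_atom.
by rewrite setIC; exact: atom_anticoncentration.
Qed.

End Anticoncentration.

(** * Error bounds *)

Lemma weighted_cauchy_schwarz {R : realFieldType} {I : eqType} (s : seq I) (x w : I -> R) :
  {in s, forall i, 0 < w i} ->
  (\sum_(i <- s) x i) ^+ 2 <= (\sum_(i <- s) w i) * \sum_(i <- s) x i ^+ 2 / w i.
Proof.
elim: s => [|i s IH] w0; first by rewrite !big_nil expr0n mul0r.
have wi0 : 0 < w i by apply: w0; rewrite mem_head.
have ws0 : {in s, forall i, 0 < w i} by move=> j js; apply: w0; rewrite in_cons js orbT.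
rewrite !big_cons.
have [->|sN0] := eqVneq s [::].
  by rewrite !big_nil !addr0 mulrCA mulfV ?mulr1// gt_eqF.
have W0 : 0 < \sum_(j <- s) w j.
  case: s sN0 ws0 {IH w0} => [//|j s _ ws0]; rewrite big_cons.
  rewrite ltr_pwDl ?(ws0 j) ?mem_head// big_seq sumr_ge0// => k ks.
  by rewrite ltW// ws0// in_cons ks orbT.
have := IH ws0.
move: (\sum_(j <- s) x j) (\sum_(j <- s) w j) (\sum_(j <- s) x j ^+ 2 / w j) W0 => X W Y W0 XWY.
have XY : X ^+ 2 / W <= Y by rewrite ler_pdivrMr// mulrC.
apply: (@le_trans _ _ ((w i + W) * (x i ^+ 2 / w i + X ^+ 2 / W))); last first.
  by rewrite ler_wpM2l ?lerD2l// addr_ge0// ltW.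
(* The two-term inequality that drives the induction, with its defect written as a square. *)
rewrite -subr_ge0 (_ : _ - _ = (w i * X - W * x i) ^+ 2 / (w i * W)).
  by rewrite divr_ge0 ?sqr_ge0// mulr_ge0// ltW.
by field; rewrite !gt_eqF.
Qed.

Section Markov.
Context {dT} {T : measurableType dT} {R : realType} (P : probability T R).

Lemma has_int_indic (E : set T) : measurable E ->
  has_int P setT (\1_E : T -> R) (fine (P E)).
Proof.
move=> mE; apply: has_int_ge0 => //.
by rewrite integral_indic// setIT fineK// fin_num_measure.
Qed.

Lemma markov_has_int (E : set T) (f : T -> R) (c v : R) : measurable E -> 0 < c ->
  (forall w, 0 <= f w) -> (forall w, E w -> c <= f w) -> has_int P setT f v ->
  fine (P E) <= v / c.
Proof.
move=> mE c0 f0 fE fv; rewrite ler_pdivlMr// mulrC.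
apply: (has_int_le (has_intZ c (has_int_indic mE)) fv) => w _.
rewrite indicE; case: (boolP (w \in E)) => [/set_mem wE|_].
  by rewrite mulr1; exact: fE.
by rewrite mulr0.
Qed.

Lemma fine_measureU_le (E F : set T) : measurable E -> measurable F ->
  fine (P (E `|` F)) <= fine (P E) + fine (P F).
Proof.
move=> mE mF; rewrite -lee_fin EFinD !fineK ?fin_num_measure//; last exact: measurableU.
exact: measureU2.
Qed.

Lemma fine_le_measure (E F : set T) : measurable E -> measurable F -> E `<=` F ->
  fine (P E) <= fine (P F).
Proof.
move=> mE mF EF; rewrite fine_le ?fin_num_measure//.
by apply: le_measure; rewrite ?inE.
Qed.

End Markov.

Section Root.
Context {R : realType} {d : nat} {a b : R} {Pp Pm : probability (d.-tuple R) R}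
  {mu : {measure set (d.-tuple R) -> \bar R}} {rhop rhom : d.-tuple R -> R}
  {L : limit_object a b Pp Pm}.
Hypotheses (hb : 0 < b) (hab : b < a).
Hypothesis D0 : 0 < Delta a b.
Hypothesis h1 : assumption1 Pp Pm mu rhop rhom.
Notation P := (lo_prob L).
Notation M := (Mfun a b rhop rhom).
Notation sgn := (label_value R).
Notation class_law := (class_law (Pp := Pp) (Pm := Pm)).

(** The signed root score has the same law for both labels, by the involution, so tail and density
    bounds are needed under [Pp] only. *)
Lemma class_law_signed_root y (A : set R) : measurable A ->
  class_law y [set x | A (sgn y * M 0 x)] = Pp [set x | A (M 0 x)].
Proof.
move=> mA; case: y => /=.
  by congr (Pp _); apply/funext => x /=; rewrite mul1r.
rewrite -(Mfun0_swap h1 mA).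
by congr (Pm _); apply/funext => x /=; rewrite mulN1r.
Qed.

Lemma root_concentration B (delta : R) y r : 0 <= delta ->
  assumption3 Pp rhop rhom B ->
  (class_law y [set x | 0 < sgn y * M 0 x + r <= delta]%R <= (B * delta)%:E)%E.
Proof.
move=> dl0 [f [mf fB fE]].
pose I := `](- r), (delta - r)]%classic : set R.
have mI : measurable I by exact: measurable_itv.
have -> : [set x | 0 < sgn y * M 0 x + r <= delta] = [set x | I (sgn y * M 0 x)].
  by apply/funext => x; rewrite /I /= in_itv/= lerBrDr -(subr_gt0 (- r)) opprK.
rewrite class_law_signed_root//.
rewrite (_ : [set x | I (M 0 x)] = [set x | I (ln (psi rhop rhom x))]); last first.
  by apply/funext => x /=; rewrite (Mfun0_psi h1).
rewrite fE//; apply: (@le_trans _ _ (\int[lebesgue_measure]_(z in I) B%:E)%E).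
  apply: ge0_le_integral => //.
  - by move=> z _; rewrite lee_fin; case/andP: (fB z).
  - by apply/measurable_EFinP; exact: measurable_funTS.
  - by move=> z _; rewrite lee_fin; case/andP: (fB z).
have lI : lebesgue_measure I = delta%:E.
  rewrite /I lebesgue_measure_itv/= lte_fin.
  case: ltP => [_|]; first by rewrite -EFinD opprK subrK.
  by rewrite lerBlDr addNr => dl1; congr EFin; apply/eqP; rewrite eq_le dl0 dl1.
by have [_ _ ->] := has_int_cst (m := lebesgue_measure) B mI lI.
Qed.

Lemma root_tail s : 0 < s ->
  fine (P [set w | root_sign w * M 0 (feature [::] w) <= - s]) <= expR (- s).
Proof.
move=> s0; set E := [set w | _].
pose A := [set z : R | z <= - s].
have mA : measurable A by rewrite /A -set_itvNyc; exact: measurable_itv.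
pose B y := [set x | A (sgn y * M 0 x)].
have mB y : measurable (B y).
  have mM : measurable_fun setT (fun x => sgn y * M 0 x).
    by apply: measurable_funM => //; exact: measurable_Mfun h1 0%N.
  by have := mM measurableT A mA; rewrite setTI.
have mE y : measurable ([set w : lo_space L | label [::] w = y] `&` (feature [::] @^-1` B y)).
  apply: measurableI; first exact: measurable_label_eq.
  by rewrite -[X in measurable X]setTI; exact: measurable_feature.
have -> : E = ([set w : lo_space L | label [::] w = true] `&` (feature [::] @^-1` B true)) `|`
   ([set w : lo_space L | label [::] w = false] `&` (feature [::] @^-1` B false)).
  apply/seteqP; split => w /=; rewrite /E /B /A /= /root_sign.
    by case: (label [::] w) => ?; [left|right].
  by case=> -[->].
apply: le_trans (fine_measureU_le _ (mE true) (mE false)) _.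
rewrite !(root_label_feature_law D0)//=.
have tail y : fine (class_law y (B y)) <= expR (- s).
  rewrite -lee_fin fineK ?fin_num_measure// /B class_law_signed_root//.
  by have := Mfun0_tail (a := a) (b := b) h1 s0.
by have := tail true; have := tail false => /=; lra.
Qed.

End Root.

Section ModelConstants.
Context {R : realType} {a b : R}.
Hypotheses (hb : 0 < b) (hab : b < a).

Lemma Delta_gt0 : 0 < Delta a b.
Proof. by rewrite /Delta divr_gt0// addr_gt0// (lt_trans hb). Qed.

Lemma kappaE : kappa a b = gamma a b ^+ 2 * Delta a b.
Proof. by []. Qed.

Lemma kappa_gt0 : 0 < kappa a b.
Proof.
have /andP[g0 _] := gamma_bounds hb hab.
by rewrite /kappa mulr_gt0 ?exprn_gt0// Delta_gt0.
Qed.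

Lemma cgamma_gt0 : 0 < cgamma a b.
Proof.
have /andP[g0 g1] := gamma_bounds hb hab.
by rewrite /cgamma divr_gt0// subr_gt0 exprn_ilt1// ltW.
Qed.

End ModelConstants.

(* [x] and [lv] stand for [D ^+ k] and the value of [label_var] at [k]. *)
Lemma subcritical_moment_le {R : realFieldType} (x lv kap c q m2 : R) :
  0 <= x -> 0 <= lv -> 0 < kap -> kap < 1 -> 0 <= lv * (kap - 1) + x ->
  m2 <= c -> 0 <= c -> q <= c ->
  x * (q - m2) + m2 * lv + m2 * (lv * (kap - 1) + x) <= c * x / (1 - kap).
Proof.
move=> x0 lv0 k0 k1 s0 m2c c0 qc.
rewrite ler_pdivlMr ?subr_gt0//.
rewrite (_ : _ * (1 - kap) = (x * q + m2 * (kap * lv)) * (1 - kap)); last by ring.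
apply: (@le_trans _ _ ((x * c + c * (kap * lv)) * (1 - kap))).
  rewrite ler_wpM2r ?subr_ge0 ?(ltW k1)// lerD//; first by rewrite ler_wpM2l.
  by rewrite ler_wpM2r// mulr_ge0// ltW.
rewrite (_ : _ * (1 - kap) = c * ((x + kap * lv) * (1 - kap))); last by ring.
by rewrite ler_wpM2l//; nra.
Qed.

Lemma geometric_segment_le {R : realFieldType} (r : R) m n : 0 <= r < 1 ->
  \sum_(m <= k < n) r ^+ k <= r ^+ m / (1 - r).
Proof.
move=> /andP[r0 r1]; rewrite ler_pdivlMr ?subr_gt0//.
have [nm|/ltnW mn] := leqP n m; first by rewrite big_geq// mul0r exprn_ge0.
rewrite -(subnKC mn); elim: (n - m)%N => [|j IH].
  by rewrite addn0 big_geq// mul0r exprn_ge0.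
suff -> : (\sum_(m <= k < m + j.+1) r ^+ k) * (1 - r) = r ^+ m - r ^+ (m + j.+1).
  by rewrite gerBl exprn_ge0.
elim: {IH} j => [|j IH]; first by rewrite addn1 big_nat1 exprS; ring.
by rewrite addnS big_nat_recr ?leq_addr//= mulrDl IH [in RHS]exprS; ring.
Qed.

(** The origin of the 3 in [C1]. With [r^2 = kappa], [1 / (1 - r)^2 = (1 + r)^2 / (1 - kappa)^2] is
    at most [4 / (1 - kappa)^2], and [4 * (9/8)^2 = 81/16] is below [2 * 3]. *)
Lemma subcritical_tail_le {R : realFieldType} (r cg th : R) l : 0 < r < 1 -> 0 <= th ->
  (9 / 8 * cg) ^+ 2 * th / (1 - r ^+ 2) * (r ^+ l.+1 / (1 - r)) ^+ 2 <=
  2 * (3 * cg ^+ 2 * th / (1 - r ^+ 2) ^+ 3) * (r ^+ 2) ^+ l.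
Proof.
move=> /andP[r0 r1] th0.
have n1 : 0 < 1 - r by rewrite subr_gt0.
have n2 : 0 < 1 + r by rewrite addr_gt0.
have e : 1 - r ^+ 2 = (1 - r) * (1 + r) by ring.
rewrite -subr_ge0 e.
have -> : 2 * (3 * cg ^+ 2 * th / ((1 - r) * (1 + r)) ^+ 3) * (r ^+ 2) ^+ l -
  (9 / 8 * cg) ^+ 2 * th / ((1 - r) * (1 + r)) * (r ^+ l.+1 / (1 - r)) ^+ 2 =
  cg ^+ 2 * th * r ^+ l ^+ 2 / ((1 - r) * (1 + r)) ^+ 3 *
    (6 - 81 / 64 * r ^+ 2 * (1 + r) ^+ 2).
  rewrite -[(r ^+ 2) ^+ l]exprM mulnC exprM (exprS r l).
  by move: (r ^+ l) => z; field; rewrite !gt_eqF.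
apply: mulr_ge0.
  apply: divr_ge0; last by apply/exprn_ge0/mulr_ge0; exact: ltW.
  by apply: mulr_ge0; [apply: mulr_ge0 => //|]; exact: sqr_ge0.
have r2 : r ^+ 2 <= 1 by rewrite exprn_ile1// ltW.
have s2 : (1 + r) ^+ 2 <= 4 by nra.
have : r ^+ 2 * (1 + r) ^+ 2 <= 1 * 4 by rewrite ler_pM// sqr_ge0.
by rewrite -mulrA; move: (r ^+ 2 * _) => z; lra.
Qed.

(** * The tail of the statistic when kappa < 1 *)

Section ErrorComparison.
Context {R : realType} {d : nat} {a b : R} {Pp Pm : probability (d.-tuple R) R}
  {mu : {measure set (d.-tuple R) -> \bar R}} {rhop rhom : d.-tuple R -> R}
  {L : limit_object a b Pp Pm}.
Hypotheses (hb : 0 < b) (hab : b < a).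
Hypothesis h1 : assumption1 Pp Pm mu rhop rhom.
Hypothesis h2 : assumption2 Pp rhop rhom.
Notation P := (lo_prob L).
Notation M := (Mfun a b rhop rhom).
Notation T := (statistic (L := L) M).
Notation g := (gamma a b).
Notation D := (Delta a b).
Notation kap := (kappa a b).
Notation theta := (theta Pp rhop rhom).
Notation K := (9 / 8 * cgamma a b).

Let g0 : 0 < g. Proof. by have /andP[] := gamma_bounds hb hab. Qed.
Let g1 : g < 1. Proof. by have /andP[] := gamma_bounds hb hab. Qed.
Let D0 : 0 < D. Proof. exact: Delta_gt0. Qed.
Let g01 : -1 <= g <= 1. Proof. by rewrite (ltW g1) andbT (le_trans _ (ltW g0))// lerN10. Qed.
Let th0 : 0 < theta := h2.

Let kap0 : 0 < kap. Proof. exact: kappa_gt0. Qed.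

Lemma kappaX k : g ^+ (2 * k) * D ^+ k = kap ^+ k.
Proof. by rewrite kappaE; move: g D => x y; rewrite exprMn -exprM. Qed.

Lemma feature_sum_deviation k : (0 < k)%N -> exists m q : R,
  [/\ g ^+ k * theta <= m, m ^+ 2 <= K ^+ 2 * g ^+ (2 * k) * theta,
      q <= K ^+ 2 * g ^+ (2 * k) * theta &
   forall c, has_int P setT (fun w => (root_sign w * feature_sum (M k) k w - c) ^+ 2)
    (D ^+ k * (q - m ^+ 2) + m ^+ 2 * label_var (a := a) (b := b) k +
      (m * (g * D) ^+ k - c) ^+ 2)].
Proof.
move=> k0; have [m [q [hm hq m1 m2 q1]]] := Mfun_moments hb hab h1 k0.
have gk0 : 0 < g ^+ k by rewrite exprn_gt0.
have m0 : 0 < m by apply: lt_le_trans m1; rewrite mulr_gt0.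
exists m, q; split => //.
(* Squaring [m <= K g^k theta] gives [theta^2], weakened to [theta] so that [m^2] and [q] have the
   same bound. *)
- rewrite mulnC exprM -exprMn; have := theta_le1 h1 => th1.
  apply: (@le_trans _ _ ((K * g ^+ k * theta) ^+ 2)).
    by apply: lerXn2r; rewrite ?nnegrE//; [exact: ltW|exact: le_trans (ltW m0) m2].
  rewrite [X in X <= _]exprMn ler_wpM2l ?sqr_ge0//.
  by move: theta th0 th1 => z z0 z1; nra.
- by rewrite mulnC exprM -exprMn.
- move=> c; apply: has_int_feature_sum => //; rewrite ?gt_eqF//.
Qed.

Section Subcritical.
Hypothesis kap1 : kap < 1.

Lemma feature_sum_sqr k : (0 < k)%N -> exists v : R,
  v <= K ^+ 2 * theta * kap ^+ k / (1 - kap) /\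
  has_int P setT (fun w => (root_sign w * feature_sum (M k) k w) ^+ 2) v.
Proof.
move=> k0; have [m [q [_ m2 q2 /(_ 0) hv]]] := feature_sum_deviation k0.
eexists; split; last first.
  by apply: has_int_ext hv => w _; rewrite subr0.
have -> : (m * (g * D) ^+ k - 0) ^+ 2 = m ^+ 2 * (g * D) ^+ (2 * k).
  by rewrite subr0 [in LHS]exprMn mulnC exprM.
have lv := label_var_closed (a := a) (b := b) k.
have gD0 : 0 <= (g * D) ^+ (2 * k) by rewrite exprM exprn_ge0// sqr_ge0.
have e : (g * D) ^+ (2 * k) = label_var (a := a) (b := b) k * (kap - 1) + D ^+ k by rewrite lv subrK.
rewrite e; rewrite e in gD0.
rewrite (_ : K ^+ 2 * theta * kap ^+ k = K ^+ 2 * g ^+ (2 * k) * theta * D ^+ k); last first.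
  by rewrite -kappaX; move: (g ^+ _) (D ^+ _) => x y; ring.
apply: subcritical_moment_le => //.
- by rewrite exprn_ge0// ltW.
- exact: label_var_ge0.
- exact: le_trans (sqr_ge0 m) m2.
Qed.

Lemma statistic_close_tail l l' (delta : R) : (l <= l')%N -> 0 < delta ->
  fine (P [set w | delta <= `|root_sign w * (T l' w - T l w)|]) <=
    2 * C1 a b theta * kap ^+ l / delta ^+ 2.
Proof.
move=> ll' dl0.
have kap1' : 0 < 1 - kap by rewrite subr_gt0.
(* The second moment of the k-th term is at most a constant times [r^(2 k)]. With weights [r^k] both
   factors of the Cauchy-Schwarz bound become the same geometric sum. *)
pose r := Num.sqrt kap.
have r0 : 0 < r by rewrite sqrtr_gt0.
have rE : r ^+ 2 = kap by rewrite sqr_sqrtr// ltW.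
have r1 : r < 1 by rewrite -[1]sqrtr1 ltr_sqrt.
pose s := index_iota l.+1 l'.+1.
pose S k w := root_sign w * feature_sum (L := L) (M k) k w.
have TE w : root_sign w * (T l' w - T l w) = \sum_(k <- s) S k w.
  rewrite /statistic -!(big_mkord xpredT (fun k => feature_sum (M k) k w)).
  rewrite (@big_cat_nat _ _ _ l.+1)//= addrAC subrr add0r mulr_sumr.
  by [].
have sgt0 k : k \in s -> (0 < k)%N by rewrite mem_index_iota => /andP[/(leq_ltn_trans _) ->].
have hS k : k \in s -> has_int P setT (fun w => S k w ^+ 2)
    (fine (\int[P]_w (S k w ^+ 2)%:E)%E) /\
    fine (\int[P]_w (S k w ^+ 2)%:E)%E <= K ^+ 2 * theta * kap ^+ k / (1 - kap).
  move=> /sgt0 /feature_sum_sqr [v [vle hv]].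
  by rewrite -(has_int_fine hv).
pose f w := (\sum_(k <- s) r ^+ k) * \sum_(k <- s) S k w ^+ 2 / r ^+ k.
pose v k := fine (\int[P]_w (S k w ^+ 2)%:E)%E.
have rk0 k : 0 < r ^+ k by rewrite exprn_gt0.
have hf : has_int P setT f ((\sum_(k <- s) r ^+ k) * \sum_(k <- s) (r ^+ k)^-1 * v k).
  apply: has_intZ.
  apply: (@has_int_ext _ _ _ _ _ (fun w => \sum_(k <- s) (r ^+ k)^-1 * S k w ^+ 2)).
    by move=> w _; apply: eq_bigr => k _; rewrite mulrC.
  apply: (@has_int_sum _ _ _ _ _ _ _ (fun k w => (r ^+ k)^-1 * S k w ^+ 2)) => // k ks.
  exact: has_intZ (hS k ks).1.
have f0 w : 0 <= f w.
  rewrite mulr_ge0 ?sumr_ge0// => k _; first exact: ltW.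
  by rewrite divr_ge0 ?sqr_ge0// ltW.
have mT j : measurable_fun setT (T j).
  by apply: measurable_statistic => k; exact: measurable_Mfun h1 k.
have mE : measurable [set w | delta <= `|root_sign w * (T l' w - T l w)|].
  have mf : measurable_fun setT (fun w => `|root_sign w * (T l' w - T l w)|).
    apply: measurableT_comp => //; apply: measurable_funM; first exact: measurable_root_sign.
    exact: measurable_funB.
  have := mf measurableT `[delta, +oo[%classic (measurable_itv _); rewrite setTI.
  by congr measurable; apply/seteqP; split => w /=; rewrite in_itv/= andbT.
have d20 : 0 < delta ^+ 2 by rewrite exprn_gt0.
apply: le_trans (markov_has_int mE d20 f0 _ hf) _.
  move=> w /=; rewrite TE => dle; apply: (@le_trans _ _ ((\sum_(k <- s) S k w) ^+ 2)).
    rewrite -[X in _ <= X]real_normK ?num_real//; apply: lerXn2r; rewrite ?nnegrE//.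
    exact: ltW.
  by apply: weighted_cauchy_schwarz => k _.
rewrite ler_wpM2r ?invr_ge0 ?(ltW d20)//.
set C' := K ^+ 2 * theta / (1 - kap).
have C'0 : 0 <= C'.
  apply: divr_ge0; last exact: ltW.
  by apply: mulr_ge0; [exact: sqr_ge0|exact: ltW].
have sumv : \sum_(k <- s) (r ^+ k)^-1 * v k <= C' * \sum_(k <- s) r ^+ k.
  rewrite mulr_sumr big_seq [X in _ <= X]big_seq; apply: ler_sum => k ks.
  rewrite mulrC ler_pdivrMr//; apply: le_trans (hS k ks).2 _.
  have -> : kap ^+ k = r ^+ k * r ^+ k by rewrite -rE expr2 exprMn.
  rewrite /C'; move: (r ^+ k) => x.
  by rewrite le_eqVlt; apply/orP; left; apply/eqP; ring.
have sumr : \sum_(k <- s) r ^+ k <= r ^+ l.+1 / (1 - r).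
  by apply: geometric_segment_le; rewrite r1 andbT ltW.
have sum0 : 0 <= \sum_(k <- s) r ^+ k by rewrite sumr_ge0// => k _; exact: ltW.
apply: (@le_trans _ _ (C' * (r ^+ l.+1 / (1 - r)) ^+ 2)).
  apply: (@le_trans _ _ ((\sum_(k <- s) r ^+ k) * (C' * \sum_(k <- s) r ^+ k))).
    by rewrite ler_wpM2l.
  rewrite mulrCA ler_wpM2l// expr2; apply: ler_pM => //.
rewrite /C' /C1 -rE; apply: subcritical_tail_le; last exact: ltW.
by rewrite r0 r1.
Qed.

End Subcritical.
End ErrorComparison.

Section ErrorBounds.
Context {R : realType} {d : nat} {a b : R} {Pp Pm : probability (d.-tuple R) R}
  {mu : {measure set (d.-tuple R) -> \bar R}} {rhop rhom : d.-tuple R -> R}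
  {L : limit_object a b Pp Pm}.
Hypotheses (hb : 0 < b) (hab : b < a).
Hypothesis h1 : assumption1 Pp Pm mu rhop rhom.
Hypothesis h2 : assumption2 Pp rhop rhom.
Notation P := (lo_prob L).
Notation M := (Mfun a b rhop rhom).
Notation T := (statistic (L := L) M).
Notation g := (gamma a b).
Notation D := (Delta a b).
Notation kap := (kappa a b).
Notation theta := (theta Pp rhop rhom).
Notation K := (9 / 8 * cgamma a b).

Let g0 : 0 < g. Proof. by have /andP[] := gamma_bounds hb hab. Qed.
Let D0 : 0 < D. Proof. exact: Delta_gt0. Qed.
Let kap0 : 0 < kap. Proof. exact: kappa_gt0. Qed.
Let th0 : 0 < theta := h2.

Let mM k : measurable_fun setT (M k). Proof. exact: measurable_Mfun h1 k. Qed.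
Let mT l : measurable_fun setT (T l). Proof. exact: measurable_statistic. Qed.
Let mS k : measurable_fun setT (feature_sum (L := L) (M k) k).
Proof. exact: measurable_feature_sum. Qed.

Lemma measurable_le_set (f : lo_space L -> R) (c : R) : measurable_fun setT f ->
  measurable [set w | f w <= c].
Proof.
move=> mf; have := mf measurableT `]-oo, c]%classic (measurable_itv _); rewrite setTI.
by congr measurable; apply/seteqP; split => w /=; rewrite in_itv.
Qed.

Lemma measurable_ge_set (f : lo_space L -> R) (c : R) : measurable_fun setT f ->
  measurable [set w | c <= f w].
Proof.
move=> mf; have := mf measurableT `[c, +oo[%classic (measurable_itv _); rewrite setTI.
by congr measurable; apply/seteqP; split => w /=; rewrite in_itv/= andbT.
Qed.

Let mrs := measurable_root_sign (L := L).

Lemma errorE l : error L rhop rhom l = fine (P [set w | root_sign w * T l w <= 0]).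
Proof. by []. Qed.

(** An error at depth [l] is an error at depth [l'], or the signed statistic at [l'] lies in []0,
    delta]], or the two statistics differ by at least [delta]. The depths are not ordered, so the
    bound can be applied both ways. *)
Lemma error_le_error B l l' (delta t : R) : assumption3 Pp rhop rhom B -> 0 < delta ->
  fine (P [set w | delta <= `|root_sign w * (T l' w - T l w)|]) <= t ->
  error L rhop rhom l <= error L rhop rhom l' + (B * delta + t).
Proof.
move=> h3 dl0 close; have B0 : 0 <= B.
  by have [f [_ fB _]] := h3; case/andP: (fB 0) => /le_trans; exact.
rewrite !errorE.
set E := [set w | _ <= 0]; set E' := [set w | _ <= 0].
set E1 := [set w | 0 < root_sign w * T l' w <= delta].
set E2 := [set w | delta <= `|root_sign w * (T l' w - T l w)|] in close *.
have mE : measurable E by apply: measurable_le_set; exact: measurable_funM.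
have mE' : measurable E' by apply: measurable_le_set; exact: measurable_funM.
have mE1 : measurable E1 by exact: measurable_statistic_itv.
have mE2 : measurable E2.
  apply: measurable_ge_set; apply: measurableT_comp => //.
  by apply: measurable_funM => //; exact: measurable_funB.
have conc : fine (P E1) <= B * delta.
  rewrite -lee_fin fineK ?fin_num_measure//.
  rewrite /E1; apply: anticoncentration => // [|y r]; first by rewrite mulr_ge0// ltW.
  by apply: (root_concentration h1) => //; exact: ltW.
apply: le_trans (fine_le_measure P mE (measurableU _ _ mE' (measurableU _ _ mE1 mE2)) _) _.
  move=> w; rewrite /E /E' /E1 /E2 /= => Tl.
  have [Tl'|Tl'] := leP (root_sign w * T l' w) 0; first by left.
  right; have [Td|Td] := leP (root_sign w * T l' w) delta; first by left.
  right; apply: le_trans (ler_norm _); rewrite mulrBr.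
  by move: (root_sign w * T l' w) (root_sign w * T l w) Tl Td Tl' => x y; lra.
apply: le_trans (fine_measureU_le P mE' (measurableU _ _ mE1 mE2)) _.
by rewrite lerD2l; apply: le_trans (fine_measureU_le P mE1 mE2) _; rewrite lerD.
Qed.

Lemma error_close B l l' (delta : R) : kap < 1 -> assumption3 Pp rhop rhom B ->
  (l <= l')%N -> 0 < delta ->
  `|error L rhop rhom l - error L rhop rhom l'| <=
    B * delta + 2 * C1 a b theta * kap ^+ l / delta ^+ 2.
Proof.
move=> kap1 h3 ll' dl0.
have close := statistic_close_tail hb hab h1 h2 kap1 ll' dl0 (L := L).
have e1 := error_le_error h3 dl0 close.
have close' : fine (P [set w | delta <= `|root_sign w * (T l w - T l' w)|]) <=
    2 * C1 a b theta * kap ^+ l / delta ^+ 2.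
  apply: le_trans close; rewrite le_eqVlt; apply/orP; left; apply/eqP.
  congr (fine (P _)); apply/seteqP; split => w /=; by rewrite -normrN -mulrN opprB.
have e2 := error_le_error h3 dl0 close'.
by rewrite ler_norml lerBlDl e1 andbT lerBrDr addrC lerBlDr; rewrite addrC in e2; lra.
Qed.

Section Supercritical.
Hypothesis kap1 : 1 < kap.

(** [p.1] is the mean and [p.2] the variance. The feature noise is at most [K^2] times the mean, and
    the branching part at most the squared mean over [kappa - 1]. *)
Lemma feature_sum_centered k : (0 < k)%N -> exists p : R * R,
  [/\ theta * kap ^+ k <= p.1, p.2 <= p.1 * (K ^+ 2 + p.1 / (kap - 1)) &
   has_int P setT (fun w => (root_sign w * feature_sum (M k) k w - p.1) ^+ 2) p.2].
Proof.
move=> k0; have [m [q [m1 m2 q2 hv]]] := feature_sum_deviation hb hab h1 h2 k0 (L := L).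
have gk0 : 0 < g ^+ k by rewrite exprn_gt0.
have Dk0 : 0 < D ^+ k by rewrite exprn_gt0.
have gDk0 : 0 < (g * D) ^+ k by rewrite exprn_gt0// mulr_gt0.
have gDE : (g * D) ^+ k = g ^+ k * D ^+ k by rewrite exprMn.
have kapE : kap ^+ k = g ^+ k ^+ 2 * D ^+ k by rewrite -kappaX// mulnC exprM.
exists (m * (g * D) ^+ k,
  D ^+ k * (q - m ^+ 2) + m ^+ 2 * label_var (a := a) (b := b) k).
have mu1 : theta * kap ^+ k <= m * (g * D) ^+ k.
  rewrite kapE gDE (_ : theta * _ = g ^+ k * theta * (g ^+ k * D ^+ k)); last first.
    by move: (g ^+ k) (D ^+ k) => x y; ring.
  by rewrite ler_wpM2r//; move: gDk0; rewrite gDE => /ltW.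
split => //=; last first.
  have := hv (m * (g * D) ^+ k); rewrite subrr expr0n addr0.
  by [].
have lv := label_var_closed (a := a) (b := b) k.
have kap10 : 0 < kap - 1 by rewrite subr_gt0.
have lvE : label_var (a := a) (b := b) k <= (g * D) ^+ k ^+ 2 / (kap - 1).
  rewrite ler_pdivlMr// lv mulnC exprM gerBl; exact: ltW.
have Dq : D ^+ k * q <= K ^+ 2 * (m * (g * D) ^+ k).
  apply: (@le_trans _ _ (K ^+ 2 * (theta * kap ^+ k))); last by rewrite ler_wpM2l// sqr_ge0.
  rewrite kapE (_ : K ^+ 2 * _ = D ^+ k * (K ^+ 2 * g ^+ k ^+ 2 * theta)); last first.
    by move: (g ^+ k) (D ^+ k) => x y; ring.
  by rewrite ler_wpM2l ?(ltW Dk0)// -exprM mulnC.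
have mlv : m ^+ 2 * label_var (a := a) (b := b) k <=
    (m * (g * D) ^+ k) * ((m * (g * D) ^+ k) / (kap - 1)).
  rewrite (_ : _ * (_ / _) = m ^+ 2 * ((g * D) ^+ k ^+ 2 / (kap - 1))); last first.
    by move: ((g * D) ^+ k) => x; ring.
  by rewrite ler_wpM2l// sqr_ge0.
move: Dq mlv; move: (m * _) (K ^+ 2) => X K2 Dq mlv.
rewrite (_ : X * _ = K2 * X + X * (X / (kap - 1))); last by rewrite mulrDr [X * K2]mulrC.
rewrite lerD//; apply: le_trans Dq.
by rewrite ler_wpM2l ?(ltW Dk0)// gerBl sqr_ge0.
Qed.

(** With weights equal to the means, the squared deviation of the nonroot sum has expectation at
    most [mt * (l * K^2 + mt / (kappa - 1))]. Division by [(mt / 2)^2] gives the first two terms,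
    the root tail the third. *)
Lemma supercritical_error l : (0 < l)%N ->
  error L rhop rhom l <= 4 * (l%:R * K ^+ 2 / (theta * kap ^+ l)) + 4 / (kap - 1) +
    expR (- (theta / 2 * kap ^+ l)).
Proof.
move=> l0; have kap10 : 0 < kap - 1 by rewrite subr_gt0.
(* The dummy pair at k = 0 lets [choice] select [p] for all k; the root generation is treated by its
   tail. *)
have exp k : exists p : R * R, (0 < k)%N ->
  [/\ theta * kap ^+ k <= p.1, p.2 <= p.1 * (K ^+ 2 + p.1 / (kap - 1)) &
   has_int P setT (fun w => (root_sign w * feature_sum (M k) k w - p.1) ^+ 2) p.2].
  have [->|k0] := posnP k; first by exists (0, 0).
  by have [p ?] := feature_sum_centered k0; exists p.
have [p hp] := choice exp.
pose m k := (p k).1; pose s := index_iota 1 l.+1.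
have sgt0 k : k \in s -> (0 < k)%N by rewrite mem_index_iota => /andP[].
have kapk k : 0 < theta * kap ^+ k by rewrite mulr_gt0// exprn_gt0.
have m0 k : k \in s -> 0 < m k.
  by move=> /sgt0 /hp [+ _ _]; apply: lt_le_trans.
pose mt := \sum_(k <- s) m k.
have mtl : theta * kap ^+ l <= mt.
  have ls : l \in s by rewrite mem_index_iota l0 ltnSn.
  rewrite /mt (big_rem l)//= -[X in X <= _]addr0 lerD//; first by have [] := hp l l0.
  rewrite big_seq sumr_ge0// => k /mem_rem /m0; exact: ltW.
have mt0 : 0 < mt by exact: lt_le_trans (kapk l) mtl.
pose x k w := root_sign w * feature_sum (L := L) (M k) k w - m k.
pose f w := mt * \sum_(k <- s) x k w ^+ 2 / m k.
have hf : has_int P setT f (mt * \sum_(k <- s) (m k)^-1 * (p k).2).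
  apply: has_intZ.
  apply: (@has_int_ext _ _ _ _ _ (fun w => \sum_(k <- s) (m k)^-1 * x k w ^+ 2)).
    by move=> w _; apply: eq_bigr => k _; rewrite mulrC.
  apply: (@has_int_sum _ _ _ _ _ _ _ (fun k w => (m k)^-1 * x k w ^+ 2)) => // k ks.
  by apply: has_intZ; have [] := hp k (sgt0 k ks).
have f0 w : 0 <= f w.
  rewrite mulr_ge0 ?(ltW mt0)// big_seq sumr_ge0// => k ks.
  by rewrite divr_ge0 ?sqr_ge0// ltW// m0.
have TE w : root_sign w * T l w =
    root_sign w * M 0 (feature [::] w) + (\sum_(k <- s) x k w + mt).
  rewrite statistic_recl mulrDr; congr (_ + _).
  rewrite /mt -big_split/= /s big_add1 /= big_mkord mulr_sumr.
  by apply: eq_bigr => k _; rewrite /x subrK.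
(* The root term may be as low as [- sl]. Since [2 * sl <= mt], a nonpositive statistic then still
   forces the nonroot sum to fall short of its mean by [mt / 2]. *)
set sl := theta / 2 * kap ^+ l.
have sl0 : 0 < sl by rewrite /sl mulr_gt0 ?exprn_gt0// divr_gt0.
have slmt : 2 * sl <= mt.
  by apply: le_trans mtl; rewrite /sl le_eqVlt; apply/orP; left; apply/eqP; field.
pose E1 := [set w : lo_space L | root_sign w * M 0 (feature [::] w) <= - sl].
pose E2 := [set w | (mt / 2) ^+ 2 <= (\sum_(k <- s) x k w) ^+ 2].
have mE1 : measurable E1.
  apply: measurable_le_set; apply: measurable_funM => //.
  by apply: measurableT_comp => //; exact: measurable_feature.
have mE2 : measurable E2.
  apply: measurable_ge_set; apply: measurable_funX; apply: measurable_sum => k.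
  by apply: measurable_funB => //; exact: measurable_funM.
have mE : measurable [set w | root_sign w * T l w <= 0].
  by apply: measurable_le_set; exact: measurable_funM.
rewrite errorE.
apply: le_trans (fine_le_measure P mE (measurableU _ _ mE2 mE1) _) _.
  move=> w /=; rewrite TE => h.
  have [e1|e1] := leP (root_sign w * M 0 (feature [::] w)) (- sl); first by right.
  left; rewrite /E2 /=; move: (\sum_(k <- s) x k w) h => z h.
  have hz : mt / 2 <= - z.
    by move: slmt e1 h; move: (root_sign w * M 0 _) (sl) (mt) => y1 y2 y3; lra.
  have m20 : 0 <= mt / 2 by rewrite divr_ge0// ltW.
  by rewrite -[z ^+ 2]sqrrN; apply: lerXn2r; rewrite ?nnegrE// (le_trans m20).
apply: le_trans (fine_measureU_le P mE2 mE1) _.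
rewrite lerD//; last exact: (root_tail D0 h1).
have mt20 : 0 < (mt / 2) ^+ 2 by rewrite exprn_gt0// divr_gt0.
apply: le_trans (markov_has_int mE2 mt20 f0 _ hf) _.
  by move=> w /=; move/le_trans; apply; exact: weighted_cauchy_schwarz.
have sumle : \sum_(k <- s) (m k)^-1 * (p k).2 <= l%:R * K ^+ 2 + mt / (kap - 1).
  apply: (@le_trans _ _ (\sum_(k <- s) (K ^+ 2 + m k / (kap - 1)))).
    rewrite big_seq [X in _ <= X]big_seq; apply: ler_sum => k ks.
    rewrite mulrC ler_pdivrMr ?m0// mulrC.
    by have [] := hp k (sgt0 k ks).
  have e : \sum_(k <- s) K ^+ 2 = l%:R * K ^+ 2.
    by rewrite sum_seq_const size_iota subSS subn0; move: (K ^+ 2) => z; rewrite mulr_natl.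
  by rewrite big_split/= e -mulr_suml.
apply: (@le_trans _ _ (mt * (l%:R * K ^+ 2 + mt / (kap - 1)) / (mt / 2) ^+ 2)).
  by rewrite ler_wpM2r ?invr_ge0 ?(ltW mt20)// ler_wpM2l// ltW.
have -> : mt * (l%:R * K ^+ 2 + mt / (kap - 1)) / (mt / 2) ^+ 2 =
   4 * (l%:R * K ^+ 2 / mt) + 4 / (kap - 1).
  by field; rewrite !gt_eqF.
rewrite lerD2r ler_wpM2l// ler_wpM2l//; first by apply: mulr_ge0 => //; exact: sqr_ge0.
by rewrite lef_pV2 ?posrE.
Qed.

End Supercritical.
End ErrorBounds.

(** * Depth conditions *)

Section DepthConditions.
Context {R : realType}.
Implicit Types (k x y eps : R) (l : nat).

Lemma powRE k x : 0 < k -> k `^ x = expR (x * ln k).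
Proof. by move=> k0; rewrite /powR gt_eqF. Qed.

Lemma powR_half k l : 1 < k -> k `^ (l%:R / 2) = expR (ln k / 2 * l%:R).
Proof. by move=> k1; rewrite powRE ?(lt_trans _ k1)//; congr expR; field. Qed.

Lemma exprE_expR k l : 0 < k -> k ^+ l = expR (ln k * l%:R).
Proof. by move=> k0; rewrite mulrC expRM_natl lnK. Qed.

(** The fourth power is used because the second depth condition is cubic in the depth when [x] is of
    the order of [l]; one power is left to absorb the constants. *)
Lemma expR_ge_quartic : exists2 N : R, 0 < N & forall x, 0 <= x -> x ^+ 4 / N <= expR x.
Proof.
exists (4 ^+ 4); first exact: exprn_gt0.
move=> x x0; have -> : expR x = expR (x / 4) ^+ 4.
  by rewrite -expRM_natl; congr expR; field.
rewrite -expr_div_n; apply: lerXn2r; rewrite ?nnegrE ?expR_ge0 ?divr_ge0//.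
by apply: le_trans (expR_ge1Dx _); rewrite lerDr.
Qed.

Lemma le_expR_ln x y : 0 < x -> (x <= expR y) = (ln x <= y).
Proof. by move=> x0; rewrite -{1}(lnK (x := x)) ?posrE// ler_expR. Qed.

Lemma ln3_ge : 2 / 3 <= ln 3 :> R.
Proof.
rewrite -[ln 3]opprK -lnV_total lerNr.
by apply: le_trans (ln_le_subr1 _) _; [rewrite invr_gt0|lra].
Qed.

Lemma ln_div_ge0 c eps : 1 <= c -> 0 < eps < 1 -> 0 <= ln (c / eps).
Proof.
move=> c1 /andP[e0 e1]; rewrite ln_ge0// ler_pdivlMr// mul1r.
by apply: le_trans (ltW e1) c1.
Qed.

(** The origin of [4 / ln k]. For [l' = l + j] the left side grows by
    [(1 + j / l)^2 <= expR (2 j / l)], and the right side by [k^(j / 2)]; the second factor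
    dominates as soon as [2 / l <= ln k / 2]. *)
Lemma growth_persists k x c l l' : 1 < k -> 0 <= x -> 4 / ln k <= l%:R -> (l <= l')%N ->
  0 <= c -> l%:R ^+ 2 * x <= c * k `^ (l%:R / 2 - 1) ->
  l'%:R ^+ 2 * x <= c * k `^ (l'%:R / 2 - 1).
Proof.
move=> k1 x0 l4 ll' c0; have k0 : 0 < k by exact: lt_trans k1.
have lk : 0 < ln k by rewrite ln_gt0.
have l0 : 0 < l%:R :> R by apply: lt_le_trans l4; rewrite divr_gt0.
have q2 : 2 / l%:R <= ln k / 2.
  rewrite ler_pdivrMr//; move: l4; rewrite ler_pdivrMr// => l4.
  by rewrite mulrAC ler_pdivlMr//; lra.
rewrite !powRE// => h.
have -> : l'%:R = l%:R + (l' - l)%:R :> R by rewrite -natrD subnKC.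
move: (l' - l)%N => j.
have e1 : (l%:R + j%:R) = l%:R * (1 + j%:R / l%:R) :> R by field; rewrite gt_eqF.
have j0 : 0 <= j%:R / l%:R :> R by rewrite divr_ge0// ltW.
have sq : (1 + j%:R / l%:R) ^+ 2 <= expR (j%:R * (ln k / 2)) :> R.
  apply: (@le_trans _ _ (expR (j%:R / l%:R) ^+ 2)).
    apply: lerXn2r; rewrite ?nnegrE ?expR_ge0 ?addr_ge0//.
    exact: expR_ge1Dx.
  rewrite -expRM_natl ler_expR (_ : 2 * _ = j%:R * (2 / l%:R)); last first.
    by field; rewrite gt_eqF.
  by rewrite ler_wpM2l.
rewrite (_ : ((l%:R + j%:R) / 2 - 1) * ln k = (l%:R / 2 - 1) * ln k + j%:R * (ln k / 2));
  last by field.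
rewrite e1 expRD (mulrA c) (_ : _ * x = l%:R ^+ 2 * x * (1 + j%:R / l%:R) ^+ 2); last by ring.
by apply: ler_pM => //; rewrite ?mulr_ge0 ?sqr_ge0.
Qed.

Lemma large_depth_growth k c th : 1 < k -> 0 < c -> 0 < th ->
  exists Z : R, 2 <= Z /\ forall l x, Z <= ln k / 2 * l%:R -> 0 <= x -> x <= ln k / 2 * l%:R ->
    [/\ 4 / ln k <= l%:R, l%:R ^+ 2 * x <= c * k `^ (l%:R / 2 - 1) & x <= th / 2 * k ^+ l].
Proof.
move=> k1 c0 th0; have k0 : 0 < k by exact: lt_trans k1.
have lk : 0 < ln k by rewrite ln_gt0.
set q := ln k / 2; have q0 : 0 < q by rewrite divr_gt0.
have [N N0 quartic] := expR_ge_quartic.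
have cq0 : 0 < c * q ^+ 2 by apply: mulr_gt0 => //; exact: exprn_gt0.
have Z1 : 0 <= N * k / (c * q ^+ 2).
  by apply: divr_ge0; [apply: mulr_ge0|]; exact: ltW.
have Z2 : 0 <= 2 * N / th by apply: divr_ge0; [apply: mulr_ge0|]; rewrite // ltW.
(* One summand for each of the three conclusions, in this order. *)
exists (2 + N * k / (c * q ^+ 2) + 2 * N / th); split.
  by rewrite -addrA lerDl addr_ge0.
move=> l x Zl x0 xl; set u := q * l%:R in Zl xl.
have u2 : 2 <= u by apply: le_trans Zl; rewrite -addrA lerDl addr_ge0.
have u1 : N * k / (c * q ^+ 2) <= u.
  by apply: le_trans Zl; rewrite addrAC lerDr addr_ge0.
have u3 : 2 * N / th <= u by apply: le_trans Zl; rewrite lerDr addr_ge0.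
have u0 : 0 <= u by apply: le_trans u2.
have lE : l%:R = u / q by rewrite /u mulrAC mulfV ?mul1r// gt_eqF.
rewrite ler_pdivrMr// in u1; rewrite ler_pdivrMr// in u3.
have quart := quartic u u0.
split.
- rewrite lE ler_pdivlMr// (_ : _ * q = 2)// /q; field; rewrite gt_eqF//.
- rewrite powRE// mulrBl mul1r expRD expRN lnK ?posrE//.
  rewrite (_ : l%:R / 2 * ln k = u); last by rewrite /u /q; field.
  apply: (@le_trans _ _ (c * (u ^+ 4 / N / k))); last first.
    by rewrite ler_wpM2l ?(ltW c0)// ler_wpM2r ?invr_ge0 ?(ltW k0).
  apply: (@le_trans _ _ (l%:R ^+ 2 * u)); first by rewrite ler_wpM2l// sqr_ge0.
  have -> : c * (u ^+ 4 / N / k) = u ^+ 3 / (N * k * q ^+ 2) * (u * (c * q ^+ 2)).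
    by move: (u) (q) q0 => v z z0; field; rewrite !gt_eqF.
  have -> : l%:R ^+ 2 * u = u ^+ 3 / (N * k * q ^+ 2) * (N * k).
    by rewrite lE; move: (u) (q) q0 => v z z0; field; rewrite !gt_eqF.
  rewrite ler_wpM2l//; apply: divr_ge0; first exact: exprn_ge0.
  by apply: mulr_ge0; [apply: mulr_ge0; exact: ltW|exact: sqr_ge0].
- apply: le_trans xl _; rewrite exprE_expR//.
  apply: (@le_trans _ _ (th / 2 * (u ^+ 4 / N))); last first.
    rewrite ler_wpM2l ?divr_ge0 ?(ltW th0)//; apply: le_trans quart _.
    by rewrite ler_expR /u /q ler_wpM2r// ler_pdivrMr// ler_peMr ?ltW// ltr1n.
  have -> : th / 2 * (u ^+ 4 / N) = u / (2 * N) * (th * u ^+ 3).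
    by field; rewrite gt_eqF.
  rewrite [X in X <= _](_ : u = u / (2 * N) * (2 * N)); last by field; rewrite gt_eqF.
  rewrite ler_wpM2l//; first by apply: divr_ge0 => //; apply: mulr_ge0 => //; exact: ltW.
  apply: le_trans u3 _; rewrite mulrC ler_wpM2l ?(ltW th0)// exprS ler_peMr//.
  by rewrite exprn_ege1// (le_trans _ u2)// ler1n.
Qed.

Lemma cond1E k eps l : 1 < k -> 0 < eps ->
  (6 / eps <= k `^ (l%:R / 2)) = (ln (6 / eps) <= ln k / 2 * l%:R).
Proof. by move=> k1 e0; rewrite powR_half// le_expR_ln// divr_gt0. Qed.

Lemma threshold_pow k A eps l : 0 < k < 1 -> 0 < A -> 0 < eps ->
  3 * ln (A / eps) / ln (1 / k) <= l%:R -> A ^+ 3 * k ^+ l <= eps ^+ 3.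
Proof.
move=> /andP[k0 k1] A0 e0; rewrite div1r lnV ?posrE//.
have lk : 0 < - ln k by rewrite oppr_gt0 ln_lt0// k0.
rewrite ler_pdivrMr// => h.
have X0 : 0 < A / eps by rewrite divr_gt0.
have : (A / eps) ^+ 3 <= k ^- l.
  rewrite (exprE_expR 3 X0) (exprE_expR l k0) -expRN ler_expR.
  by rewrite mulrC -mulNr [X in _ <= X]mulrC.
have kl0 : 0 < k ^+ l by rewrite exprn_gt0.
by rewrite -[k ^- l]mul1r ler_pdivlMr// expr_div_n mulrAC ler_pdivrMr ?exprn_gt0// mul1r.
Qed.

(* The first error term of [supercritical_error], bounded through cond1 and cond2. *)
Lemma supercritical_term k cg th eps l : 1 < k -> 0 < cg -> 0 < th -> th <= 1 -> 0 < eps < 1 ->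
  4 / ln k <= l%:R -> 6 / eps <= k `^ (l%:R / 2) ->
  l%:R ^+ 2 * ln (3 / eps) <= th ^+ 2 / (8 * cg ^+ 2) * (k - 1) * k `^ (l%:R / 2 - 1) ->
  4 * (l%:R * (9 / 8 * cg) ^+ 2 / (th * k ^+ l)) <= eps / 6.
Proof.
move=> k1 cg0 th0 th1 /andP[e0 e1] l4 c1 c2; have k0 : 0 < k by exact: lt_trans k1.
have lk : 0 < ln k by rewrite ln_gt0.
have l0 : 0 < l%:R :> R by apply: lt_le_trans l4; rewrite divr_gt0.
have l1 : 1 <= l%:R :> R by move: l0; rewrite ltr0n ler1n.
set y := k `^ (l%:R / 2) in c1.
have y0 : 0 < y by rewrite powR_gt0.
have yE : k ^+ l = y ^+ 2.
  by rewrite /y powR_half// exprE_expR// -expRM_natl; congr expR; field.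
have c2' : l%:R ^+ 2 * (2 / 3) <= th ^+ 2 / (8 * cg ^+ 2) * y.
  have e30 : ln 3 <= ln (3 / eps) :> R.
    by rewrite ler_ln ?posrE ?divr_gt0// ler_pdivlMr// ler_piMr// ltW.
  apply: (@le_trans _ _ (l%:R ^+ 2 * ln (3 / eps))).
    by rewrite ler_wpM2l ?sqr_ge0//; exact: le_trans ln3_ge e30.
  apply: le_trans c2 _; rewrite -mulrA ler_wpM2l//.
    by rewrite divr_ge0 ?sqr_ge0// mulr_ge0// sqr_ge0.
  have -> : k `^ (l%:R / 2 - 1) = y / k.
    by rewrite /y !powRE// mulrBl mul1r expRD expRN lnK ?posrE.
  by rewrite mulrCA ger_pMr// ler_pdivrMr// mul1r gerBl.
have ll : l%:R <= l%:R ^+ 2 :> R by rewrite expr2 ler_peMr// ltW.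
(* [3/16] is [(3/2) / 8], from the [2/3] below [ln 3] and the 8 in [c0]. It suffices because
   [81/16 * 3/16 = 243/256 < 1]. *)
have main : l%:R * cg ^+ 2 <= 3 / 16 * th * y.
  have h : l%:R * (2 / 3) <= th ^+ 2 / (8 * cg ^+ 2) * y.
    by apply: le_trans c2'; rewrite ler_wpM2r.
  have cg2 : 0 < cg ^+ 2 by rewrite exprn_gt0.
  have : l%:R * (2 / 3) * (8 * cg ^+ 2) <= th ^+ 2 * y.
    by rewrite -ler_pdivlMr ?mulr_gt0// mulrAC.
  have : th ^+ 2 * y <= th * y by rewrite ler_wpM2r ?(ltW y0)// expr2 ler_piMr// ltW.
  by move: (th ^+ 2 * y) (cg ^+ 2) => z1 z2; nra.
rewrite yE; apply: (@le_trans _ _ (1 / y)); last first.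
  rewrite ler_pdivrMr//; move: c1; rewrite ler_pdivrMr//; lra.
rewrite (_ : 4 * _ = 81 / 16 * (l%:R * cg ^+ 2) / (th * y ^+ 2)); last by field; rewrite !gt_eqF.
rewrite ler_pdivrMr ?mulr_gt0 ?exprn_gt0//.
rewrite (_ : 1 / y * _ = th * y); last by field; rewrite gt_eqF.
have : 0 < th * y by rewrite mulr_gt0.
by move: main; move: (l%:R * _) => z main ty; rewrite -mulrA in main; move: (th * y) main ty => w; lra.
Qed.

End DepthConditions.

Section LogarithmicDepth.
Context {R : realType}.

Lemma ln_inv_ge (y eps : R) : 0 < eps -> eps <= expR (- y) -> y <= ln (1 / eps).
Proof.
move=> e0 ey; rewrite div1r lnV_total lerNr -ler_expR lnK ?posrE//.
Qed.

(** For [eps <= expR (- 1)] the logarithm is at least 1 and absorbs the constant [al]. *)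
Lemma bigO_ln_inv (f : R -> R) (al be e0 : R) : 0 <= al -> 0 <= be -> 0 < e0 ->
  (forall eps : R, 0 < eps < e0 -> 0 <= f eps <= al + be * ln (1 / eps)) ->
  f =O_ (at_right (0 : R)) (fun eps => ln (1 / eps) : R).
Proof.
move=> al0 be0 e0_gt0 fle; apply/eqO_exP; exists (al + be + 1); first by rewrite ltr_wpDl ?addr_ge0.
near=> eps.
have eps0 : 0 < eps by near: eps; exact: nbhs_right_gt.
have epse0 : eps < e0 by near: eps; exact: nbhs_right_lt.
have l1 : 1 <= ln (1 / eps).
  by apply: ln_inv_ge => //; near: eps; apply: nbhs_right_le; exact: expR_gt0.
have /andP[f0 fl] : 0 <= f eps <= al + be * ln (1 / eps) by apply: fle; rewrite eps0 epse0.
rewrite ger0_norm// ger0_norm ?(le_trans _ l1)//; apply: le_trans fl _.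
by move: (ln _) l1 => z z1; nra.
Unshelve. all: by end_near. Qed.

Lemma powR_third (n : nat) (x : R) : 0 <= x -> (x `^ (n%:R / 3)) ^+ 3 = x ^+ n.
Proof.
move=> x0; rewrite -powR_mulrn ?powR_ge0// -powRrM -[RHS]powR_mulrn//.
by congr (_ `^ _); field.
Qed.

End LogarithmicDepth.

(** * Convergence and sufficient depth when kappa < 1 *)

Section Subcritical.
Context {R : realType} {d : nat} {a b : R} {Pp Pm : probability (d.-tuple R) R}
  {mu : {measure set (d.-tuple R) -> \bar R}} {rhop rhom : d.-tuple R -> R}.
Hypotheses (hb : 0 < b) (hab : b < a).
Hypothesis h1 : assumption1 Pp Pm mu rhop rhom.
Hypothesis h2 : assumption2 Pp rhop rhom.
Variable B : R.
Hypothesis h3 : assumption3 Pp rhop rhom B.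
Notation kap := (kappa a b).
Hypothesis kap1 : kap < 1.
Notation Cst := (C1 a b (theta Pp rhop rhom)).

Let kap0 : 0 < kap. Proof. exact: kappa_gt0. Qed.

(** A density bounded by 0 would have total mass 0. Positivity is what allows [delta] to be chosen
    proportional to [1 / B]. *)
Lemma assumption3_gt0 : 0 < B.
Proof.
have [f [mf fB fE]] := h3.
rewrite lt_neqAle; apply/andP; split; last by case/andP: (fB 0) => /le_trans; exact.
apply/eqP => B0; have := fE setT measurableT.
rewrite (_ : [set x | _] = setT); last by apply/seteqP; split.
rewrite probability_setT integral0_eq => [[/eqP]|z _]; first by rewrite oner_eq0.
by congr EFin; apply/eqP; rewrite eq_le; have /andP[f0 fl] := fB z; rewrite f0 B0 fl.
Qed.

Let B0 := assumption3_gt0.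

Lemma C1_gt0 : 0 < Cst.
Proof.
rewrite /C1; have : 0 < theta Pp rhop rhom := h2; move: (theta _ _ _) => th th0.
have c2 : 0 < cgamma a b ^+ 2 by apply: exprn_gt0; exact: cgamma_gt0.
apply: divr_gt0; last by rewrite exprn_gt0// subr_gt0.
by apply: mulr_gt0 => //; exact: mulr_gt0.
Qed.

Let C0 := C1_gt0.

Lemma error_cvg (L : limit_object a b Pp Pm) : cvgn (error L rhop rhom).
Proof.
apply/cauchy_cvgP/cauchy_exP => e e0.
pose delta := e / (4 * B).
have dl0 : 0 < delta by rewrite divr_gt0// mulr_gt0.
(* Below this bound on [kappa^N], the second term of [error_close] is at most [e / 4]; the choice of
   [delta] makes the first one [e / 4]. *)
have e2 : 0 < e * delta ^+ 2 / (8 * Cst).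
  by apply: divr_gt0; apply: mulr_gt0 => //; exact: exprn_gt0.
have kapn : `|kap| < 1 by rewrite gtr0_norm.
have [N _ hN] := proj1 (cvgr0Pnorm_lt _) (cvg_expr kapn) _ e2.
exists (error L rhop rhom N); exists N => // n /= Nn; rewrite /ball /=.
apply: le_lt_trans (error_close hb hab h1 h2 kap1 h3 Nn dl0) _.
have := hN N (leqnn N) => /=; rewrite gtr0_norm ?exprn_gt0//.
have C80 : 0 < 8 * Cst by apply: mulr_gt0.
rewrite (ltr_pdivlMr _ _ C80) => kN.
have -> : B * delta = e / 4 by rewrite /delta; field; rewrite gt_eqF.
suff : 2 * Cst * kap ^+ N / delta ^+ 2 <= e / 4 by lra.
rewrite ler_pdivrMr ?exprn_gt0//; move: (delta ^+ 2) (kap ^+ N) kN => x y kN.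
by move: Cst kN => z; lra.
Qed.

Lemma subcritical_depth (L : limit_object a b Pp Pm) eps l : 0 < eps < 1 ->
  3 * ln (3 * B `^ (2 / 3) * Cst `^ (1 / 3) / eps) / ln (1 / kap) <= l%:R ->
  error L rhop rhom l <= limn (error L rhop rhom) + eps.
Proof.
move=> /andP[e0 e1] hl.
have A0 : 0 < 3 * B `^ (2 / 3) * Cst `^ (1 / 3).
  by rewrite mulr_gt0 ?powR_gt0// mulr_gt0 ?powR_gt0.
have k01 : 0 < kap < 1 by rewrite kap0.
have := threshold_pow k01 A0 e0 hl.
have -> : (3 * B `^ (2 / 3) * Cst `^ (1 / 3)) ^+ 3 = 27 * B ^+ 2 * Cst.
  have -> : (3 * B `^ (2 / 3) * Cst `^ (1 / 3)) ^+ 3 =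
      27 * (B `^ (2 / 3)) ^+ 3 * (Cst `^ (1 / 3)) ^+ 3 by ring.
  by rewrite powR_third ?(ltW B0)// (powR_third 1) ?(ltW C0).
(* The terms of [error_close] become [eps / 3] and at most [2 eps / 3], the latter because the cubed
   depth condition reads [27 B^2 C1 kappa^l <= eps^3]. *)
move=> h; pose delta := eps / (3 * B).
have dl0 : 0 < delta by rewrite divr_gt0// mulr_gt0.
have close n : (l <= n)%N -> error L rhop rhom l - eps <= error L rhop rhom n.
  move=> ln; have := error_close (L := L) hb hab h1 h2 kap1 h3 ln dl0.
  have -> : B * delta = eps / 3 by rewrite /delta; field; rewrite gt_eqF.
  have : 2 * Cst * kap ^+ l / delta ^+ 2 <= 2 / 3 * eps.
    rewrite ler_pdivrMr ?exprn_gt0// /delta.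
    rewrite (_ : 2 / 3 * eps * _ = 2 / 27 * eps ^+ 3 / B ^+ 2); last by field; rewrite gt_eqF.
    rewrite ler_pdivlMr ?exprn_gt0//.
    move: h; move: (B ^+ 2) (kap ^+ l) (eps ^+ 3) Cst => x y z w; lra.
  by move: (2 * Cst * _ / _) => z zle; rewrite ler_norml => /andP[_]; lra.
rewrite -lerBlDr; apply: limr_ge; first exact: error_cvg.
by exists l => // n /= /close.
Qed.

Lemma subcritical_log_depth : log_depth_suffices (fun eps l =>
  forall L : limit_object a b Pp Pm, error L rhop rhom l <= limn (error L rhop rhom) + eps).
Proof.
pose A := 3 * B `^ (2 / 3) * Cst `^ (1 / 3).
have A0 : 0 < A by rewrite mulr_gt0 ?powR_gt0// mulr_gt0 ?powR_gt0.
pose thr eps := 3 * ln (A / eps) / ln (1 / kap).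
have lk : 0 < ln (1 / kap) by rewrite div1r lnV ?posrE// oppr_gt0 ln_lt0// kap0.
exists (fun eps => (Num.trunc (thr eps)).+1); split; last first.
  move=> eps l e01 hl L; apply: subcritical_depth => //.
  apply: (@le_trans _ _ (Num.trunc (thr eps)).+1%:R); last by rewrite ler_nat.
  exact/ltW/truncnS_gt.
apply: (@bigO_ln_inv _ _ (3 * `|ln A| / ln (1 / kap) + 1) (3 / ln (1 / kap)) 1) => //.
- by rewrite addr_ge0// divr_ge0 ?mulr_ge0// ltW.
- by rewrite divr_ge0// ltW.
move=> eps e01; rewrite ler0n/=; have /andP[e0 e1] := e01.
have le0 : 0 <= ln (1 / eps) by exact: ln_div_ge0.
have X0 : 0 <= 3 * `|ln A| / ln (1 / kap).
  by apply: divr_ge0; [apply: mulr_ge0|exact: ltW].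
have Y0 : 0 <= 3 / ln (1 / kap) * ln (1 / eps).
  by apply: mulr_ge0 => //; apply: divr_ge0 => //; exact: ltW.
rewrite addrAC; have [t0|t0] := ltP (thr eps) 0.
  have -> : Num.trunc (thr eps) = 0%N.
    by apply/eqP; rewrite -leqn0 truncn_le_nat (lt_trans t0).
  by rewrite lerDr addr_ge0.
rewrite -natr1 lerD2r; have /andP[tl _] := truncn_itv t0.
have lnE : ln (A / eps) = ln A + ln (1 / eps).
  by rewrite div1r lnM ?posrE ?invr_gt0.
apply: le_trans tl _; rewrite /thr lnE mulrDr mulrDl lerD//; last by rewrite mulrAC.
by rewrite ler_wpM2r ?invr_ge0 ?(ltW lk)// ler_wpM2l// ler_norm.
Qed.

End Subcritical.

(** * Admissible depths when kappa > 1 *)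

Section Supercritical.
Context {R : realType} {d : nat} {a b : R} {Pp Pm : probability (d.-tuple R) R}
  {mu : {measure set (d.-tuple R) -> \bar R}} {rhop rhom : d.-tuple R -> R}.
Hypotheses (hb : 0 < b) (hab : b < a).
Hypothesis h1 : assumption1 Pp Pm mu rhop rhom.
Hypothesis h2 : assumption2 Pp rhop rhom.
Notation k := (kappa a b).
Notation th := (theta Pp rhop rhom).
Hypothesis k1 : 1 < k.

Let k0 : 0 < k. Proof. exact: kappa_gt0. Qed.
Let th0 : 0 < th := h2.
Let lk : 0 < ln k. Proof. exact: ln_gt0. Qed.

Lemma c0_gt0 : 0 < c0 a b th * (k - 1).
Proof.
apply: mulr_gt0; last by rewrite subr_gt0.
apply: divr_gt0; first exact: exprn_gt0.
by apply: mulr_gt0 => //; apply: exprn_gt0; exact: cgamma_gt0.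
Qed.

Lemma conditions_persist (eps : R) (l l' : nat) :
  0 < eps < 1 -> 4 / ln k <= l%:R -> (l <= l')%N ->
  [/\ cond1 a b eps l -> cond1 a b eps l',
      cond2 a b th eps l -> cond2 a b th eps l' &
      cond3 a b th eps l -> cond3 a b th eps l'].
Proof.
move=> e01 l4 ll'; split.
- move=> h; apply: le_trans h _; apply: ler_powR; first exact: ltW.
  by rewrite ler_wpM2r// ler_nat.
- apply: growth_persists => //; last exact/ltW/c0_gt0.
  by apply: ln_div_ge0 => //; rewrite ler1n.
- move=> h; apply: le_trans h _; rewrite ler_wpM2l ?divr_ge0 ?(ltW th0)//.
  by rewrite ler_eXn2l.
Qed.

Lemma admissible_persists (eps : R) (l l' : nat) : 0 < eps < 1 -> (l <= l')%N ->
  admissible_depth a b th eps l -> admissible_depth a b th eps l'.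
Proof.
move=> e01 ll' [l4 c1 c2 c3]; have [p1 p2 p3] := conditions_persist e01 l4 ll'.
by split; [apply: le_trans l4 _; rewrite ler_nat|exact: p1|exact: p2|exact: p3].
Qed.

Lemma admissible_le (eps eps' : R) l : 0 < eps' -> eps' <= eps ->
  admissible_depth a b th eps' l -> admissible_depth a b th eps l.
Proof.
move=> e'0 e'e; have e0 := lt_le_trans e'0 e'e.
have ln_le : ln (3 / eps) <= ln (3 / eps').
  by rewrite ler_ln ?posrE ?divr_gt0// ler_pM2l// lef_pV2 ?posrE.
move=> [l4 c1 c2 c3]; split => //.
- by apply: le_trans c1; rewrite ler_pM2l// lef_pV2 ?posrE.
- by apply: le_trans c2; rewrite ler_wpM2l// sqr_ge0.
- by apply: le_trans c3.
Qed.

(** Why the first condition binds: it says that [ln k / 2 * l] is at least [ln (6 / eps)], which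
    exceeds both [ln (3 / eps)] and, for small [eps], the threshold of [large_depth_growth]. *)
Lemma cond1_admissible : exists2 e0 : R, 0 < e0 < 1 & forall (eps : R) l,
  0 < eps <= e0 -> cond1 a b eps l -> admissible_depth a b th eps l.
Proof.
have [Z [Z2 large]] := large_depth_growth k1 c0_gt0 th0.
have Z0 : 0 < Z by exact: lt_le_trans Z2.
have e01 : 0 < expR (- Z) < 1 by rewrite expR_gt0 expR_lt1 oppr_lt0.
exists (expR (- Z)) => // eps l /andP[e0 ele] c1.
have e1 : eps < 1 by apply: le_lt_trans ele _; case/andP: e01.
have c1' := c1; rewrite /cond1 cond1E// in c1'.
have Zle : Z <= ln (6 / eps).
  apply: le_trans (ln_inv_ge e0 ele) _.
  by rewrite ler_ln ?posrE ?divr_gt0// ler_pM2r ?invr_gt0// ler1n.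
have x0 : 0 <= ln (3 / eps) by apply: ln_div_ge0; rewrite ?e0// ler1n.
have x1 : ln (3 / eps) <= ln k / 2 * l%:R.
  apply: le_trans c1'; rewrite ler_ln ?posrE ?divr_gt0// ler_pM2r ?invr_gt0//.
  by rewrite ler_nat.
by have [] := large l _ (le_trans Zle c1') x0 x1; split.
Qed.

Lemma exists_cond1 (eps : R) : 0 < eps < 1 ->
  exists2 l, cond1 a b eps l & l%:R <= 2 * (ln (6 / eps) / ln k) + 1.
Proof.
move=> /andP[e0 e1]; set x := 2 * _.
have x0 : 0 <= x.
  rewrite mulr_ge0// divr_ge0 ?(ltW lk)//.
  by apply: ln_div_ge0; rewrite ?e0// ler1n.
have /andP[tl tu] := truncn_itv x0.
exists (Num.trunc x).+1; last by rewrite -natr1 lerD2r.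
rewrite /cond1 cond1E//; apply: (@le_trans _ _ (ln k / 2 * x)).
  by rewrite /x le_eqVlt; apply/orP; left; apply/eqP; field; rewrite gt_eqF.
by rewrite ler_wpM2l ?ltW// divr_gt0.
Qed.

Lemma exists_smallest (eps : R) : 0 < eps < 1 ->
  exists l, smallest_admissible a b th eps l.
Proof.
move=> /andP[e0 e1]; have [e' /andP[e'0 e'1] adm] := cond1_admissible.
(* For larger [eps] an admissible depth is taken from a smaller tolerance, the conditions being
   monotone in [eps]. *)
have m0 : 0 < Num.min eps e' by rewrite lt_min e0.
have m1 : Num.min eps e' < 1 by rewrite gt_min e1.
have m01 : 0 < Num.min eps e' < 1 by rewrite m0.
have [l c1 _] := exists_cond1 m01.
have exl : exists l, `[< admissible_depth a b th eps l >].
  exists l; apply/asboolP; apply: (@admissible_le _ (Num.min eps e')) => //.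
    by rewrite ge_min lexx.
  by apply: adm => //; rewrite m0 ge_min lexx orbT.
exists (ex_minn exl); case: ex_minnP => n /asboolP nadm nmin; split => // l' l'adm.
by apply: nmin; exact/asboolP.
Qed.

(** The terms of [supercritical_error] are at most [eps / 6], [4 / (k - 1)] and [eps / 3]; the last
    uses [cond3]. *)
Lemma supercritical_depth (L : limit_object a b Pp Pm) (eps : R) l : 0 < eps < 1 ->
  admissible_depth a b th eps l -> error L rhop rhom l <= 16 / (k - 1) + eps.
Proof.
move=> e01 [l4 c1 c2 c3]; have /andP[e0 e1] := e01.
have l0 : (0 < l)%N.
  by rewrite -(ltr_nat R); apply: lt_le_trans l4; rewrite divr_gt0.
apply: le_trans (supercritical_error hb hab h1 h2 k1 l0) _.
have t1 := supercritical_term k1 (cgamma_gt0 hb hab) th0 (theta_le1 h1) e01 l4 c1 c2.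
have t2 : expR (- (th / 2 * k ^+ l)) <= eps / 3.
  apply: (@le_trans _ _ (expR (- ln (3 / eps)))); first by rewrite ler_expR lerN2.
  by rewrite -lnV_total lnK ?posrE ?invr_gt0 ?divr_gt0// invf_div.
have t3 : 4 / (k - 1) <= 16 / (k - 1).
  by rewrite ler_pM2r ?invr_gt0 ?subr_gt0// ler_nat.
apply: le_trans (lerD (lerD t1 t3) t2) _.
by move: (16 / (k - 1)) => z; lra.
Qed.

(** For small [eps] the depth [ell1 eps] is the least one satisfying [cond1], so it exceeds
    [2 ln (6 / eps) / ln k] by at most 1. This bounded difference is [O(ln ln (1 / eps))]. *)
Lemma supercritical_regime :
  (exists ell1 : R -> nat,
      [/\ forall eps : R, 0 < eps < 1 ->
            smallest_admissible a b th eps (ell1 eps),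
          forall (L : limit_object a b Pp Pm) (eps : R) (l : nat),
            0 < eps < 1 -> (ell1 eps <= l)%N ->
            error L rhop rhom l <= 16 / (k - 1) + eps &
          (fun eps => (ell1 eps)%:R - 2 * (ln (6 / eps) / ln k) : R)
            =O_ (at_right (0 : R)) (fun eps => ln (ln (1 / eps)) : R)]) /\
  (\forall eps \near (0 : R)^'+, forall l : nat,
     cond1 a b eps l -> admissible_depth a b th eps l) /\
  log_depth_suffices (fun eps l => forall L : limit_object a b Pp Pm,
    error L rhop rhom l <= 16 / (k - 1) + eps).
Proof.
have ex eps : exists l, 0 < eps < 1 -> smallest_admissible a b th eps l.
  have [e01|] := boolP (0 < eps < 1); last by exists 0%N.
  by have [l ?] := exists_smallest e01; exists l.
have [ell1 hell] := choice ex.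
have [e0 /andP[e0_gt0 e0_lt1] adm] := cond1_admissible.
have bounds eps : 0 < eps < e0 -> 2 * (ln (6 / eps) / ln k) <= (ell1 eps)%:R <=
    2 * (ln (6 / eps) / ln k) + 1.
  move=> /andP[eps0 epse0]; have e01 : 0 < eps < 1 by rewrite eps0 (lt_trans epse0).
  have [[_ c1 _ _] smallest] := hell _ e01.
  apply/andP; split.
    move: c1; rewrite /cond1 cond1E// => c1.
    rewrite mulrA ler_pdivrMr//; move: (ln k) (ln (6 / eps)) c1 => x y; lra.
  have [l c1l lle] := exists_cond1 e01; apply: le_trans lle.
  by rewrite ler_nat; apply: smallest; apply: adm => //; rewrite eps0 ltW.
have good (L : limit_object a b Pp Pm) eps l : 0 < eps < 1 -> (ell1 eps <= l)%N ->
    error L rhop rhom l <= 16 / (k - 1) + eps.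
  move=> e01 hl; apply: supercritical_depth => //.
  by apply: admissible_persists hl _ => //; case: (hell _ e01).
split; [|split].
- exists ell1; split => //.
  apply/eqO_exP; exists 1 => //; near=> eps.
  have eps0 : 0 < eps by near: eps; exact: nbhs_right_gt.
  have epse0 : eps < e0 by near: eps; exact: nbhs_right_lt.
  (* For [eps <= expR (- expR 1)] the iterated logarithm is at least 1 and dominates the
     difference. *)
  have l1 : expR 1 <= ln (1 / eps).
    by apply: ln_inv_ge => //; near: eps; apply: nbhs_right_le; exact: expR_gt0.
  have ll1 : 1 <= ln (ln (1 / eps)).
    by rewrite -ler_expR lnK// posrE (lt_le_trans (expR_gt0 1)).
  rewrite mul1r [X in _ <= X]ger0_norm; last exact: le_trans ler01 ll1.
  have /andP[b1 b2] : 2 * (ln (6 / eps) / ln k) <= (ell1 eps)%:R <=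
    2 * (ln (6 / eps) / ln k) + 1 by apply: bounds; rewrite eps0 epse0.
  apply: le_trans ll1; rewrite ger0_norm ?subr_ge0//.
  by rewrite lerBlDl.
- near=> eps => l; apply: adm; apply/andP; split.
    by near: eps; exact: nbhs_right_gt.
  by near: eps; exact: nbhs_right_le.
- exists ell1; split; last by move=> eps l e01 hl L; exact: good.
  apply: (@bigO_ln_inv _ _ (2 * (ln 6 / ln k) + 1) (2 / ln k) e0) => //.
  + apply: addr_ge0 => //; apply: mulr_ge0 => //; apply: divr_ge0; last exact: ltW.
    by rewrite ln_ge0// ler1n.
  + by apply: divr_ge0 => //; exact: ltW.
  move=> eps epsb; rewrite ler0n /=; have /andP[eps0 _] := epsb.
  have /andP[_ b2] := bounds _ epsb; apply: le_trans b2 _.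
  have -> : ln (6 / eps) = ln 6 + ln (1 / eps) by rewrite div1r lnM ?posrE ?invr_gt0.
  rewrite le_eqVlt; apply/orP; left; apply/eqP.
  by field; rewrite gt_eqF.
Unshelve. all: by end_near. Qed.

End Supercritical.
Theorem corollary3p5 (R : realType) (d : nat) (a b : R)
    (Pp Pm : probability (d.-tuple R) R)
    (mu : {measure set (d.-tuple R) -> \bar R})
    (rhop rhom : d.-tuple R -> R)
    (hb : 0 < b) (hab : b < a) (hDelta : 1 < Delta a b)
    (h1 : assumption1 Pp Pm mu rhop rhom)
    (h2 : assumption2 Pp rhop rhom) :
  let k := kappa a b in
  let th := theta Pp rhop rhom in
  (forall B : R, k < 1 -> assumption3 Pp rhop rhom B ->
    [/\ forall L : limit_object a b Pp Pm, cvgn (error L rhop rhom),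
        forall (L : limit_object a b Pp Pm) (eps : R) (l : nat),
          0 < eps < 1 ->
          3 * ln (3 * B `^ (2 / 3) * C1 a b th `^ (1 / 3) / eps) / ln (1 / k)
            <= l%:R ->
          error L rhop rhom l <= limn (error L rhop rhom) + eps &
        log_depth_suffices (fun eps l => forall L : limit_object a b Pp Pm,
          error L rhop rhom l <= limn (error L rhop rhom) + eps)])
  /\
  (1 < k ->
    (exists ell1 : R -> nat,
      [/\ forall eps : R, 0 < eps < 1 ->
            smallest_admissible a b th eps (ell1 eps),
          forall (L : limit_object a b Pp Pm) (eps : R) (l : nat),
            0 < eps < 1 -> (ell1 eps <= l)%N ->
            error L rhop rhom l <= 16 / (k - 1) + eps &
          (fun eps => (ell1 eps)%:R - 2 * (ln (6 / eps) / ln k) : R)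
            =O_ (at_right (0 : R)) (fun eps => ln (ln (1 / eps)) : R)]) /\
    (forall (eps : R) (l l' : nat),
       0 < eps < 1 -> 4 / ln k <= l%:R -> (l <= l')%N ->
       [/\ cond1 a b eps l -> cond1 a b eps l',
           cond2 a b th eps l -> cond2 a b th eps l' &
           cond3 a b th eps l -> cond3 a b th eps l']) /\
    (\forall eps \near (0 : R)^'+, forall l : nat,
       cond1 a b eps l -> admissible_depth a b th eps l) /\
    log_depth_suffices (fun eps l => forall L : limit_object a b Pp Pm,
      error L rhop rhom l <= 16 / (k - 1) + eps)).
Proof.
move=> k th; split.
  move=> B k1 h3; split.
  - by move=> L; exact: (error_cvg hb hab h1 h2 h3 k1).
  - by move=> L eps l; exact: (subcritical_depth hb hab h1 h2 h3 k1).
  - exact: (subcritical_log_depth hb hab h1 h2 h3 k1).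
move=> k1; have [ell1 [near_adm log_depth]] := supercritical_regime hb hab h1 h2 k1.
split; [exact: ell1|split; [|split]].
- by move=> eps l l'; exact: (conditions_persist hb hab h2 k1).
- exact: near_adm.
- exact: log_depth.
Qed.
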